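(* Let $T>0$ and let $f\colon[0,T]\times\mathbb{R}^n\to\mathbb{R}$ satisfy Assumptions 1--4 listed in the context. Let $y_0\in\mathbb{R}^n$ be such that $\nabla_x f(0,y_0)=0$ and $\nabla_x^2 f(0,y_0)$ is positive definite. Let $0=t_0<t_1<\dots<t_{k-1}<t_k=T$, the functions $u_i$, $v_i$, the points $x_i$, $y_i$ and the piecewise $C^2$ function $u$ with $u(0)=y_0$ be those associated with $y_0$ as described in the context. For every $\varepsilon>0$ let $u_\varepsilon\colon[0,T]\to\mathbb{R}^n$ be the solution of $$\varepsilon\dot u_\varepsilon(t)=-\nabla_x f(t,u_\varepsilon(t)),\qquad u_\varepsilon(0)=y_\varepsilon,$$ where $y_\varepsilon\in\mathbb{R}^n$. If $y_\varepsilon\to y_0$ as $\varepsilon\to0$, then, as $\varepsilon\to 0$: (i) $u_\varepsilon\to u$ uniformly on compact subsets of $[0,T]\setminus\{t_1,\dots,t_k\}$. (ii) For every $i=1,\dots,k-1$ there exist times $t^i_\varepsilon$ with $t^i_\varepsilon\to t_i$ as $\varepsilon\to0$ such that $$v^i_\varepsilon(s):=u_\varepsilon(t^i_\varepsilon+\varepsilon s)\to v_i(s)\quad\text{uniformly on compact subsets of }\mathbb{R}.$$ (iii) Setting $\gamma_i:=v_i(\mathbb{R})\cup\{x_i,y_i\}$ and $G:=\mathrm{graph}(u)\cup\bigcup_{i=1}^{k-1}(\{t_i\}\times\gamma_i)$, one has $$\mathrm{dist}\big((t,u_\varepsilon(t)),G\big)\to0\quad\text{as }\varepsilon\to0,\text{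 uniformly for }t\in[0,T].$$
   Context: $\nabla_x f$ and $\nabla_x^2 f$ denote the gradient and the Hessian of $f$ with respect to $x\in\mathbb{R}^n$; $f_t$ is the partial derivative in $t$. A point $x$ is a critical point of $f(t,\cdot)$ if $\nabla_x f(t,x)=0$; it is degenerate if moreover $\det\nabla_x^2 f(t,x)=0$. Put $Z_f:=\{(t,\xi)\in[0,T]\times\mathbb{R}^n:\ \nabla_x f(t,\xi)=0,\ \det\nabla_x^2 f(t,\xi)=0\}$. Assumption 1: $f$ is of class $C^3$ and there are $a_0\ge0$, $c_0>0$ with $\nabla_x f(t,x)\cdot x\ge c_0|x|^2-a_0$ for all $(t,x)\in[0,T]\times\mathbb{R}^n$. Assumption 2: $Z_f$ is finite, the projection $\Pi\colon Z_f\to[0,T]$, $\Pi(t,\xi)=t$, is injective, and $0,T\notin\Pi(Z_f)$. Assumption 3: for every $(\tau,\xi)\in Z_f$ with $\nabla_x^2 f(\tau,\xi)$ positive semidefinite there is $\ell\in\mathbb{R}^n\setminus\{0\}$ such that (a) $\ker\nabla_x^2 f(\tau,\xi)=\mathrm{span}(\ell)$; (b) $\nabla_x f_t(\tau,\xi)\cdot\ell\ne0$; (c) $\sum_{i,j,k}f_{x_ix_jx_k}(\tau,\xi)\ell_i\ell_j\ell_k\ne0$. Assumption 4: for every $(\tau,\xi)\in Z_f$ with $\nabla_x^2 f(\tau,\xi)$ positive semidefinite, let $w$ be the unique (up to time-translations) nonconstant solution of $\dot w(s)=-\nabla_x f(\tau,w(s))$ with $\lim_{s\to-\infty}w(s)=\xi$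 (existence and uniqueness follow from the previous assumptions, as does the existence of $w_\infty:=\lim_{s\to+\infty}w(s)$). Then $\nabla_x^2 f(\tau,w_\infty)$ is positive definite. Construction of $u$: under Assumptions 1--4, given $y_0$ with $\nabla_x f(0,y_0)=0$ and $\nabla_x^2 f(0,y_0)$ positive definite, there exist unique times $0=t_0<t_1<\dots<t_k=T$, unique $C^2$ functions $u_i\colon[t_{i-1},t_i)\to\mathbb{R}^n$ ($i=1,\dots,k$) and $C^2$ functions $v_i\colon\mathbb{R}\to\mathbb{R}^n$ ($i=1,\dots,k-1$), unique up to time-translations, such that: (1) $u_1(0)=y_0$; (2) for $t\in[t_{i-1},t_i)$, $\nabla_x f(t,u_i(t))=0$ and $\nabla_x^2 f(t,u_i(t))$ is positive definite; (3) the limits $x_i:=\lim_{t\to t_i^-}u_i(t)$ exist for $i=1,\dots,k$, and for $i=1,\dots,k-1$ one has $(t_i,x_i)\in Z_f$, $\nabla_x^2 f(t_i,x_i)$ is positive semidefinite, and the two nonzero numbers in (b) and (c) of Assumption 3 at $(t_i,x_i)$ (computed with the same $\ell$) have the same sign; (4) for $i=1,\dots,k-1$, $\dot v_i(s)=-\nabla_x f(t_i,v_i(s))$, $\lim_{s\to-\infty}v_i(s)=x_i$ and $\lim_{s\to+\infty}v_i(s)=u_{i+1}(t_i)$. Put $y_i:=u_{i+1}(t_i)$ for $i=0,\dots,k-1$. The function $u$ is defined by $u:=u_i$ on $[t_{i-1},t_i)$, $i=1,\dots,k$, and $u(T):=x_k$. For every $\varepsilon>0$ and every initial datum, the Cauchy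 problem for $\varepsilon\dot u_\varepsilon=-\nabla_x f(t,u_\varepsilon)$ has a unique solution on the whole of $[0,T]$. For each compact subset of $\mathbb{R}$ the function $v^i_\varepsilon$ is defined on it for $\varepsilon$ small. *)

(* Defs.v *)
From HB Require Import structures.
From mathcomp Require Export all_boot all_order all_algebra.
From mathcomp Require Export all_classical all_reals all_analysis.

Set Implicit Arguments.
Unset Strict Implicit.
Unset Printing Implicit Defensive.

Export Order.TTheory GRing.Theory Num.Theory.
Export numFieldNormedType.Exports.

#[global] Open Scope classical_set_scope.
#[global] Open Scope ring_scope.

Section Euclidean.
Context {R : realType} {n : nat}.
Implicit Types x y : 'rV[R]_n.

Definition dotv x y : R := \sum_(i < n) x ord0 i * y ord0 i.

(* The library norm on row vectors is the sup norm; the Euclidean norm is used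
   wherever a length or a distance enters quantitatively. *)
Definition euclid_norm x : R := Num.sqrt (dotv x x).

Definition euclid_dist (p q : R * 'rV[R]_n) : R :=
  Num.sqrt ((p.1 - q.1) ^+ 2 + euclid_norm (p.2 - q.2) ^+ 2).

Definition dist_to (p : R * 'rV[R]_n) (G : set (R * 'rV[R]_n)) : R :=
  inf [set euclid_dist p q | q in G].

Definition posdef (H : 'M[R]_n) : Prop :=
  forall x, x != 0 -> 0 < dotv (x *m H) x.

Definition possemidef (H : 'M[R]_n) : Prop :=
  forall x, 0 <= dotv (x *m H) x.

End Euclidean.

(* Derivatives of a curve relative to a set A of times: the increments h are
   restricted to those with h + t in A, so derivatives are one-sided at the
   end points of an interval A, and values of g outside A play no role. *)
Section CurveDerivatives.
Context {R : realType} {V : normedModType R}.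
Implicit Types (A : set R) (g : R -> V).

Definition derivable_in A g (t : R) : Prop :=
  cvg (h^-1 *: (g (h + t) - g t) @[h --> within [set h | A (h + t)] 0^']).

Definition derive_in A g (t : R) : V :=
  lim (h^-1 *: (g (h + t) - g t) @[h --> within [set h | A (h + t)] 0^']).

Fixpoint class_C_curve (k : nat) A g : Prop :=
  {within A, continuous g} /\
  match k with
  | 0 => True
  | k'.+1 => (forall t, A t -> derivable_in A g t) /\
             class_C_curve k' A (derive_in A g)
  end.

End CurveDerivatives.

Section SpaceDerivatives.
Context {R : realType} {n : nat}.
Implicit Types g : 'rV[R]_n -> R.

Definition partial (i : 'I_n) g (x : 'rV[R]_n) : R := 'D_(delta_mx ord0 i) g x.

Definition grad g (x : 'rV[R]_n) : 'rV[R]_n := \row_i partial i g x.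

Definition hess g (x : 'rV[R]_n) : 'M[R]_n :=
  \matrix_(i, j) partial i (partial j g) x.

Definition third_form g (x l : 'rV[R]_n) : R :=
  \sum_(i < n) \sum_(j < n) \sum_(k < n)
    partial i (partial j (partial k g)) x * l ord0 i * l ord0 j * l ord0 k.

End SpaceDerivatives.

Section Potential.
Context {R : realType} {n : nat}.
Variable T : R.
Implicit Types f : R -> 'rV[R]_n -> R.

Definition dtime f (t : R) (x : 'rV[R]_n) : R :=
  derive_in `[0, T] (f ^~ x) t.

(* Class C^k on [0, T] x R^n: all iterated partial derivatives of order at most
   k (one-sided in time at 0 and T) exist and are continuous on the slab. *)
Fixpoint class_C (k : nat) f : Prop :=
  {within [set p : R * 'rV[R]_n | p.1 \in `[0, T]],
     continuous (fun p : R * 'rV[R]_n => f p.1 p.2)} /\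
  match k with
  | 0 => True
  | k'.+1 =>
    [/\ forall t x, t \in `[0, T] -> derivable_in `[0, T] (f ^~ x) t,
        forall t x i, t \in `[0, T] -> derivable (f t) x (delta_mx ord0 i),
        class_C k' (dtime f)
      & forall i, class_C k' (fun t => partial i (f t))]
  end.

Definition degenerate f : set (R * 'rV[R]_n) :=
  [set p | [/\ p.1 \in `[0, T], grad (f p.1) p.2 = 0
             & \det (hess (f p.1) p.2) = 0]].

Definition mixed_form f (tau : R) (xi l : 'rV[R]_n) : R :=
  dotv (grad (dtime f tau) xi) l.

(* The row kernel [kermx] is the usual kernel, the Hessian of a C^3 function
   being symmetric. *)
Definition fold_direction f (tau : R) (xi l : 'rV[R]_n) : Prop :=
  [/\ l != 0,
      (kermx (hess (f tau) xi) :=: l)%MS,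
      mixed_form f tau xi l != 0
    & third_form (f tau) xi l != 0].

Definition gradient_flow f (tau : R) (w : R -> 'rV[R]_n) : Prop :=
  forall s : R, is_derive s 1 w (- grad (f tau) (w s)).

Definition assumption1 f : Prop :=
  class_C 3 f /\
  exists a0 c0 : R, [/\ 0 <= a0, 0 < c0 &
    forall t x, t \in `[0, T] ->
      dotv (grad (f t) x) x >= c0 * euclid_norm x ^+ 2 - a0].

Definition assumption2 f : Prop :=
  [/\ finite_set (degenerate f),
      {in degenerate f &, injective fst},
      ~ (fst @` degenerate f) 0
    & ~ (fst @` degenerate f) T].

Definition assumption3 f : Prop :=
  forall tau xi, degenerate f (tau, xi) -> possemidef (hess (f tau) xi) ->
  exists l, fold_direction f tau xi l.

(* Under the previous assumptions w exists, is unique up to time translations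
   and has a limit at +oo, so quantifying universally over w and its limit
   amounts to speaking of "the" orbit and its limit. *)
Definition assumption4 f : Prop :=
  forall tau xi, degenerate f (tau, xi) -> possemidef (hess (f tau) xi) ->
  forall (w : R -> 'rV[R]_n) (winf : 'rV[R]_n),
    gradient_flow f tau w ->
    ~ (exists c, forall s, w s = c) ->
    w s @[s --> -oo] --> xi ->
    w s @[s --> +oo] --> winf ->
    posdef (hess (f tau) winf).

(* The indices are those of the mathematical text: t_ i for 0 <= i <= k, u_ i
   and x_ i for 1 <= i <= k, v_ i for 1 <= i <= k - 1; other values are junk.
   The data are determined by f and y0 up to time translations of the v_ i. *)
Record limit_evolution f (y0 : 'rV[R]_n) (k : nat) (t_ : nat -> R)
    (u_ v_ : nat -> R -> 'rV[R]_n) (x_ : nat -> 'rV[R]_n)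
    (u : R -> 'rV[R]_n) : Prop := LimitEvolution {
  le_t0 : t_ 0%N = 0;
  le_tk : t_ k = T;
  le_t_incr : forall i, (i < k)%N -> t_ i < t_ i.+1;
  le_u_C2 : forall i, (0 < i <= k)%N ->
    class_C_curve 2 `[t_ i.-1, t_ i[ (u_ i);
  le_v_C2 : forall i, (0 < i < k)%N -> class_C_curve 2 setT (v_ i);
  le_init : u_ 1%N 0 = y0;
  le_crit : forall i, (0 < i <= k)%N -> forall t, t \in `[t_ i.-1, t_ i[ ->
    grad (f t) (u_ i t) = 0 /\ posdef (hess (f t) (u_ i t));
  le_x_lim : forall i, (0 < i <= k)%N ->
    u_ i t @[t --> (t_ i)^'-] --> x_ i;
  le_x_fold : forall i, (0 < i < k)%N ->
    [/\ degenerate f (t_ i, x_ i),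
        possemidef (hess (f (t_ i)) (x_ i))
      & exists l, fold_direction f (t_ i) (x_ i) l /\
          Num.sg (mixed_form f (t_ i) (x_ i) l) =
          Num.sg (third_form (f (t_ i)) (x_ i) l)];
  le_v_flow : forall i, (0 < i < k)%N ->
    [/\ gradient_flow f (t_ i) (v_ i),
        v_ i s @[s --> -oo] --> x_ i
      & v_ i s @[s --> +oo] --> u_ i.+1 (t_ i)];
  le_u_pieces : forall i, (0 < i <= k)%N ->
    forall t, t \in `[t_ i.-1, t_ i[ -> u t = u_ i t;
  le_u_end : u T = x_ k
}.

Definition perturbed_solution f (eps : R) (yeps : 'rV[R]_n)
    (ueps : R -> 'rV[R]_n) : Prop :=
  ueps 0 = yeps /\
  forall t, t \in `[0, T] ->
    derivable_in `[0, T] ueps t /\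
    eps *: derive_in `[0, T] ueps t = - grad (f t) (ueps t).

Definition limit_graph (k : nat) (t_ : nat -> R)
    (u_ v_ : nat -> R -> 'rV[R]_n) (x_ : nat -> 'rV[R]_n)
    (u : R -> 'rV[R]_n) : set (R * 'rV[R]_n) :=
  let y_ i := u_ i.+1 (t_ i) in
  let gamma i := range (v_ i) `|` [set x_ i; y_ i] in
  [set (t, u t) | t in `[0, T]] `|`
  \bigcup_(i in [set i | (0 < i < k)%N]) ([set t_ i] `*` gamma i).

End Potential.

(* Main.v *)
(* Let F = grad f(t,.).  Along a branch of nondegenerate minima F is strongly
   monotone, so |u_eps - u_i|^2 obeys a differential inequality which traps
   u_eps in any small tube around u_i, up to times close to t_i.

   At a fold (tau, xi) with unit kernel vector l, write p for the coordinate
   along l.  The orbit v leaves xi tangentially to l (the transverse part is at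
   most K p^2), so its trace is the graph of a curve c over p.  The deviation
   D = u - c(p(u)) contracts at a fixed rate in fast time.  In the window
   |t - tau| <= k r^2 the perturbation of F has size O(r^2), so the region
   { p >= - r, |D| <= K3 r^2 } is invariant; the sign condition on the mixed
   and cubic forms makes p increase, and for eps small u_eps exits at a fixed
   level p = delta, that is, near a fixed point v(s0), before the window ends.
   From there Gronwall's inequality in fast time follows v, forwards into the
   basin of the next branch and backwards for the profile.  At t = T no fold
   occurs and x_k is a nondegenerate minimum, so the tube argument reaches T.
   Compactness of [0, T] makes the local estimates uniform. *)
Require Import Defs.
From mathcomp Require Import ring lra.

Set Implicit Arguments.
Unset Strict Implicit.
Unset Printing Implicit Defensive.

(** * Euclidean geometry and barriers *)

(** No centre manifold is constructed. The powers of [r] balance as follows. At [p = - r] the cubic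
    drift, of order [r^2], has to beat the time perturbation, which before [tau] has the wrong sign
    to first order; this limits the window to a multiple of [r^2]. After [tau] the mixed form pushes
    [p] with a force of order [r^2], while the coupling to the deviation costs only the square of
    its bound, of order [r^4]. So [r] is fixed first and [eps] afterwards, and no rate in [eps] is
    extracted. The exit time is then known only to lie in the window: the induction over the stages
    has to work with starting times that tend to [t_ i.-1], and the reference point [v s0] has to be
    fixed before any tolerance, so that one family of times serves all of them. *)

Section Dot.
Context {R : realType} {n : nat}.
Implicit Types (x y z : 'rV[R]_n) (a : R).

Lemma dotvC x y : dotv x y = dotv y x.
Proof. by apply: eq_bigr => i _; rewrite mulrC. Qed.

Lemma dotvDl x y z : dotv (x + y) z = dotv x z + dotv y z.
Proof. by rewrite /dotv -big_split; apply: eq_bigr => i _; rewrite mxE mulrDl. Qed.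

Lemma dotvZl a x y : dotv (a *: x) y = a * dotv x y.
Proof. by rewrite /dotv mulr_sumr; apply: eq_bigr => i _; rewrite mxE mulrA. Qed.

Lemma dotvDr x y z : dotv x (y + z) = dotv x y + dotv x z.
Proof. by rewrite dotvC dotvDl !(dotvC x). Qed.

Lemma dotvZr a x y : dotv x (a *: y) = a * dotv x y.
Proof. by rewrite dotvC dotvZl (dotvC x). Qed.

Lemma dotvNl x y : dotv (- x) y = - dotv x y.
Proof. by rewrite -scaleN1r dotvZl mulN1r. Qed.

Lemma dotvNr x y : dotv x (- y) = - dotv x y.
Proof. by rewrite dotvC dotvNl dotvC. Qed.

Lemma dotvBl x y z : dotv (x - y) z = dotv x z - dotv y z.
Proof. by rewrite dotvDl dotvNl. Qed.

Lemma dotvBr x y z : dotv x (y - z) = dotv x y - dotv x z.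
Proof. by rewrite dotvDr dotvNr. Qed.

Lemma dotv0l x : dotv 0 x = 0.
Proof. by rewrite -(scale0r 0) dotvZl mul0r. Qed.

Lemma dotv0r x : dotv x 0 = 0.
Proof. by rewrite dotvC dotv0l. Qed.

Lemma dotvv_ge0 x : 0 <= dotv x x.
Proof. by apply: sumr_ge0 => i _; rewrite -expr2 sqr_ge0. Qed.

Lemma euclid_norm_ge0 x : 0 <= euclid_norm x.
Proof. exact: sqrtr_ge0. Qed.

Lemma euclid_norm_sqr x : euclid_norm x ^+ 2 = dotv x x.
Proof. by rewrite sqr_sqrtr// dotvv_ge0. Qed.

Lemma dotv_le x y : dotv x y <= euclid_norm x * euclid_norm y.
Proof.
have [a0|] := eqVneq (euclid_norm y) 0.
  have y0 : forall i, y ord0 i = 0.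
    have/eqP : dotv y y = 0 by rewrite -euclid_norm_sqr a0 expr0n.
    rewrite /dotv psumr_eq0 => [/allP h i|i _]; last by rewrite -expr2 sqr_ge0.
    by have /implyP/(_ isT) := h i (mem_index_enum i); rewrite mulf_eq0 orbb => /eqP.
  by rewrite a0 mulr0 /dotv big1// => i _; rewrite y0 mulr0.
move=> yn0; have ygt0 : 0 < euclid_norm y by rewrite lt_def yn0 euclid_norm_ge0.
have [b0|xn0] := eqVneq (euclid_norm x) 0.
  have x0 : forall i, x ord0 i = 0.
    have/eqP : dotv x x = 0 by rewrite -euclid_norm_sqr b0 expr0n.
    rewrite /dotv psumr_eq0 => [/allP h i|i _]; last by rewrite -expr2 sqr_ge0.
    by have /implyP/(_ isT) := h i (mem_index_enum i); rewrite mulf_eq0 orbb => /eqP.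
  by rewrite b0 mul0r /dotv big1// => i _; rewrite x0 mul0r.
have xgt0 : 0 < euclid_norm x by rewrite lt_def xn0 euclid_norm_ge0.
(* This square expands to [2 * (a * b) * (a * b - c)], with [a], [b] the norms and [c] the product;
   the null vectors were removed in order to divide by [2 * (a * b)]. *)
have := dotvv_ge0 (euclid_norm y *: x - euclid_norm x *: y).
rewrite !(dotvBl, dotvBr, dotvZl, dotvZr) -!euclid_norm_sqr (dotvC y x).
move: ygt0 xgt0; set a := euclid_norm x; set b := euclid_norm y; set c := dotv x y.
move=> b0 a0 h.
have : 0 <= (2 * (a * b)) * (a * b - c) by apply: (le_trans h); rewrite le_eqVlt; apply/orP; left; apply/eqP; ring.
by rewrite pmulr_rge0 ?subr_ge0// !mulr_gt0.
Qed.

Lemma ler_dotv x y : `|dotv x y| <= euclid_norm x * euclid_norm y.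
Proof.
rewrite ler_norml dotv_le andbT lerNl -dotvNl (le_trans (dotv_le _ _))//.
by rewrite /euclid_norm dotvNl dotvNr opprK.
Qed.

Lemma euclid_norm0 : euclid_norm (0 : 'rV[R]_n) = 0.
Proof. by rewrite /euclid_norm dotv0l sqrtr0. Qed.

Lemma euclid_normZ a x : euclid_norm (a *: x) = `|a| * euclid_norm x.
Proof.
by rewrite /euclid_norm dotvZl dotvZr mulrA -expr2 sqrtrM ?sqr_ge0// sqrtr_sqr.
Qed.

Lemma euclid_normN x : euclid_norm (- x) = euclid_norm x.
Proof. by rewrite -scaleN1r euclid_normZ normrN1 mul1r. Qed.

Lemma euclid_distC x y : euclid_norm (x - y) = euclid_norm (y - x).
Proof. by rewrite -euclid_normN opprB. Qed.

Lemma euclid_normD x y : euclid_norm (x + y) <= euclid_norm x + euclid_norm y.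
Proof.
rewrite -(@ler_sqr R) ?nnegrE ?addr_ge0 ?euclid_norm_ge0//.
rewrite euclid_norm_sqr !(dotvDl, dotvDr) (dotvC y x) sqrrD -!euclid_norm_sqr.
by have := dotv_le x y; lra.
Qed.

Lemma euclid_normB_le x y z :
  euclid_norm (x - y) <= euclid_norm (x - z) + euclid_norm (z - y).
Proof. by rewrite (le_trans _ (euclid_normD _ _))// addrA subrK. Qed.

Lemma euclid_norm_le x e : 0 <= e -> (euclid_norm x <= e) = (dotv x x <= e ^+ 2).
Proof. by move=> e0; rewrite -euclid_norm_sqr ler_sqr// nnegrE// euclid_norm_ge0. Qed.

Lemma euclid_norm_lt x e : 0 <= e -> (euclid_norm x < e) = (dotv x x < e ^+ 2).
Proof. by move=> e0; rewrite -euclid_norm_sqr ltr_sqr// nnegrE// euclid_norm_ge0. Qed.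

Lemma coord_le_norm x i : `|x ord0 i| <= `|x|.
Proof.
rewrite [leRHS]/Num.Def.normr/= mx_normrE.
by apply: (le_bigmax _ (fun i : 'I_1 * 'I_n => `|x i.1 i.2|) (ord0, i)).
Qed.

Lemma coord_le_euclid x i : `|x ord0 i| <= euclid_norm x.
Proof.
rewrite -(@ler_sqr R) ?nnegrE ?normr_ge0 ?euclid_norm_ge0//.
rewrite euclid_norm_sqr real_normK ?num_real// expr2 /dotv (bigD1 i)//= lerDl.
by apply: sumr_ge0 => j _; rewrite -expr2 sqr_ge0.
Qed.

Lemma norm_le_euclid x : `|x| <= euclid_norm x.
Proof.
rewrite [leLHS]/Num.Def.normr/= mx_normrE.
apply: bigmax_le => [|[i j] _ /=]; first exact: euclid_norm_ge0.
by rewrite (ord1 i) coord_le_euclid.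
Qed.

Lemma euclid_le_norm x : euclid_norm x <= n%:R * `|x|.
Proof.
rewrite euclid_norm_le ?mulr_ge0//.
have -> : (n%:R * `|x|) ^+ 2 = n%:R * (n%:R * `|x| ^+ 2) by ring.
apply: (@le_trans _ _ (\sum_(i < n) `|x| ^+ 2)).
  apply: ler_sum => i _; rewrite -expr2 -real_normK ?num_real//.
  by rewrite ler_sqr ?nnegrE// coord_le_norm.
rewrite sumr_const card_ord -[leLHS]mulr_natl.
case: n x => [|m] x; first by rewrite !mul0r.
rewrite ler_wpM2l// ler_peMl ?sqr_ge0//.
by rewrite ler1n.
Qed.

Lemma near_euclid x e : 0 < e -> \forall y \near x, euclid_norm (y - x) < e.
Proof.
move=> e0; have n1 : 0 < n.+1%:R :> R by [].
near=> y; apply: (le_lt_trans (euclid_le_norm _)).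
apply: (@le_lt_trans _ _ (n.+1%:R * `|y - x|)).
  by rewrite ler_wpM2r// ler_nat.
rewrite -ltr_pdivlMl// mulrC distrC.
by near: y; apply: cvgr_dist_lt; rewrite // divr_gt0.
Unshelve. all: by end_near. Qed.

Lemma nbhs_euclidP x (A : set 'rV[R]_n) :
  nbhs x A <-> exists2 d : R, 0 < d & forall y, euclid_norm (y - x) < d -> A y.
Proof.
split=> [/nbhs_ballP[d /= d0 hd]|[d d0 hd]].
  exists d => // y xy; apply: hd; rewrite -ball_normE /= distrC.
  exact: le_lt_trans (norm_le_euclid _) xy.
by near=> y; apply: hd; near: y; exact: near_euclid.
Unshelve. all: by end_near. Qed.

Lemma cvg_euclidP (T : Type) (F : set_system T) (FF : Filter F) (u : T -> 'rV[R]_n) x :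
  u @ F --> x <-> forall e : R, 0 < e -> \forall t \near F, euclid_norm (u t - x) < e.
Proof.
split=> [ux e e0|h A /nbhs_euclidP[d d0 hd]]; last first.
  by have := h _ d0; apply: filterS => t; exact: hd.
by have := near_euclid x e0; move=> /ux.
Qed.

End Dot.

(** * Relative continuity and barrier arguments *)

Section EpsDelta.
Context {R : realType}.

Lemma nbhs_realP (x : R) (A : set R) :
  nbhs x A <-> exists2 d : R, 0 < d & forall y, `|y - x| < d -> A y.
Proof.
split=> [/nbhs_ballP[d /= d0 hd]|[d d0 hd]].
  by exists d => // y xy; apply: hd; rewrite -ball_normE /= distrC.
by apply/nbhs_ballP; exists d => //= y; rewrite -ball_normE /= distrC; exact: hd.
Qed.

Lemma within_continuousP (A : set R) (g : R -> R) :
  {within A, continuous g} <-> forall t, A t -> forall e : R, 0 < e ->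
    exists2 d : R, 0 < d & forall s, A s -> `|s - t| < d -> `|g s - g t| < e.
Proof.
rewrite subspace_continuousP; split=> h t At.
  move=> e e0; move: (h t At) => /cvgrPdist_lt /(_ e e0).
  move=> /nbhs_realP[d d0 hd]; exists d => // s As st.
  by rewrite distrC; apply: hd.
apply/cvgrPdist_lt => e e0; have [d d0 hd] := h t At e e0.
by apply/nbhs_realP; exists d => // s st As /=; rewrite distrC; apply: hd.
Qed.

Lemma within_continuous_rVP n (A : set R) (g : R -> 'rV[R]_n) :
  {within A, continuous g} <-> forall t, A t -> forall e : R, 0 < e ->
    exists2 d : R, 0 < d & forall s, A s -> `|s - t| < d -> euclid_norm (g s - g t) < e.
Proof.
rewrite subspace_continuousP; split=> h t At.
  move=> e e0; move: (h t At) => /cvg_euclidP /(_ e e0).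
  by move=> /nbhs_realP[d d0 hd]; exists d => // s As st; apply: hd.
apply/cvg_euclidP => e e0; have [d d0 hd] := h t At e e0.
by apply/nbhs_realP; exists d => // s st As /=; apply: hd.
Qed.

Lemma nincr_of_derive (g : R -> R) (a b : R) : a <= b ->
  {within `[a, b], continuous g} ->
  (forall t, a < t < b -> exists2 d : R, is_derive t 1 g d & d <= 0) -> g b <= g a.
Proof.
rewrite le_eqVlt => /predU1P[->//|ab] cg dg.
have dv x : x \in `]a, b[ -> is_derive x 1 g ('D_1 g x) /\ 'D_1 g x <= 0.
  rewrite in_itv => /dg[d dd d0]; split; last by rewrite derive_val.
  by apply: DeriveDef => //; case: dd.
have [c cab h] := MVT ab (fun x hx => (dv x hx).1) cg.
have [_ d0] := dv _ cab.
by rewrite -subr_le0 h mulr_le0_ge0// subr_ge0 ltW.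
Qed.

(* Time runs until the last zero of [g]; after it [g] cannot increase. *)
Lemma barrier1 (g : R -> R) (a b : R) : a <= b ->
  {within `[a, b], continuous g} -> g a <= 0 ->
  (forall t, a < t < b -> 0 < g t -> exists2 d : R, is_derive t 1 g d & d <= 0) ->
  g b <= 0.
Proof.
move=> ab cg ga dg; rewrite leNgt; apply/negP => gb.
pose S := [set t | a <= t <= b /\ g t <= 0].
have Sa : S a by rewrite /S /= lexx ab.
have Sub : ubound S b by move=> t [/andP[]].
have Ss : has_sup S by split; [exists a|exists b].
set s := sup S.
have as_ : a <= s by apply: ub_le_sup => //; exists b.
have sb : s <= b by apply: sup_le_ub => //; exists a.
have gs : g s <= 0.
  rewrite leNgt; apply/negP => gs.
  have [|d d0 hd] := (within_continuousP _ _).1 cg s _ _ gs.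
    by rewrite /= in_itv /= as_.
  have [t St] := sup_adherent d0 Ss; rewrite -/s => ts.
  have ts' : t <= s by apply: ub_le_sup => //; exists b.
  case: (St) => tab gt0; have := hd t; rewrite /= in_itv /= => /(_ tab).
  rewrite ler0_norm ?subr_le0// => h.
  have /h : - (t - s) < d by lra.
  rewrite ltr_norml; lra.
suff : g b <= g s by lra.
apply: nincr_of_derive => //.
  apply: continuous_subspaceW cg => t /=.
  by rewrite !in_itv /= => /andP[? ->]; rewrite andbT; lra.
move=> t /andP[st tb]; apply: dg; first by rewrite tb andbT; lra.
rewrite ltNge; apply/negP => gt0; have : t <= s; last lra.
by apply: ub_le_sup; [exists b|split => //; apply/andP; split; lra].
Qed.

(** At the infimum [s] of the bad times all [g i] are still nonpositive by continuity, hence below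
    [rho] just after [s]. Some [g i] is positive at a time close to [s], which [barrier1] started at
    [s] forbids. The margin [rho] allows the derivative of one function to be estimated with the
    help of bounds on all the others. *)
Lemma barrier (I : finType) (g : I -> R -> R) (a b rho : R) : 0 < rho -> a <= b ->
  (forall i, {within `[a, b], continuous (g i)}) -> (forall i, g i a <= 0) ->
  (forall t, a < t < b -> (forall i, g i t < rho) -> forall i, 0 < g i t ->
     exists2 d : R, is_derive t 1 (g i) d & d <= 0) ->
  forall t, a <= t <= b -> forall i, g i t <= 0.
Proof.
move=> rho0 ab cg ga dg t1 /andP[at1 t1b] i1; rewrite leNgt; apply/negP => gt1.
pose S := [set t | a <= t <= b /\ exists i, 0 < g i t].
have St1 : S t1 by split; [rewrite at1 | exists i1].
have Slb : has_inf S by split; [exists t1|exists a => t [/andP[]]].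
set s := inf S.
have as_ : a <= s by apply: lb_le_inf; [exists t1|move=> t [/andP[]]].
have st1 : s <= t1 by apply: ge_inf => //; exists a => t [/andP[]].
have lts t : a <= t < s -> forall i, g i t <= 0.
  move=> /andP[at_ ts] i; rewrite leNgt; apply/negP => git.
  suff : s <= t by lra.
  apply: ge_inf; [by exists a => u [/andP[]]|split; last by exists i].
  by apply/andP; split; lra.
have sab : s \in `[a, b] by rewrite in_itv /= as_ /= (le_trans st1).
have gs i : g i s <= 0.
  have [<-//|as'] := eqVneq a s.
  have {}as' : a < s by rewrite lt_neqAle as'.
  rewrite leNgt; apply/negP => gis.
  have [d d0 hd] := (within_continuousP _ _).1 (cg i) s sab _ gis.
  pose t := Num.max a (s - d / 2).
  have ta : a <= t < s by rewrite le_max lexx /= gt_max as' /=; lra.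
  have td : s - d / 2 <= t by rewrite le_max lexx orbT.
  have := lts t ta i; have := hd t; rewrite /= in_itv /=.
  case/andP: ta => -> ts /=; rewrite (le_trans (ltW ts)) ?(le_trans st1)//.
  move=> /(_ isT); rewrite ltr0_norm ?subr_lt0// => h gt0.
  have /h : - (t - s) < d by lra.
  rewrite ltr_norml; lra.
have : \forall d \near 0^'+, forall i, forall t, t \in `[a, b] -> `|t - s| < d -> g i t < rho.
  apply: filter_forall => i.
  have [d d0 hd] := (within_continuousP _ _).1 (cg i) s sab _ rho0.
  near=> d' => t tab ts.
  have /(hd t tab) : `|t - s| < d by apply: (lt_le_trans ts); near: d'; exact: nbhs_right_le.
  by rewrite ltr_norml; have := gs i; lra.
move=> near_d; near (0 : R)^'+ => d.
have d0 : 0 < d by [].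
have hd : forall i t, t \in `[a, b] -> `|t - s| < d -> g i t < rho by near: d.
have [t2 St2] := inf_adherent d0 Slb; rewrite -/s => t2s.
case: St2 => /andP[at2 t2b] [i git2].
have st2 : s <= t2 by apply: ge_inf; [exists a => t [/andP[]]|split; [apply/andP|exists i]].
suff : g i t2 <= 0 by lra.
apply: (@barrier1 (g i) s) => //.
  apply: continuous_subspaceW (cg i) => t /=.
  by rewrite !in_itv /= => /andP[? ?]; apply/andP; split; lra.
move=> t /andP[st tt2]; apply: dg; first by apply/andP; split; lra.
move=> j; apply: hd; first by rewrite in_itv /=; apply/andP; split; lra.
by rewrite gtr0_norm; lra.
Unshelve. all: by end_near. Qed.

End EpsDelta.

(** * Mean values, Gronwall's inequality and directional derivatives *)

Section Calculus.
Context {R : realType}.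

(** Leaving the order of [a] and [b] open serves times on both sides of [tau] and kernel coordinates
    of both signs. *)
Lemma MVT_between (g dg : R -> R) (a b : R) : 
  (forall x, Num.min a b <= x <= Num.max a b -> is_derive x 1 g (dg x)) ->
  exists2 c, Num.min a b <= c <= Num.max a b & g b - g a = dg c * (b - a).
Proof.
move=> dgE; wlog ab : a b dgE / a <= b => [hw|].
  have /orP[ab|ba] := le_total a b; first exact: (hw a b).
  have [x hx|//|c hc E] := hw b a; first by apply: dgE; rewrite minC maxC.
  by exists c; [rewrite minC maxC|rewrite -opprB E -mulrN opprB].
rewrite min_l// max_r// in dgE *.
move: ab; rewrite le_eqVlt => /predU1P[->|ab].
  by exists b; rewrite ?lexx// !subrr mulr0.
have D x : x \in `]a, b[ -> is_derive x 1 g (dg x).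
  by rewrite in_itv => /andP[ax xb]; apply: dgE; rewrite !ltW.
have C : {within `[a, b], continuous g}.
  apply: derivable_within_continuous => t; rewrite in_itv/= => /dgE tab.
  exact: ex_derive.
have [c] := MVT ab D C.
by rewrite in_itv /= => /andP[ac cb] E; exists c => //; rewrite !ltW.
Qed.

Lemma is_derive_mulrl (k s : R) : is_derive s 1 (fun t : R => k * t) k.
Proof.
have -> : (fun t : R => k * t) = k \*: (id : R -> R) by [].
by apply: is_derive_eq; rewrite [k *: 1]mulr1.
Qed.

(** The function [(y t + mu) * expR (- K * t)] is nonincreasing as long as [y < rho]. The
    differential inequality is available only in that range, because the fields are controlled only
    near a reference curve; the smallness of [y 0] and [mu] keeps [y] there up to time [S]. *)
Lemma gronwall (y : R -> R) (S K mu rho : R) : 0 <= S ->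
  {within `[0, S], continuous y} -> (y 0 + mu) * expR (K * S) < rho + mu ->
  0 <= K -> 0 <= mu -> 0 <= rho ->
  (forall t, 0 < t < S -> y t < rho ->
    exists2 d : R, is_derive t 1 y d & d <= K * (y t + mu)) ->
  forall t, 0 <= t <= S -> y t + mu <= (y 0 + mu) * expR (K * t).
Proof.
move=> S0 cy y0 K0 mu0 rho0 dy.
pose g (_ : 'I_1) t := (y t + mu) * expR (- K * t) - (y 0 + mu).
(* The largest margin for which [g < rho'] forces [y < rho] throughout [[0, S]]. *)
pose rho' := (rho + mu) * expR (- (K * S)) - (y 0 + mu).
have rho'0 : 0 < rho' by rewrite subr_gt0 -ltr_pdivrMr ?expR_gt0// -expRN opprK.
have cE t : {for t, continuous (fun t => expR (- K * t))}.
  apply: continuous_comp; last exact: continuous_expR.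
  exact: mulrl_continuous.
have cg i : {within `[0, S], continuous (g i)}.
  apply/subspace_continuousP => t tS; rewrite /g.
  apply: cvgB; last exact: cvg_cst.
  apply: cvgM; last exact: cvg_within_filter (cE t).
  by apply: cvgD; [by move/subspace_continuousP: cy; exact|exact: cvg_cst].
have := barrier rho'0 S0 cg.
move=> /(_ _ _) H t tS; have {H} : g ord0 t <= 0.
  apply: H => // [i|s sS gs i _].
    by rewrite /g mulr0 expR0 mulr1 subrr.
  have ys : y s < rho.
    have : (y s + mu) * expR (- K * s) < (rho + mu) * expR (- (K * S)).
      by have := gs i; rewrite /g /rho' ltrD2r.
    rewrite mulNr => h.
    have {h} : y s + mu < (rho + mu) * expR (- (K * S)) * expR (K * s).
      by rewrite -ltr_pdivrMr ?expR_gt0// -expRN.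
    move=> h; rewrite -(ltrD2r mu); apply: (lt_le_trans h).
    rewrite -mulrA -expRD ler_piMr ?addr_ge0// -expR0 ler_expR.
    by rewrite addrC subr_le0 ler_wpM2l//; lra.
  have [d dd dK] := dy s sS ys.
  exists ((d - K * (y s + mu)) * expR (- K * s)); last first.
    by rewrite mulr_le0_ge0 ?expR_ge0// subr_le0.
  have dE : is_derive s 1 (fun t => expR (- K * t)) (expR (- K * s) * - K).
    apply: (@is_derive1_comp _ expR (fun t => - K * t)).
    exact: is_derive_mulrl.
  have -> : g i = (y + cst mu) * (fun t => expR (- K * t)) - cst (y 0 + mu) by [].
  apply: is_derive_eq.
  by rewrite /GRing.scale /= !addr0 subr0 -[(y + cst mu) s]/(y s + mu); ring.
by rewrite /g subr_le0 mulNr expRN ler_pdivrMr ?expR_gt0.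
Qed.

Lemma is_derive_coord (V : normedModType R) m n (a : V -> 'M[R]_(m, n)) t v da i j :
  is_derive t v a da -> is_derive t v (fun x => a x i j) (da i j).
Proof.
move=> [ad ade]; apply: DeriveDef; first exact: (derivable_mxP _ _ _).1.
by rewrite -ade derive_mx// mxE.
Qed.

Lemma is_derive_dotv (V : normedModType R) n (a b : V -> 'rV[R]_n) t v da db :
  is_derive t v a da -> is_derive t v b db ->
  is_derive t v (fun x => dotv (a x) (b x)) (dotv da (b t) + dotv (a t) db).
Proof.
move=> ad bd.
have -> : (fun x => dotv (a x) (b x)) =
          \sum_(i < n) (fun x => a x ord0 i * b x ord0 i).
  by apply/funext => x; rewrite fct_sumE.
apply: is_derive_eq.
  apply: is_derive_sum => i; apply: is_deriveM; exact: is_derive_coord.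
rewrite /dotv -big_split; apply: eq_bigr => i _ /=.
by rewrite /GRing.scale /= addrC; congr (_ + _); rewrite mulrC.
Qed.

Lemma is_derive_dotvl n (V : normedModType R) (a : V -> 'rV[R]_n) t v da w :
  is_derive t v a da -> is_derive t v (fun x => dotv (a x) w) (dotv da w).
Proof.
move=> ad; apply: is_derive_eq; first exact: is_derive_dotv (is_derive_cst w t v).
by rewrite dotv0r addr0.
Qed.

Lemma is_derive_line (V W : normedModType R) (g : V -> W) x v s d :
  is_derive (x + s *: v) v g d -> is_derive s 1 (fun s => g (x + s *: v)) d.
Proof.
have E : (fun h : R => h^-1 *: (((fun s => g (x + s *: v)) \o shift s) (h *: 1) - g (x + s *: v)))
     = (fun h : R => h^-1 *: ((g \o shift (x + s *: v)) (h *: v) - g (x + s *: v))).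
  apply/funext => h /=; congr (_ *: (g _ - _)).
  by rewrite [h *: 1]mulr1 scalerDl addrCA.
by move=> [ed de]; apply: DeriveDef; rewrite /derivable /derive E.
Qed.

Lemma is_derive_scale_dir (V : normedModType R) (g : V -> R) x v k d :
  is_derive x v g d -> is_derive x (k *: v) g (k * d).
Proof.
move=> dg.
have := @is_derive1_comp _ (fun s => g (x + s *: v)) (fun s => k * s) 0 d k.
rewrite mulr0 => H.
have {H} : is_derive (0:R) 1 ((fun s => g (x + s *: v)) \o (fun s => k * s)) (d * k).
  apply: H.
    by apply: is_derive_line; rewrite scale0r addr0.
  exact: is_derive_mulrl.
have E : (fun h : R => h^-1 *: (((((fun s => g (x + s *: v)) \o (fun s => k * s))) \o shift 0) (h *: 1) - g x))
     = (fun h : R => h^-1 *: ((g \o shift x) (h *: (k *: v)) - g x)).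
  apply/funext => h /=; congr (_ *: (g _ - _)).
  by rewrite [h *: 1]mulr1 addr0 scalerA mulrC addrC.
rewrite mulrC => -[ed de]; apply: DeriveDef; rewrite /derivable /derive.
  by move: ed; rewrite /derivable /= mulr0 scale0r addr0 E.
by move: de; rewrite /derive /= mulr0 scale0r addr0 E.
Qed.

(** Moving along [w] first and along [e] second splits the difference quotient: the second move is a
    mean value of [de] near [x], controlled by continuity at [x], and the first is the quotient
    along [w]. Added up over the coordinates, this yields directional derivatives from continuous
    partial ones. *)
Lemma is_derive_add_dir n (g de : 'rV[R]_n -> R) x e w (a dw : R) :
  (forall y, is_derive y e g (de y)) -> {for x, continuous de} ->
  is_derive x w g dw -> is_derive x (a *: e + w) g (a * de x + dw).
Proof.
move=> dge cde [wd wdE].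
(* At [h = 0] the convention that the inverse of [0] is [0] makes the left-hand side vanish, hence
   the case distinction in the factor. *)
have step (h : R) : exists2 c : R, 0 <= c <= 1 &
    h^-1 * (g (h *: (a *: e + w) + x) - g (h *: w + x))
    = (if h == 0 then 0 else a) * de (h *: w + x + c *: ((h * a) *: e)).
  have [c c01 E] := @MVT_between (fun s => g (h *: w + x + s *: ((h * a) *: e)))
    (fun s => h * a * de (h *: w + x + s *: ((h * a) *: e))) 0 1
    (fun s _ => is_derive_line (is_derive_scale_dir (h * a) (dge _))).
  rewrite min_l// max_r// in c01; exists c => //.
  have -> : h *: (a *: e + w) + x = h *: w + x + 1 *: ((h * a) *: e).
    by rewrite scalerDr scalerA scale1r -addrA addrC.
  have [->|h0] := eqVneq h 0; first by rewrite invr0 !mul0r.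
  have -> : g (h *: w + x) = g (h *: w + x + 0 *: (h * a *: e)).
    by rewrite scale0r addr0.
  by rewrite E; field.
suff H : h^-1 *: ((g \o shift x) (h *: (a *: e + w)) - g x) @[h --> 0^'] --> a * de x + dw.
  by apply: DeriveDef; [apply/cvg_ex; eexists; exact: H | exact: cvg_lim H].
have -> : (fun h : R => h^-1 *: ((g \o shift x) (h *: (a *: e + w)) - g x))
  = (fun h : R => h^-1 * (g (h *: (a *: e + w) + x) - g (h *: w + x)))
    \+ (fun h => h^-1 *: ((g \o shift x) (h *: w) - g x)).
  by apply/funext => h; rewrite /GRing.scale /= -mulrDr subrKA.
apply: cvgD; last by rewrite -wdE; exact: wd.
apply/cvgrPdist_lt => eps eps0.
have eps1 : 0 < eps / (`|a| + 1) by rewrite divr_gt0// ltr_wpDl.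
have := cde; move/cvgrPdist_lt => /(_ _ eps1) /nbhs_euclidP[d d0 hd].
have Nw0 : 0 <= euclid_norm w + `|a| * euclid_norm e.
  by rewrite addr_ge0 ?mulr_ge0 ?euclid_norm_ge0.
near=> h.
have h0 : h != 0 by near: h; exact: nbhs_dnbhs_neq.
have [c /andP[c0 c1] ->] := step h; rewrite (negbTE h0) -mulrBr normrM.
have /hd : euclid_norm (h *: w + x + c *: (h * a *: e) - x) < d.
  have -> : h *: w + x + c *: (h * a *: e) - x = h *: (w + (c * a) *: e).
    by rewrite addrAC addrK scalerDr !scalerA; congr (_ + _ *: _); ring.
  rewrite euclid_normZ; apply: (@le_lt_trans _ _ (`|h| * (euclid_norm w + `|a| * euclid_norm e + 1))).
    rewrite ler_wpM2l// (le_trans (euclid_normD _ _))// -addrA lerD2l.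
    rewrite euclid_normZ normrM (ger0_norm c0) ler_wpDr// ler_wpM2r ?euclid_norm_ge0//.
    by rewrite ler_piMl.
  rewrite -ltr_pdivlMr ?ltr_wpDl//; near: h; apply: dnbhs0_lt.
  by rewrite divr_gt0// ltr_wpDl.
move=> hlt; apply: (@le_lt_trans _ _ (`|a| * (eps / (`|a| + 1)))).
  by rewrite ler_wpM2l// ltW.
by rewrite mulrCA gtr_pMr// ltr_pdivrMr ?ltr_wpDl// mul1r ltrDl.
Unshelve. all: by end_near. Qed.

Lemma is_derive_grad n (g : 'rV[R]_n -> R) x v :
  (forall y i, derivable g y (delta_mx ord0 i)) ->
  (forall i, {for x, continuous (partial i g)}) ->
  is_derive x v g (dotv (grad g x) v).
Proof.
move=> dg cg; rewrite {1}[v]row_sum_delta.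
have -> : dotv (grad g x) v = \sum_(i < n) v ord0 i * partial i g x.
  by apply: eq_bigr => i _; rewrite mxE mulrC.
apply: (big_rec2 (fun w d => is_derive x w g d)) => [|i d w _ dw].
  exact: is_derive0.
by apply: is_derive_add_dir => // y; exact: derivableP.
Qed.

(** The second difference of [G] over the square of side [h] is computed by two mean values in
    either order, so [G12] and [G21] agree at two points of that square; both points tend to the
    origin. Phrasing it for functions of two real variables covers two space variables ([hess_sym])
    as well as time and space ([dtime_partial]). *)
Lemma schwarz (G G1 G2 G12 G21 : R -> R -> R) (e : R) : 0 < e ->
  (forall s t : R, `|s| <= e -> `|t| <= e ->
    [/\ is_derive s 1 (G ^~ t) (G1 s t), is_derive t 1 (G1 s) (G12 s t),
        is_derive t 1 (G s) (G2 s t) & is_derive s 1 (G2 ^~ t) (G21 s t)]) ->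
  (forall eta : R, 0 < eta -> exists2 d : R, 0 < d & forall s t : R, `|s| < d -> `|t| < d ->
     `|G12 s t - G12 0 0| < eta /\ `|G21 s t - G21 0 0| < eta) ->
  G12 0 0 = G21 0 0.
Proof.
move=> e0 dG cG; apply/eqP; rewrite -subr_eq0 -normr_eq0; apply/eqP.
apply/eqP; rewrite eq_le normr_ge0 andbT; apply/ler_addgt0Pl => eta eta0; rewrite addr0.
have [d d0 hd] : exists2 d : R, 0 < d & forall s t : R, `|s| < d -> `|t| < d ->
    `|G12 s t - G12 0 0| < eta / 2 /\ `|G21 s t - G21 0 0| < eta / 2.
  by apply: cG; rewrite divr_gt0.
pose h := Num.min e (d / 2).
have h0 : 0 < h by rewrite lt_min e0 divr_gt0.
have he : h <= e by rewrite ge_min lexx.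
have hd2 : h <= d / 2 by rewrite ge_min lexx orbT.
have abs (x : R) : 0 <= x <= h -> `|x| <= e /\ `|x| < d.
  by move=> /andP[x0 xh]; rewrite ger0_norm//; split; lra.
have M (g dg : R -> R) : (forall x : R, 0 <= x <= h -> is_derive x 1 g (dg x)) ->
    exists2 c, 0 <= c <= h & g h - g 0 = dg c * h.
  move=> D; have [|c hc] := @MVT_between g dg 0 h.
    by rewrite min_l ?max_r ?(ltW h0).
  by rewrite subr0 => E; exists c => //; move: hc; rewrite min_l ?max_r ?(ltW h0).
have [|c hc] := M (fun s => G s h - G s 0) (fun s => G1 s h - G1 s 0).
  move=> x /abs[xe _]; have [|d1 _ _ _] := dG x h xe; first by rewrite gtr0_norm.
  have [|d1' _ _ _] := dG x 0 xe; first by rewrite normr0 ltW.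
  exact: is_deriveB.
have [|c' hc' ->] := M (fun t => G1 c t) (fun t => G12 c t).
  by move=> x /abs[xe _]; have [] := dG c x (abs _ hc).1 xe.
move=> E1.
have [|b hb] := M (fun t => G h t - G 0 t) (fun t => G2 h t - G2 0 t).
  move=> x /abs[xe _]; have [|_ _ d1 _] := dG h x _ xe; first by rewrite gtr0_norm.
  have [|_ _ d1' _] := dG 0 x _ xe; first by rewrite normr0 ltW.
  exact: is_deriveB.
have [|b' hb' ->] := M (fun s => G2 s b) (fun s => G21 s b).
  by move=> x /abs[xe _]; have [] := dG x b xe (abs _ hb).1.
move=> E2.
have E : G12 c c' = G21 b' b.
  have : G12 c c' * h * h = G21 b' b * h * h by rewrite -E1 -E2; ring.
  by move=> /(mulIf (lt0r_neq0 h0))/(mulIf (lt0r_neq0 h0)).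
have [h1 _] := hd c c' (abs _ hc).2 (abs _ hc').2.
have [_ h2] := hd b' b (abs _ hb').2 (abs _ hb).2.
move: h1 h2; rewrite E !ltr_norml ler_norml; lra.
Qed.

Lemma cvg_sum_real (U : Type) (F : set_system U) (FF : Filter F) m
    (g : 'I_m -> U -> R) (a : 'I_m -> R) :
  (forall i, g i x @[x --> F] --> a i) ->
  \sum_i g i x @[x --> F] --> \sum_i a i.
Proof. by move=> ga; apply: cvg_big => [|i _]; [exact: add_continuous|exact: ga]. Qed.

Lemma is_derive_within_interior (V : normedModType R) (A : set R) (g : R -> V) t :
  nbhs t A -> derivable_in A g t -> is_derive t 1 g (derive_in A g t).
Proof.
move=> At; have E : within [set h | A (h + t)] 0^' = (0 : R)^'.
  have N : (0 : R)^' [set h | A (h + t)].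
    move: At => /nbhs_realP[d d0 hd]; near=> h; apply: hd; rewrite addrK.
    by near: h; exact: dnbhs0_lt.
  apply/seteqP; split=> P; last exact: cvg_within.
  by rewrite /within /= => h; apply: filterS2 h N => x; exact.
have E2 : (fun h : R => h^-1 *: ((g \o shift t) (h *: 1) - g t)) =
          (fun h : R => h^-1 *: (g (h + t) - g t)).
  by apply/funext => h /=; rewrite [h *: 1]mulr1.
rewrite /derivable_in /derive_in E => D.
by apply: DeriveDef; rewrite /derivable /derive E2.
Unshelve. all: by end_near. Qed.

End Calculus.

(** * Regularity of the potential *)

Lemma dotv_mulmx_bound (R : realType) n (A : 'M[R]_n) (c : R) u w :
  (forall i j, `|A i j| <= c) ->
  `|dotv (u *m A) w| <= n%:R ^+ 2 * c * (euclid_norm u * euclid_norm w).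
Proof.
move=> Ac; have -> : dotv (u *m A) w = \sum_j \sum_i u ord0 i * A i j * w ord0 j.
  by apply: eq_bigr => j _; rewrite mxE mulr_suml.
apply: (le_trans (ler_norm_sum _ _ _)).
have -> : n%:R ^+ 2 * c * (euclid_norm u * euclid_norm w) =
    \sum_(j < n) \sum_(i < n) (c * (euclid_norm u * euclid_norm w)).
  by rewrite !sumr_const !card_ord -!mulrnA -[RHS]mulr_natl natrM; ring.
apply: ler_sum => j _; apply: (le_trans (ler_norm_sum _ _ _)).
apply: ler_sum => i _; rewrite !normrM [`|u _ _| * _]mulrC -mulrA.
by rewrite ler_pM ?mulr_ge0 ?normr_ge0// ler_pM ?normr_ge0// coord_le_euclid.
Qed.

Section Regularity.
Context {R : realType} {n : nat}.
Variable T : R.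
Implicit Types (f : R -> 'rV[R]_n -> R) (x v w l : 'rV[R]_n) (t : R).

Lemma class_C_continuous k f t0 x0 (e : R) : class_C T k f -> 0 <= t0 <= T -> 0 < e ->
  exists2 d : R, 0 < d & forall t x, 0 <= t <= T -> `|t - t0| < d ->
    euclid_norm (x - x0) < d -> `|f t x - f t0 x0| < e.
Proof.
move=> Cf t0T e0; have : {within [set p : R * 'rV[R]_n | p.1 \in `[0, T]],
     continuous (fun p : R * 'rV[R]_n => f p.1 p.2)} by case: k Cf => [|k] [].
move/subspace_continuousP => /(_ (t0, x0)) /=; rewrite in_itv => /(_ t0T).
move/cvgrPdist_lt => /(_ e e0) [[A B] [/=]].
move=> /nbhs_realP[d1 d10 h1] /nbhs_euclidP[d2 d20 h2] h.
exists (Num.min d1 d2) => [|t x tT]; first by rewrite lt_min d10.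
rewrite !lt_min => /andP[td1 _] /andP[_ xd2].
rewrite distrC; apply: (h (t, x)); last by rewrite /= in_itv.
by split => /=; [exact: h1|exact: h2].
Qed.

Lemma class_C_partial k f i : class_C T k.+1 f -> class_C T k (fun t => partial i (f t)).
Proof. by move=> [_ [_ _ _ h]]; apply: (h i). Qed.

Lemma class_C_dtime k f : class_C T k.+1 f -> class_C T k (dtime T f).
Proof. by move=> [_ [_ _ h _]]; apply: h. Qed.

Lemma class_C_continuous_at k f t x : class_C T k f -> 0 <= t <= T ->
  {for x, continuous (f t)}.
Proof.
move=> Cf tT; apply/(@cvgrPdist_lt _ R^o _ (nbhs x)) => e e0.
have [d d0 hd] := class_C_continuous x Cf tT e0.
apply/nbhs_euclidP; exists d => // y yx; rewrite distrC; apply: hd => //.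
by rewrite subrr normr0.
Qed.

Lemma class_C_derivable k f t x v : class_C T k.+1 f -> 0 <= t <= T ->
  is_derive x v (f t) (dotv (grad (f t) x) v).
Proof.
move=> Cf tT; apply: is_derive_grad.
  by move=> y i; case: Cf => _ [_ + _ _]; apply; rewrite in_itv.
by move=> i; apply: (@class_C_continuous_at k (fun t => partial i (f t))) => //; exact: class_C_partial.
Qed.

Lemma class_C_dtimeP k f t x : class_C T k.+1 f -> 0 < t < T ->
  is_derive t 1 (f ^~ x) (dtime T f t x).
Proof.
move=> [_ [+ _ _ _]] /andP[t0 tT] => /(_ t x).
rewrite in_itv /= !ltW// => /(_ isT); apply: is_derive_within_interior.
by near=> s; apply/andP; split; apply: ltW; near: s;
  [exact: lt_nbhsr|exact: lt_nbhsl].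
Unshelve. all: by end_near. Qed.

Lemma class_C_MVT_space k f t x v : class_C T k.+1 f -> 0 <= t <= T ->
  exists2 th : R, 0 <= th <= 1 &
    f t (x + v) - f t x = dotv (grad (f t) (x + th *: v)) v.
Proof.
move=> Cf tT; have [c] := @MVT_between _ (fun s => f t (x + s *: v)) _ 0 1
  (fun s _ => is_derive_line (class_C_derivable (x + s *: v) v Cf tT)).
rewrite min_l// max_r// scale1r scale0r subr0 mulr1 addr0 => c01 E.
by exists c.
Qed.

Lemma class_C_derive_gradF k f t x v w : class_C T k.+2 f -> 0 <= t <= T ->
  is_derive x v (fun y => dotv (grad (f t) y) w) (dotv (v *m hess (f t) x) w).
Proof.
move=> Cf tT.
have -> : (fun y => dotv (grad (f t) y) w) =
    \sum_(j < n) (w ord0 j \*: partial j (f t)).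
  by apply/funext => y; rewrite fct_sumE; apply: eq_bigr => j _; rewrite mxE mulrC.
have D j := @class_C_derivable k (fun t => partial j (f t)) t x v
    (class_C_partial j Cf) tT.
apply: is_derive_eq.
apply: eq_bigr => j _; rewrite /GRing.scale /= mulrC; congr (_ * _).
by rewrite mxE; apply: eq_bigr => i _; rewrite !mxE mulrC.
Qed.

(** The mean value theorem fails for vector-valued maps, so the gradient is first paired with [w];
    the intermediate point depends on [w]. *)
Lemma grad_MVT k f t x v w : class_C T k.+2 f -> 0 <= t <= T ->
  exists2 th : R, 0 <= th <= 1 &
    dotv (grad (f t) (x + v) - grad (f t) x) w = dotv (v *m hess (f t) (x + th *: v)) w.
Proof.
move=> Cf tT; have [c] := @MVT_between _ (fun s => dotv (grad (f t) (x + s *: v)) w) _ 0 1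
  (fun s _ => is_derive_line (class_C_derive_gradF (x + s *: v) v w Cf tT)).
rewrite min_l// max_r// scale1r scale0r subr0 mulr1 addr0 -dotvBl => c01 E.
by exists c.
Qed.

Lemma grad_continuous k f t0 x0 (e : R) : class_C T k.+1 f -> 0 <= t0 <= T -> 0 < e ->
  exists2 d : R, 0 < d & forall t x, 0 <= t <= T -> `|t - t0| < d ->
    euclid_norm (x - x0) < d -> euclid_norm (grad (f t) x - grad (f t0) x0) < e.
Proof.
move=> Cf t0T e0.
have e1 : 0 < e / n.+1%:R by rewrite divr_gt0.
have H i := class_C_continuous x0 (class_C_partial i Cf) t0T e1.
have : \forall d \near (0 : R)^'+, forall i, forall t x, 0 <= t <= T -> `|t - t0| < d ->
    euclid_norm (x - x0) < d -> `|partial i (f t) x - partial i (f t0) x0| < e / n.+1%:R.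
  apply: filter_forall => i; have [d d0 hd] := H i.
  near=> d' => t x tT td xd.
  have d'd : d' <= d by near: d'; exact: nbhs_right_le.
  by apply: hd => //; [exact: lt_le_trans td _|exact: lt_le_trans xd _].
move=> nd; near (0 : R)^'+ => d.
have hd : forall i, forall t x, 0 <= t <= T -> `|t - t0| < d ->
    euclid_norm (x - x0) < d -> `|partial i (f t) x - partial i (f t0) x0| < e / n.+1%:R.
  by near: d.
exists d => // t x tT td xd; apply: (le_lt_trans (euclid_le_norm _)).
apply: (@le_lt_trans _ _ (n%:R * (e / n.+1%:R))).
  rewrite ler_wpM2l// [leLHS]/Num.Def.normr/= mx_normrE.
  apply: bigmax_le => [|[i j] _ /=]; first exact: ltW.
  by rewrite !mxE; apply/ltW/hd.
by rewrite mulrCA gtr_pMr// ltr_pdivrMr// mul1r ltr_nat.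
Unshelve. all: by end_near. Qed.

(** Closeness of Hessians is expressed through bilinear forms because this is how [grad_MVT]
    produces them. *)
Lemma hess_continuous k f t0 x0 (e : R) : class_C T k.+2 f -> 0 <= t0 <= T -> 0 < e ->
  exists2 d : R, 0 < d & forall t x, 0 <= t <= T -> `|t - t0| < d ->
    euclid_norm (x - x0) < d -> forall u w,
    `|dotv (u *m (hess (f t) x - hess (f t0) x0)) w| <= e * (euclid_norm u * euclid_norm w).
Proof.
move=> Cf t0T e0.
have n2 : 0 < n%:R ^+ 2 + 1 :> R by rewrite ltr_wpDl// sqr_ge0.
have e1 : 0 < e / (n%:R ^+ 2 + 1) by rewrite divr_gt0.
have H i j := class_C_continuous x0 (class_C_partial i (class_C_partial j Cf)) t0T e1.
have : \forall d \near (0 : R)^'+, forall i, forall j, forall t x, 0 <= t <= T -> `|t - t0| < d ->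
    euclid_norm (x - x0) < d -> `|partial i (partial j (f t)) x - partial i (partial j (f t0)) x0| < e / (n%:R ^+ 2 + 1).
  apply: filter_forall => i; apply: filter_forall => j; have [d d0 hd] := H i j.
  near=> d' => t x tT td xd.
  have d'd : d' <= d by near: d'; exact: nbhs_right_le.
  by apply: hd => //; [exact: lt_le_trans td _|exact: lt_le_trans xd _].
move=> nd; near (0 : R)^'+ => d.
have hd : forall i j, forall t x, 0 <= t <= T -> `|t - t0| < d ->
    euclid_norm (x - x0) < d -> `|partial i (partial j (f t)) x - partial i (partial j (f t0)) x0| < e / (n%:R ^+ 2 + 1).
  by near: d.
exists d => // t x tT td xd u w.
apply: (le_trans (dotv_mulmx_bound (c := e / (n%:R ^+ 2 + 1)) u w _)).
  by move=> i j; rewrite !mxE; apply/ltW/hd.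
rewrite ler_wpM2r ?mulr_ge0 ?euclid_norm_ge0//.
by rewrite mulrCA ger_pMr// ler_pdivrMr// mul1r lerDl.
Unshelve. all: by end_near. Qed.

(** Each entry of the Hessian is of class [C^1], with a gradient bounded near [x0] by continuity;
    the mean value theorem on a segment inside the ball does the rest. Summing the bounds over all
    entries gives the common bound [B]. *)
Lemma hess_lipschitz f t x0 : class_C T 3 f -> 0 <= t <= T ->
  exists2 C : R, 0 < C & exists2 d : R, 0 < d & forall x y,
    euclid_norm (x - x0) < d -> euclid_norm (y - x0) < d -> forall u w,
    `|dotv (u *m (hess (f t) x - hess (f t) y)) w|
      <= C * euclid_norm (x - y) * (euclid_norm u * euclid_norm w).
Proof.
move=> Cf tT.
pose g i j t := partial i (partial j (f t)).
have Cg i j : class_C T 1 (g i j) by apply: class_C_partial; exact: class_C_partial.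
have H i j := grad_continuous x0 (Cg i j) tT (@ltr01 R).
pose B := \sum_i \sum_j (euclid_norm (grad (g i j t) x0) + 1).
have Bij i j : euclid_norm (grad (g i j t) x0) + 1 <= B.
  pose G i := \sum_j (euclid_norm (grad (g i j t) x0) + 1).
  have S (F : 'I_n -> R) m : (forall i, 0 <= F i) -> F m <= \sum_i F i.
    by move=> F0; rewrite (bigD1 m)//= lerDl; apply: sumr_ge0.
  have P a b : 0 <= euclid_norm (grad (g a b t) x0) + 1.
    by rewrite addr_ge0 ?euclid_norm_ge0.
  apply: (@le_trans _ _ (G i)); last by apply: (S G) => a; apply: sumr_ge0.
  exact: (S (fun j => euclid_norm (grad (g i j t) x0) + 1)).
have B0 : 0 <= B.
  by apply: sumr_ge0 => i _; apply: sumr_ge0 => j _; rewrite addr_ge0 ?euclid_norm_ge0.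
have : \forall d \near (0 : R)^'+, forall i, forall j, forall x, euclid_norm (x - x0) < d ->
    euclid_norm (grad (g i j t) x) <= B.
  apply: filter_forall => i; apply: filter_forall => j; have [d d0 hd] := H i j.
  near=> d' => x xd.
  have d'd : d' <= d by near: d'; exact: nbhs_right_le.
  apply: le_trans (Bij i j).
  have -> : grad (g i j t) x = grad (g i j t) x0 + (grad (g i j t) x - grad (g i j t) x0).
    by rewrite addrC subrK.
  apply: (le_trans (euclid_normD _ _)); rewrite lerD2l; apply/ltW/hd => //.
    by rewrite subrr normr0.
  exact: lt_le_trans xd _.
move=> nd; near (0 : R)^'+ => d.
have hd : forall i, forall j, forall x, euclid_norm (x - x0) < d ->
    euclid_norm (grad (g i j t) x) <= B by near: d.
exists (n%:R ^+ 2 * B + 1); first by rewrite ltr_wpDl// mulr_ge0// sqr_ge0.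
exists d => // x y xd yd u w.
apply: (le_trans (dotv_mulmx_bound (c := B * euclid_norm (x - y)) u w _)).
  move=> i j; rewrite !mxE.
  have [th /andP[th0 th1] E] := class_C_MVT_space y (x - y) (Cg i j) tT.
  move: E; rewrite [y + (x - y)]addrC subrK => ->; apply: (le_trans (ler_dotv _ _)).
  rewrite ler_wpM2r ?euclid_norm_ge0//; apply: hd.
  (* Convexity of the ball: the intermediate point is a convex combination of [x] and [y]. *)
  have -> : y + th *: (x - y) - x0 = th *: (x - x0) + (1 - th) *: (y - x0).
    by apply/rowP => k; rewrite !mxE; ring.
  apply: (le_lt_trans (euclid_normD _ _)); rewrite !euclid_normZ.
  rewrite !ger0_norm ?subr_ge0//.
  move: xd yd; set a := euclid_norm _; set b := euclid_norm _ => ad bd.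
  pose m := Num.max a b; have md : m < d by rewrite gt_max ad.
  have h1 : 0 <= th * (m - a) by rewrite mulr_ge0// subr_ge0 le_max lexx.
  have h2 : 0 <= (1 - th) * (m - b) by rewrite mulr_ge0 ?subr_ge0// le_max lexx orbT.
  lra.
rewrite ler_wpM2r ?mulr_ge0 ?euclid_norm_ge0// mulrA.
by rewrite ler_wpM2r ?euclid_norm_ge0// lerDl.
Unshelve. all: by end_near. Qed.

End Regularity.

(** * Exchange of derivatives and expansions at a fold *)

Section Symmetry.
Context {R : realType} {n : nat}.
Variable T : R.
Implicit Types (f : R -> 'rV[R]_n -> R) (x v w l : 'rV[R]_n) (t : R).

Lemma class_C_partialP k f t x i : class_C T k.+1 f -> 0 <= t <= T ->
  is_derive x (delta_mx ord0 i) (f t) (partial i (f t) x).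
Proof. by move=> [_ [_ h _ _]] tT; apply/derivableP/h; rewrite in_itv. Qed.

Lemma euclid_norm_delta i : euclid_norm (delta_mx ord0 i : 'rV[R]_n) = 1.
Proof.
rewrite /euclid_norm /dotv (bigD1 i)//= big1 => [|j ji].
  by rewrite !mxE !eqxx mul1r addr0 sqrtr1.
by rewrite !mxE (negbTE ji) andbF mul0r.
Qed.

Lemma hess_sym k f t x i j : class_C T k.+2 f -> 0 <= t <= T ->
  hess (f t) x i j = hess (f t) x j i.
Proof.
move=> Cf tT; rewrite !mxE.
pose P (a b : R) : 'rV[R]_n := x + a *: delta_mx ord0 j + b *: delta_mx ord0 i.
have P0 : P 0 0 = x by rewrite /P !scale0r !addr0.
have := @schwarz _ (fun a b => f t (P a b)) (fun a b => partial j (f t) (P a b))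
  (fun a b => partial i (f t) (P a b)) (fun a b => partial i (partial j (f t)) (P a b))
  (fun a b => partial j (partial i (f t)) (P a b)) 1 ltr01.
rewrite P0; apply.
  move=> a b _ _; split.
  - under eq_fun do rewrite /P addrAC.
    apply: is_derive_line; rewrite addrAC; exact: (class_C_partialP _ _ Cf).
  - apply: is_derive_line; exact: (class_C_partialP _ _ (class_C_partial j Cf)).
  - apply: is_derive_line; exact: (class_C_partialP _ _ Cf).
  - under eq_fun do rewrite /P addrAC.
    apply: is_derive_line; rewrite addrAC; exact: (class_C_partialP _ _ (class_C_partial i Cf)).
move=> eta eta0.
have [d1 d10 h1] := class_C_continuous x (class_C_partial i (class_C_partial j Cf)) tT eta0.
have [d2 d20 h2] := class_C_continuous x (class_C_partial j (class_C_partial i Cf)) tT eta0.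
exists (Num.min d1 d2 / 2) => [|a b ha hb]; first by rewrite divr_gt0// lt_min d10.
have : euclid_norm (P a b - x) < Num.min d1 d2.
  rewrite /P -[x + _ + _]addrA [x + _]addrC addrK (le_lt_trans (euclid_normD _ _))//.
  by rewrite !euclid_normZ !euclid_norm_delta !mulr1; lra.
rewrite lt_min => /andP[xd1 xd2]; rewrite /= ?P0.
by split; [apply: (h1 t (P a b) tT)|apply: (h2 t (P a b) tT)] => //; rewrite subrr normr0.
Qed.

Lemma is_derive_shiftl (g : R -> R) (tau s d : R) :
  is_derive (tau + s) 1 g d -> is_derive s 1 (fun s => g (tau + s)) d.
Proof.
have -> : (fun s => g (tau + s)) = (fun s => g (tau + s *: (1 : R))).
  by apply/funext => a; rewrite [_ *: _]mulr1.
by move=> h; apply: is_derive_line; rewrite [_ *: _]mulr1.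
Qed.

(** A mean value in time produces the time derivative of the gradient, whereas [mixed_form] contains
    the gradient of the time derivative. The time [t] is interior, so a small square around it stays
    in the domain and all derivatives are two-sided. *)
Lemma dtime_partial k f t x i : class_C T k.+2 f -> 0 < t < T ->
  dtime T (fun t => partial i (f t)) t x = partial i (dtime T f t) x.
Proof.
move=> Cf /andP[t0 tT]; have tT' : 0 <= t <= T by rewrite !ltW.
pose P (a : R) : 'rV[R]_n := x + a *: delta_mx ord0 i.
have P0 : P 0 = x by rewrite /P !scale0r !addr0.
pose e := Num.min t (T - t) / 2.
have e0 : 0 < e by rewrite divr_gt0// lt_min t0 subr_gt0.
have e1 : 2 * e <= t by rewrite mulrC divfK// ge_min lexx.
have e2 : 2 * e <= T - t by rewrite mulrC divfK// ge_min lexx orbT.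
have := @schwarz _ (fun s a => f (t + s) (P a)) (fun s a => dtime T f (t + s) (P a))
  (fun s a => partial i (f (t + s)) (P a)) (fun s a => partial i (dtime T f (t + s)) (P a))
  (fun s a => dtime T (fun t => partial i (f t)) (t + s) (P a)) e e0.
rewrite addr0 P0 => H; apply/esym/H.
  move=> s a; rewrite ler_norml => /andP[se1 se2] _.
  have ts : 0 < t + s < T by apply/andP; split; lra.
  have ts' : 0 <= t + s <= T by case/andP: ts => *; rewrite !ltW.
  split.
  - exact: (is_derive_shiftl (class_C_dtimeP _ Cf ts)).
  - apply: is_derive_line; exact: (class_C_partialP _ _ (class_C_dtime Cf)).
  - apply: is_derive_line; exact: (class_C_partialP _ _ Cf).
  - exact: (is_derive_shiftl (class_C_dtimeP _ (class_C_partial i Cf) ts)).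
move=> eta eta0.
have [d1 d10 h1] := class_C_continuous x (class_C_partial i (class_C_dtime Cf)) tT' eta0.
have [d2 d20 h2] := class_C_continuous x (class_C_dtime (class_C_partial i Cf)) tT' eta0.
exists (Num.min e (Num.min d1 d2)) => [|s a]; first by rewrite !lt_min e0 d10.
rewrite !lt_min => /and3P[se sd1 sd2] /and3P[ae ad1 ad2].
have Px : euclid_norm (P a - x) = `|a|.
  by rewrite /P [x + _]addrC addrK euclid_normZ euclid_norm_delta mulr1.
have tsT : 0 <= t + s <= T.
  by move: se; rewrite ltr_norml => /andP[*]; apply/andP; split; lra.
rewrite /= ?P0 ?addr0.
have Es : t + s - t = s by rewrite addrC addKr.
have := h1 (t + s) (P a) tsT; have := h2 (t + s) (P a) tsT.
rewrite Es Px => /(_ sd2 ad2) H2 /(_ sd1 ad1) H1.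
split.
  exact: H1.
exact: H2.
Qed.

(** A mean value in time at fixed [x], combined with the continuity of the gradient of [dtime T f]
    at [(tau, x0)]. Both the size of the time perturbation and, for [w] the kernel vector, its sign
    are read off from this expansion. *)
Lemma grad_time k f tau x0 (e : R) : class_C T k.+3 f -> 0 < tau < T -> 0 < e ->
  exists2 d : R, 0 < d & forall t x, `|t - tau| < d -> euclid_norm (x - x0) < d ->
    forall w, `|dotv (grad (f t) x - grad (f tau) x) w
                - (t - tau) * dotv (grad (dtime T f tau) x0) w|
              <= e * `|t - tau| * euclid_norm w.
Proof.
move=> Cf /andP[t0 tT] e0; have tT' : 0 <= tau <= T by rewrite !ltW.
have [d d0 hd] := grad_continuous x0 (class_C_dtime Cf) tT' e0.
exists (Num.min d (Num.min tau (T - tau))).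
  by rewrite !lt_min d0 t0 subr_gt0.
move=> t x; rewrite !lt_min => /and3P[td ttau tTt] /andP[xd _] w.
have [|c hc E] := @MVT_between _ (fun t => dotv (grad (f t) x) w)
   (fun t => dotv (grad (dtime T f t) x) w) tau t.
  move=> c hc; have cT : 0 < c < T.
    move: hc; rewrite ge_min le_max => /andP[/orP[c1|c1] /orP[c2|c2]];
     move: ttau tTt; rewrite !ltr_norml => /andP[? ?] /andP[? ?];
     apply/andP; split; lra.
  have -> : (fun t => dotv (grad (f t) x) w) =
      \sum_(j < n) (w ord0 j \*: (fun t => partial j (f t) x)).
    by apply/funext => y; rewrite fct_sumE; apply: eq_bigr => j _; rewrite mxE mulrC.
  have D j := class_C_dtimeP x (class_C_partial j Cf) cT.
  apply: is_derive_eq.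
  by apply: eq_bigr => j _; rewrite (dtime_partial _ _ Cf cT) mxE mulrC.
have ct : `|c - tau| <= `|t - tau|.
  move: hc; rewrite ge_min le_max; rewrite ler_norml.
  have := ler_norm (t - tau); have := ler_norm (tau - t); rewrite distrC.
  by clear; move=> ? ? /andP[/orP[?|?] /orP[?|?]]; apply/andP; split; lra.
have cT : 0 <= c <= T.
  have := ler_norm (c - tau); have := ler_norm (tau - c); rewrite (distrC tau c).
  by move=> ? ?; apply/andP; split; lra.
rewrite dotvBl E [dotv _ w * _]mulrC -mulrBr -dotvBl normrM mulrAC mulrC.
rewrite ler_wpM2r// (le_trans (ler_dotv _ _))// ler_wpM2r ?euclid_norm_ge0//.
by apply/ltW/hd => //; exact: le_lt_trans td.
Qed.

Lemma third_formP f t x l : class_C T 3 f -> 0 <= t <= T ->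
  is_derive x l (fun y => dotv (l *m hess (f t) y) l) (third_form (f t) x l).
Proof.
move=> Cf tT.
have -> : (fun y => dotv (l *m hess (f t) y) l) =
  \sum_(j < n) \sum_(i < n) ((l ord0 i * l ord0 j) \*: partial i (partial j (f t))).
  apply/funext => y; rewrite fct_sumE; apply: eq_bigr => j _.
  rewrite fct_sumE mxE mulr_suml; apply: eq_bigr => i _.
  by rewrite !mxE mulrAC.
have D i j := @class_C_derivable _ _ T 0 (fun t => partial i (partial j (f t))) t x l
    (class_C_partial i (class_C_partial j Cf)) tT.
apply: is_derive_eq.
rewrite /third_form exchange_big /=.
rewrite [RHS]exchange_big /=; apply: eq_bigr => i _.
rewrite [RHS]exchange_big /=; apply: eq_bigr => j _.
rewrite /dotv scaler_sumr; apply: eq_bigr => k _.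
rewrite !mxE -[LHS]/(_ * _ * (_ * _)).
by rewrite mulrC -!mulrA; congr (_ * _); rewrite mulrCA.
Qed.

Lemma third_form_continuous f t x l : class_C T 3 f -> 0 <= t <= T ->
  {for x, continuous (fun y => third_form (f t) y l)}.
Proof.
move=> Cf tT; rewrite /third_form.
apply: (@cvg_sum_real _ _ (nbhs x)) => i; apply: (@cvg_sum_real _ _ (nbhs x)) => j.
apply: (@cvg_sum_real _ _ (nbhs x)) => k.
do 3 apply: cvgMr_tmp.
apply: (@class_C_continuous_at _ _ T 0 (fun t => partial i (partial j (partial k (f t))))) => //.
by do 3 apply: class_C_partial.
Qed.

(** Two mean values, with the factor [q] kept in [q * A q] so that both signs of [p] are treated
    together: the derivative of [phi q - c * q ^+ 2] has the sign opposite to [q], or vanishes. *)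
Lemma taylor2_le (phi A B : R -> R) (c p : R) :
  (forall q : R, is_derive q 1 phi (A q)) -> (forall q : R, is_derive q 1 A (B q)) ->
  phi 0 = 0 -> A 0 = 0 -> (forall q, `|q| <= `|p| -> B q <= 2 * c) ->
  phi p <= c * p ^+ 2.
Proof.
move=> D1 D2 phi0 A0 Bc.
have btw (q : R) (r : R) : Num.min 0 q <= r <= Num.max 0 q -> `|r| <= `|q| /\ 0 <= q * r.
  rewrite ge_min le_max => /andP[/orP[?|?] /orP[?|?]].
  - have -> : r = 0 by lra.
    by rewrite normr0 mulr0.
  - by rewrite !ger0_norm ?mulr_ge0//; lra.
  - by rewrite !ler0_norm ?mulr_le0//; lra.
  - have -> : r = q by lra.
    by rewrite -expr2 sqr_ge0.
have sec q : `|q| <= `|p| -> q * A q <= 2 * c * q ^+ 2.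
  move=> qp; have [r /btw[rq _]] := @MVT_between _ A B 0 q (fun r _ => D2 r).
  rewrite A0 !subr0 => ->.
  rewrite mulrCA -expr2 ler_wpM2r ?sqr_ge0//; apply: Bc.
  exact: le_trans qp.
have D3 (q : R) : is_derive q 1 (fun q => phi q - c * q ^+ 2) (A q - 2 * c * q).
  have -> : (fun q => phi q - c * q ^+ 2) = phi - c \*: ((id : R -> R) ^+ 2).
    by apply/funext.
  apply: is_derive_eq; congr (_ - _).
  by rewrite /GRing.scale /= expr1 mulr1; ring.
have [r /btw[rp rp0]] := @MVT_between _ _ _ 0 p (fun r _ => D3 r).
rewrite phi0 expr0n mulr0 !subr0 => E.
suff : phi p - c * p ^+ 2 <= 0 by rewrite subr_le0.
rewrite E; have := sec r rp => Xr.
have [->|r0] := eqVneq r 0; first by rewrite A0 mulr0 subrr mul0r.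
have r2 : 0 < r ^+ 2 by rewrite exprn_even_gt0.
(* The factor [r ^+ 2] makes [p * r], known to be nonnegative, and the bound [sec] at [r] appear. *)
have : (A r - 2 * c * r) * p * r ^+ 2 <= 0; last by rewrite pmulr_lle0.
have -> : (A r - 2 * c * r) * p * r ^+ 2 = (p * r) * (r * A r - 2 * c * r ^+ 2) by ring.
by rewrite mulr_ge0_le0// subr_le0.
Qed.

Lemma fold_taylor f tau xi l : class_C T 3 f -> 0 <= tau <= T ->
  grad (f tau) xi = 0 -> dotv (l *m hess (f tau) xi) l = 0 ->
  third_form (f tau) xi l < 0 ->
  exists2 d : R, 0 < d & forall p : R, `|p| < d ->
    dotv (grad (f tau) (xi + p *: l)) l <= third_form (f tau) xi l / 4 * p ^+ 2.
Proof.
move=> Cf tT g0 h0 c0; set c := third_form _ _ _ in c0 *.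
(* The Taylor coefficient at [xi] is [c / 2]. Allowing the third derivative to vary by half of its
   size leaves [c / 4]. *)
have e0 : 0 < - (c / 2) by lra.
have := third_form_continuous (x := xi) (l := l) Cf tT.
move=> /(@cvgrPdist_lt _ R^o _ (nbhs xi) _ _ _) => /(_ _ e0) /nbhs_euclidP[d d0 hd].
have l0 : 0 < euclid_norm l + 1 by rewrite ltr_wpDl// euclid_norm_ge0.
exists (d / (euclid_norm l + 1)) => [|p pd]; first by rewrite divr_gt0.
have third_le q : `|q| <= `|p| -> third_form (f tau) (xi + q *: l) l <= c / 2.
  move=> qp; have /hd : euclid_norm (xi + q *: l - xi) < d.
    rewrite [xi + _]addrC addrK euclid_normZ.
    apply: (@le_lt_trans _ _ (`|p| * (euclid_norm l + 1))); last by rewrite -ltr_pdivlMr.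
    by rewrite ler_pM ?euclid_norm_ge0// lerDl.
  by rewrite ltr_norml -/c => /andP[]; lra.
pose A q := dotv (l *m hess (f tau) (xi + q *: l)) l.
pose B q := third_form (f tau) (xi + q *: l) l.
apply: (@taylor2_le (fun q => dotv (grad (f tau) (xi + q *: l)) l) A B).
- move=> q; exact: (is_derive_line (class_C_derive_gradF (xi + q *: l) l l Cf tT)).
- move=> q; exact: (is_derive_line (third_formP (xi + q *: l) l Cf tT)).
- by rewrite scale0r addr0 g0 dotv0l.
- by rewrite /A scale0r addr0 h0.
- by move=> q qp; have := third_le q qp; rewrite /B; lra.
Qed.

End Symmetry.

(** * Quadratic forms *)

Section QuadraticForms.
Context {R : realType} {n : nat}.
Implicit Types (H : 'M[R]_n) (x y l : 'rV[R]_n).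

Lemma dotv_eq0 x : (dotv x x == 0) = (x == 0).
Proof.
apply/eqP/eqP => [x0|->]; last exact: dotv0l.
have := norm_le_euclid x; rewrite /euclid_norm x0 sqrtr0 => h.
by apply/eqP; rewrite -normr_le0.
Qed.

Lemma euclid_norm_eq0 x : euclid_norm x = 0 -> x = 0.
Proof. by move=> x0; apply/eqP; rewrite -dotv_eq0 -euclid_norm_sqr x0 expr0n. Qed.

Lemma dotv_gt0 x : x != 0 -> 0 < dotv x x.
Proof. by move=> x0; rewrite lt_def dotv_eq0 x0 dotvv_ge0. Qed.

Lemma dotv_mulmx_sym H x y : (forall i j, H i j = H j i) ->
  dotv (x *m H) y = dotv (y *m H) x.
Proof.
move=> Hs; rewrite /dotv.
under eq_bigr do rewrite mxE mulr_suml.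
under [RHS]eq_bigr do rewrite mxE mulr_suml.
rewrite exchange_big /=; apply: eq_bigr => i _; apply: eq_bigr => j _.
by rewrite (Hs i j); ring.
Qed.

Lemma dotv_continuous (g1 g2 : 'rV[R]_n -> 'rV[R]_n) x :
  (forall i, {for x, continuous (fun y => g1 y ord0 i)}) ->
  (forall i, {for x, continuous (fun y => g2 y ord0 i)}) ->
  {for x, continuous (fun y => dotv (g1 y) (g2 y))}.
Proof.
move=> c1 c2; apply: (@cvg_sum_real _ _ (nbhs x)) => i.
by apply: (@cvgM _ _ (nbhs x)); [exact: c1|exact: c2].
Qed.

Lemma mulmx_coord_continuous H x i : {for x, continuous (fun y => (y *m H) ord0 i)}.
Proof.
rewrite (_ : (fun y => (y *m H) ord0 i) = fun y => \sum_j y ord0 j * H j i); last first.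
  by apply/funext => y; rewrite mxE.
apply: (@cvg_sum_real _ _ (nbhs x)) => j.
by apply: (@cvgMr_tmp _ _ (nbhs x)); exact: coord_continuous.
Qed.

(** The minimum of the form on the compact unit sphere of the orthogonal complement of [l] is
    positive, and homogeneity extends the bound. With [l = 0] the complement is the whole space. *)
Lemma coercive_on_orthogonal H l :
  (forall x, x != 0 -> dotv x l = 0 -> 0 < dotv (x *m H) x) ->
  exists2 m : R, 0 < m & forall x, dotv x l = 0 -> m * dotv x x <= dotv (x *m H) x.
Proof.
move=> Hp; pose A := [set x : 'rV[R]_n | dotv x x = 1 /\ dotv x l = 0].
have norm1 x : x != 0 -> dotv x l = 0 -> A ((euclid_norm x)^-1 *: x).
  move=> x0 xl; split; rewrite dotvZl; last by rewrite xl mulr0.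
  rewrite dotvZr -euclid_norm_sqr mulrA -expr2 -exprMn mulVf ?expr1n//.
  by apply: contra_neq x0 => /euclid_norm_eq0.
(* The sphere may be empty, for example when [n = 1] and [l != 0]; every vector orthogonal to [l] is
   then zero. *)
have [[x0 Ax0]|A0] := pselect (exists x, A x); last first.
  exists 1 => // x xl; have [->|x0] := eqVneq x 0; first by rewrite mul0mx !dotv0l mulr0.
  by exfalso; apply: A0; exists ((euclid_norm x)^-1 *: x); exact: norm1.
have cA : compact A.
  apply: bounded_closed_compact.
    exists 1; split => // M M1 x [x1 _]; rewrite /= (le_trans (norm_le_euclid _))//.
    by rewrite /euclid_norm x1 sqrtr1 ltW.
  have -> : A = (fun x : 'rV[R]_n => dotv x x) @^-1` [set 1] `&`
                (fun x : 'rV[R]_n => dotv x l) @^-1` [set 0] by [].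
  apply: closedI; apply: closed_comp; try exact: closed_eq.
    by move=> x _; apply: dotv_continuous => i; exact: coord_continuous.
  by move=> x _; apply: dotv_continuous => i; [exact: coord_continuous|exact: cst_continuous].
have [|||c Ac cmin] := @EVT_min_rV _ _ (fun x => dotv (x *m H) x) A.
- by exists x0.
- exact: cA.
- apply: continuous_subspaceT => x; apply: dotv_continuous => i.
    exact: mulmx_coord_continuous.
  exact: coord_continuous.
case: (set_mem Ac) => c1 cl; have c0 : c != 0 by rewrite -dotv_eq0 c1 oner_eq0.
exists (dotv (c *m H) c); first exact: Hp.
move=> x xl; have [->|x0'] := eqVneq x 0; first by rewrite mul0mx !dotv0l mulr0.
have e0 : euclid_norm x != 0 by apply: contra_neq x0' => /euclid_norm_eq0.
have := cmin _ (mem_set (norm1 x x0' xl)).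
rewrite -scalemxAl dotvZl dotvZr mulrA -expr2 exprVn mulrC ler_pdivlMr.
  by rewrite euclid_norm_sqr.
by rewrite euclid_norm_sqr dotv_gt0.
Qed.

Lemma coercive_posdef H : posdef H ->
  exists2 m : R, 0 < m & forall x, m * dotv x x <= dotv (x *m H) x.
Proof.
move=> Hp; have [x x0 _|m m0 h] := @coercive_on_orthogonal H 0; first exact: Hp.
by exists m => // x; apply: h; rewrite dotv0r.
Qed.

(** The form at [x - s *: (x *m H)] is a polynomial in [s] without constant term; it can be
    nonnegative for small [s > 0] only if its linear coefficient, minus twice the square of the norm
    of [x *m H], vanishes. *)
Lemma possemidef_ker H x : (forall i j, H i j = H j i) -> possemidef H ->
  dotv (x *m H) x = 0 -> x *m H = 0.
Proof.
move=> Hs Hp x0; set z := x *m H.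
have h (s : R) : 0 <= dotv (z *m H) z * s ^+ 2 - 2 * s * dotv z z.
  have := Hp (x - s *: z).
  rewrite mulmxBl -scalemxAl !(dotvBl, dotvBr, dotvZl, dotvZr) x0.
  by rewrite (dotv_mulmx_sym z x Hs) -/z => h; apply: (le_trans h); rewrite le_eqVlt; apply/orP; left; apply/eqP; ring.
apply/eqP; rewrite -dotv_eq0 eq_le dotvv_ge0 andbT leNgt; apply/negP => z0.
have A0 : 0 <= dotv (z *m H) z by exact: Hp.
set A := dotv (z *m H) z in h A0; set B := dotv z z in h z0.
have A1 : 0 < A + 1 by lra.
(* A value of [s] near the minimiser [B / A]; the shift by [1] covers [A = 0]. *)
have := h (B / (A + 1)).
have -> : A * (B / (A + 1)) ^+ 2 - 2 * (B / (A + 1)) * B =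
    - (B ^+ 2 * (A + 2) / (A + 1) ^+ 2) by field; rewrite gt_eqF.
rewrite oppr_ge0 leNgt => /negP; apply.
by rewrite divr_gt0 ?exprn_gt0// mulr_gt0 ?exprn_gt0//; lra.
Qed.

Lemma possemidef_det_posdef H : (forall i j, H i j = H j i) -> possemidef H ->
  \det H <> 0 -> posdef H.
Proof.
move=> Hs Hp detH x x0; rewrite lt_def Hp andbT; apply/eqP => /(possemidef_ker Hs Hp) xH.
have Hu : H \in unitmx by rewrite unitmxE unitfE; apply/eqP.
by move/eqP: x0; apply; rewrite -(mulmxK Hu x) xH mul0mx.
Qed.

Lemma coercive_fold H l : (forall i j, H i j = H j i) -> possemidef H ->
  l != 0 -> (kermx H :=: l)%MS ->
  l *m H = 0 /\ exists2 m : R, 0 < m &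
    forall x, dotv x l = 0 -> m * dotv x x <= dotv (x *m H) x.
Proof.
move=> Hs Hp l0 Hl; split; first by apply/sub_kermxP; rewrite Hl.
apply: coercive_on_orthogonal => x x0 xl; rewrite lt_def Hp andbT.
apply/eqP => /(possemidef_ker Hs Hp)/sub_kermxP; rewrite Hl => /sub_rVP[a xE].
move: xl; rewrite xE dotvZl => /eqP; rewrite mulf_eq0 => /orP[/eqP a0|].
  by move: x0; rewrite xE a0 scale0r eqxx.
by rewrite dotv_eq0 (negbTE l0).
Qed.

End QuadraticForms.

(** * Passage through a fold *)

Ltac positivity := repeat first [done | apply: exprn_gt0 | apply: mulr_gt0
  | rewrite invr_gt0 | apply: addr_gt0].

Lemma is_derive_rV (R : realType) n (a : R -> 'rV[R]_n) (t : R) (da : 'rV[R]_n) :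
  (forall i, is_derive t 1 (fun x => a x ord0 i) (da ord0 i)) ->
  is_derive t 1 a da.
Proof.
move=> h; have D : derivable a t 1.
  by apply/derivable_mxP => i j; rewrite (ord1 i); have := h j; case.
apply: DeriveDef => //; rewrite derive_mx//; apply/matrixP => i j.
by rewrite mxE (ord1 i); have [_] := h j.
Qed.

Lemma is_derive_comp_rV (R : realType) n (a : R -> 'rV[R]_n) (s : R -> R) (t : R) (da : 'rV[R]_n) (ds : R) :
  is_derive (s t) 1 a da -> is_derive t 1 s ds ->
  is_derive t 1 (fun x => a (s x)) (ds *: da).
Proof.
move=> ad sd; apply: is_derive_rV => i; rewrite mxE mulrC.
exact: (@is_derive1_comp _ (fun x => a x ord0 i) s) (is_derive_coord ord0 i ad) sd.
Qed.

Section Projection.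
Context {R : realType} {n : nat}.
Implicit Types x l : 'rV[R]_n.

Lemma proj_orthogonal x l : dotv l l = 1 -> dotv (x - dotv x l *: l) l = 0.
Proof. by move=> ll; rewrite dotvBl dotvZl ll mulr1 subrr. Qed.

Lemma proj_norm_le x l : dotv l l = 1 ->
  `|dotv x l| <= euclid_norm x /\ euclid_norm (x - dotv x l *: l) <= euclid_norm x.
Proof.
move=> ll; have l1 : euclid_norm l = 1 by rewrite /euclid_norm ll sqrtr1.
split; first by rewrite (le_trans (ler_dotv _ _))// l1 mulr1.
rewrite euclid_norm_le ?euclid_norm_ge0// euclid_norm_sqr.
rewrite !(dotvBl, dotvBr, dotvZl, dotvZr) ll (dotvC l x).
by have := sqr_ge0 (dotv x l); lra.
Qed.

End Projection.

(* With [a = |q|], [p' = Pd] and [GQ = G . q], the right-hand side is the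
   derivative of [|q|^2 - K^2 p^4] along the flow, [K = 4 C / lam]. *)
Lemma cone_algebra (R : realType) (C lam K r0 a p Pd GQ : R) :
  0 < C -> 0 < lam -> 0 < r0 -> lam * K = 4 * C -> 2 * r0 * K <= 1 -> 32 * r0 * C <= lam ->
  0 <= a -> K * p ^+ 2 <= a -> `|p| <= r0 ->
  lam / 2 * a ^+ 2 - C * p ^+ 2 * a <= GQ -> `|Pd| <= C * p ^+ 2 + C * (2 * r0) * a ->
  - 2 * GQ - 4 * K ^+ 2 * (p ^+ 3 * Pd) <= 0.
Proof.
move=> C0 lam0 r00 KE h1 h2 a0 Kp pr hG hP.
have K0 : 0 < K by rewrite -(pmulr_rgt0 _ lam0) KE; lra.
have p2 : 0 <= p ^+ 2 by exact: sqr_ge0.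
have G1 : lam / 4 * a ^+ 2 <= GQ.
  apply: le_trans hG.
  have : C * p ^+ 2 * a <= lam / 4 * a ^+ 2.
    have -> : C * p ^+ 2 * a = lam / 4 * ((K * p ^+ 2) * a).
      by have -> : C = lam * K / 4; [rewrite KE; field|field].
    by rewrite expr2 ler_pM2l ?divr_gt0// ler_wpM2r.
  lra.
have P1 : `|p ^+ 3 * Pd| * K ^+ 2 <= 2 * (r0 * (C * a ^+ 2)).
  rewrite normrM normrX.
  have -> : `|p| ^+ 3 = `|p| * p ^+ 2 by rewrite exprS real_normK// num_real.
  have A1 : p ^+ 2 * `|Pd| * K ^+ 2 <= 2 * (C * a ^+ 2).
    apply: (@le_trans _ _ (p ^+ 2 * (C * p ^+ 2 + C * (2 * r0) * a) * K ^+ 2)).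
      by rewrite ler_wpM2r ?sqr_ge0// ler_wpM2l.
    have -> : p ^+ 2 * (C * p ^+ 2 + C * (2 * r0) * a) * K ^+ 2 =
      C * ((K * p ^+ 2) * (K * p ^+ 2)) + C * (2 * r0 * K * ((K * p ^+ 2) * a)) by ring.
    have Kp0 : 0 <= K * p ^+ 2 by rewrite mulr_ge0// ltW.
    have : (K * p ^+ 2) * (K * p ^+ 2) <= a ^+ 2 by rewrite [a ^+ 2]expr2 ler_pM.
    have : 2 * r0 * K * ((K * p ^+ 2) * a) <= 1 * a ^+ 2.
      rewrite [a ^+ 2]expr2; apply: ler_pM => //; last exact: ler_wpM2r.
        by rewrite !mulr_ge0// ltW.
      exact: mulr_ge0.
    rewrite -(ler_pM2l C0) => B1; rewrite -(ler_pM2l C0) => B2; clear -B1 B2; lra.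
  have -> : `|p| * p ^+ 2 * `|Pd| * K ^+ 2 = `|p| * (p ^+ 2 * `|Pd| * K ^+ 2) by ring.
  have -> : 2 * (r0 * (C * a ^+ 2)) = r0 * (2 * (C * a ^+ 2)) by ring.
  by apply: ler_pM => //; apply: (mulr_ge0 (mulr_ge0 _ _)); rewrite ?sqr_ge0.
have P2 : - (p ^+ 3 * Pd) * K ^+ 2 <= 2 * (r0 * (C * a ^+ 2)).
  apply: le_trans P1; rewrite ler_wpM2r ?sqr_ge0//.
  by rewrite -normrN; exact: ler_norm.
have P3 : 32 * r0 * C * a ^+ 2 <= lam * a ^+ 2 by rewrite ler_wpM2r ?sqr_ge0.
have la : 0 <= lam * a ^+ 2 by rewrite mulr_ge0 ?sqr_ge0// ltW.
clear - G1 P2 P3 la; lra.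
Qed.

Lemma first_hit (R : realType) (g : R -> R) (a b m : R) :
  {within `[a, b], continuous g} -> g a < m ->
  (exists2 t, a <= t <= b & m <= g t) ->
  exists2 te, a <= te <= b & g te = m /\ forall t, a <= t < te -> g t < m.
Proof.
move=> cg ga [t1 /andP[at1 t1b] gt1].
pose S := [set t | a <= t <= b /\ m <= g t].
have lbS : lbound S a by move=> t [/andP[]].
have St1 : S t1 by split; [rewrite at1|].
have Sinf : has_inf S by split; [exists t1|exists a].
pose s := inf S.
have as_ : a <= s by apply: lb_le_inf => //; exists t1.
have st1 : s <= t1 by apply: ge_inf => //; exists a.
have sab : a <= s <= b by rewrite as_ (le_trans st1).
have lts t : a <= t < s -> g t < m.
  move=> /andP[at_ ts]; rewrite ltNge; apply/negP => gt.
  have : s <= t; last by rewrite leNgt ts.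
  by apply: ge_inf; [exists a|split => //; rewrite at_ (le_trans (ltW ts))// (le_trans st1)].
have gs1 : m <= g s.
  rewrite leNgt; apply/negP => gs; have d1 : 0 < m - g s by rewrite subr_gt0.
  have [d d0 hd] := (within_continuousP _ _).1 cg s sab _ d1.
  have [t [tab gt] ts] := inf_adherent d0 Sinf.
  have st : s <= t by apply: ge_inf; [exists a|split].
  have : `|t - s| < d by rewrite ger0_norm ?subr_ge0// ltrBlDl.
  by move=> /(hd t tab)/(le_lt_trans (ler_norm _)); move: gt; clear; lra.
exists s => //; split => //; apply/eqP; rewrite eq_le gs1 andbT leNgt; apply/negP => gs.
have as' : a < s by rewrite lt_neqAle as_ andbT; apply: contraTneq gs => <-; rewrite -leNgt ltW.
have d1 : 0 < g s - m by rewrite subr_gt0.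
have [d d0 hd] := (within_continuousP _ _).1 cg s sab _ d1.
pose t := Num.max a (s - d / 2).
have ts : t < s by rewrite gt_max as' ltrBlDr ltrDl divr_gt0.
have at_ : a <= t by rewrite le_max lexx.
have td : s - d / 2 <= t by rewrite le_max lexx orbT.
have gt : g t < m by apply: lts; rewrite at_.
have : `|t - s| < d by rewrite ltr0_norm ?subr_lt0//; move: td d0; clear; lra.
have tab : a <= t <= b by case/andP: sab => _ sb; rewrite at_ (le_trans (ltW ts)).
by move=> /(hd t tab); rewrite ltr_norml; move: gt; clear; lra.
Qed.

Lemma MVT_exists (R : realType) (g : R -> R) (a b : R) : a < b ->
  {within `[a, b], continuous g} ->
  (forall t, a < t < b -> exists d, is_derive t 1 g d) ->
  exists x d, [/\ a < x < b, is_derive x 1 g d & d * (b - a) = g b - g a].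
Proof.
move=> ab cg dg.
have D x : x \in `]a, b[ -> is_derive x 1 g ('D_1 g x).
  by rewrite in_itv => /dg[d dd]; apply: DeriveDef => //; case: dd.
have [x xab E] := MVT ab D cg.
by exists x, ('D_1 g x); split; [move: xab; rewrite in_itv|exact: D|].
Qed.

(* [-A - B + ...] is [eps * D . D'] for the deviation [D] from the slow curve. *)
Lemma deviation_algebra (R : realType) (C lam K r0 h r d A A' B B' N E : R) :
  0 <= C -> 0 <= h -> 0 <= d -> 0 <= K -> 0 <= r0 ->
  `|A| <= C * h * d -> `|A'| <= C * h -> lam / 2 * d ^+ 2 <= B ->
  `|B'| <= C * (3 * r0) * d -> `|N| <= K * d -> E <= 4 * C * r ^+ 2 * d ->
  C * (3 * r0) * K <= lam / 4 ->
  E - A - B + (A' + B') * N <= - (lam / 4) * d ^+ 2 + (4 * C * r ^+ 2 + C * (1 + K) * h) * d.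
Proof.
move=> C0 h0 d0 K0 r00 hA hA' hB hB' hN hE hK.
have h1 : (A' + B') * N <= (C * h + C * (3 * r0) * d) * (K * d).
  apply: (le_trans (ler_norm _)); rewrite normrM ler_pM//.
  by rewrite (le_trans (ler_normD _ _))// lerD.
have h2 : C * (3 * r0) * K * d ^+ 2 <= lam / 4 * d ^+ 2 by rewrite ler_wpM2r ?sqr_ge0.
have h3 : - A <= C * h * d by rewrite (le_trans _ hA)// -normrN ler_norm.
have E1 : (C * h + C * (3 * r0) * d) * (K * d) = C * K * h * d + C * (3 * r0) * K * d ^+ 2 by ring.
have E2 : (4 * C * r ^+ 2 + C * (1 + K) * h) * d = 4 * C * r ^+ 2 * d + C * h * d + C * K * h * d by ring.
rewrite E2; rewrite E1 in h1; clear - h1 h2 h3 hE hB; lra.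
Qed.

(** Here [a] is the absolute value of the kernel coordinate and [q] the distance to the kernel line,
    so that [C * (a + q) * q] is the coupling to be set against the cubic drift [cc * a ^+ 2].
    Young's inequality on [C * a * eta] spends a quarter of the drift, and the smallness of [r0]
    covers the other terms in [a ^+ 2]. What survives is quadratic in [eta]. *)
Lemma exit_algebra (R : realType) (C cc K r0 a q eta : R) :
  0 < C -> 0 < cc -> 0 <= K -> 0 <= a -> a <= r0 -> 0 <= q -> 0 <= eta -> q <= eta + K * a ^+ 2 ->
  K * r0 <= 1 -> 8 * C * K * r0 <= cc ->
  C * (a + q) * q - cc * a ^+ 2 <= (C ^+ 2 / cc + 2 * C) * eta ^+ 2.
Proof.
move=> C0 cc0 K0 a0 ar q0 eta0 qle Kr0 CK.
have a2 : 0 <= a ^+ 2 := sqr_ge0 a.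
have h1 : C * a * q <= C * a * eta + (C * K * r0) * a ^+ 2.
  apply: (@le_trans _ _ (C * a * (eta + K * a ^+ 2))); first by rewrite ler_wpM2l// mulr_ge0// ltW.
  have -> : C * a * (eta + K * a ^+ 2) = C * a * eta + (C * K * a) * a ^+ 2 by ring.
  by rewrite lerD2l ler_wpM2r// ler_wpM2l// mulr_ge0// ltW.
have h2 : q ^+ 2 <= 2 * eta ^+ 2 + 2 * (K * r0) * a ^+ 2.
  have Ka : 0 <= K * a ^+ 2 by rewrite mulr_ge0.
  apply: (@le_trans _ _ ((eta + K * a ^+ 2) ^+ 2)); first by rewrite ler_sqr ?nnegrE// addr_ge0.
  have : (K * a ^+ 2) ^+ 2 <= K * r0 * a ^+ 2 * (1 : R).
    have -> : (K * a ^+ 2) ^+ 2 = ((K * a) * a ^+ 2) * (K * a) by ring.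
    have Ka1 : K * a <= K * r0 by rewrite ler_wpM2l.
    by apply: ler_pM; rewrite ?mulr_ge0// ?ler_wpM2r// (le_trans Ka1).
  by have := sqr_ge0 (eta - K * a ^+ 2); clear; lra.
have h3 : C * a * eta <= cc / 4 * a ^+ 2 + C ^+ 2 / cc * eta ^+ 2.
  have := sqr_ge0 (cc / 2 * a - C * eta) => h.
  have : 0 <= (cc / 2 * a - C * eta) ^+ 2 / cc by rewrite divr_ge0// ltW.
  have -> : (cc / 2 * a - C * eta) ^+ 2 / cc =
    cc / 4 * a ^+ 2 - C * a * eta + C ^+ 2 / cc * eta ^+ 2 by field; rewrite gt_eqF.
  by clear; lra.
have h4 : C * q ^+ 2 <= C * (2 * eta ^+ 2 + 2 * (K * r0) * a ^+ 2) by rewrite ler_wpM2l// ltW.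
have h5 : 8 * C * K * r0 * a ^+ 2 <= cc * a ^+ 2 by rewrite ler_wpM2r.
have h6 : 0 <= cc * a ^+ 2 by rewrite mulr_ge0// ltW.
have -> : C * (a + q) * q = C * a * q + C * q ^+ 2 by ring.
clear - h1 h3 h4 h5 h6; lra.
Qed.

Lemma half_lt (R : realType) (x : R) : 0 < x -> x / 2 < x.
Proof. by move=> x0; lra. Qed.

(** Differentiability inside and continuity up to the end points is exactly what the barrier lemmas
    use, and it passes to subintervals. *)
Definition solves (R : realType) n (F : R -> 'rV[R]_n -> 'rV[R]_n) (eps : R)
    (u : R -> 'rV[R]_n) (a b : R) : Prop :=
  {within `[a, b], continuous u} /\
  forall t : R, a < t < b -> exists2 u', is_derive t 1 u u' & eps *: u' = - F t (u t).

Section Fold.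
Context {R : realType} {n : nat}.
Variables (F : R -> 'rV[R]_n -> 'rV[R]_n) (J : 'rV[R]_n -> 'M[R]_n).
Variables (tau : R) (xi l : 'rV[R]_n) (rho C lam cc beta : R).
Local Notation G := (F tau).
Local Notation e := euclid_norm.

(** The fold in quantitative form. [J] stands for the Hessian at time [tau], [coer] is its
    coercivity across the kernel and [Ftay] the cubic drift along it; [GMVT], [JL] and [Jop] carry
    the smoothness. One radius [rho] and one constant [C] serve all estimates. *)
Hypotheses (rho0 : 0 < rho) (C0 : 0 < C) (lam0 : 0 < lam) (cc0 : 0 < cc) (beta0 : 0 < beta).
Hypothesis Fxi : G xi = 0.
Hypothesis ll : dotv l l = 1.
Hypothesis lJ : l *m J xi = 0.
Hypothesis Jsym : forall x y, dotv (x *m J xi) y = dotv (y *m J xi) x.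
Hypothesis GMVT : forall x v w, exists2 th : R, 0 <= th <= 1 &
  dotv (G (x + v) - G x) w = dotv (v *m J (x + th *: v)) w.
Hypothesis JL : forall x, e (x - xi) < rho -> forall u w,
  `|dotv (u *m (J x - J xi)) w| <= C * e (x - xi) * (e u * e w).
Hypothesis Jop : forall u w, `|dotv (u *m J xi) w| <= C * (e u * e w).
Hypothesis coer : forall q, dotv q l = 0 -> lam * dotv q q <= dotv (q *m J xi) q.
Hypothesis Ftay : forall p : R, `|p| < rho -> dotv (G (xi + p *: l)) l <= - cc * p ^+ 2.

Lemma norm_l : e l = 1.
Proof. by rewrite /euclid_norm ll sqrtr1. Qed.

Lemma segment_dist x v (th : R) : 0 <= th <= 1 -> e (x + th *: v - xi) <= e (x - xi) + e v.
Proof.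
move=> /andP[t0 t1]; rewrite addrAC (le_trans (euclid_normD _ _))// lerD2l.
by rewrite euclid_normZ ger0_norm// ler_piMl// euclid_norm_ge0.
Qed.

(** Since [l] lies in the kernel of [J xi], the linear term drops out; the Lipschitz bound on [J]
    leaves a second power of [p]. *)
Lemma G_axis (p : R) w : `|p| < rho -> `|dotv (G (xi + p *: l)) w| <= C * p ^+ 2 * e w.
Proof.
move=> pr; have [th th01] := GMVT xi (p *: l) w; rewrite Fxi subr0 => ->.
have pl : e (p *: l) = `|p| by rewrite euclid_normZ norm_l mulr1.
have d0 : e (xi + th *: (p *: l) - xi) <= `|p|.
  by have := segment_dist xi (p *: l) th01; rewrite subrr euclid_norm0 add0r pl.
have := JL (le_lt_trans d0 pr) (p *: l) w.
rewrite mulmxBr -(scalemxAl _ _ (J xi)) lJ scaler0 subr0 => /le_trans; apply.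
rewrite pl mulrA ler_wpM2r ?euclid_norm_ge0// -mulrA ler_wpM2l ?(ltW C0)//.
by rewrite -real_normK ?num_real// expr2 ler_wpM2r.
Qed.

Lemma G_diff x v w (r : R) : e (x - xi) + e v <= r -> r < rho -> 
  `|dotv (G (x + v) - G x) w - dotv (v *m J xi) w| <= C * r * (e v * e w).
Proof.
move=> xr rr; have [th th01 ->] := GMVT x v w.
have d0 := le_trans (segment_dist x v th01) xr.
rewrite -dotvBl -mulmxBr (le_trans (JL (le_lt_trans d0 rr) _ _))//.
by rewrite ler_wpM2r ?mulr_ge0 ?euclid_norm_ge0// ler_wpM2l// ltW.
Qed.

Lemma G_coercive x q (r : R) : e (x - xi) + e q <= r -> r < rho -> C * r <= lam / 2 ->
  dotv q l = 0 -> lam / 2 * dotv q q <= dotv (G (x + q) - G x) q.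
Proof.
move=> xr rr Cr ql; have := G_diff q xr rr; rewrite -expr2 euclid_norm_sqr.
have := coer ql; have := dotvv_ge0 q; set A := dotv q q; set B := dotv _ _; set D := dotv _ _.
rewrite ler_norml => A0 h /andP[h1 _]; have h2 : C * r * A <= lam / 2 * A by rewrite ler_wpM2r.
lra.
Qed.

(** By symmetry of [J xi] the linear part of a transverse displacement has no component along [l].
    The coupling of the deviation into the kernel direction therefore carries the small factor
    [r]. *)
Lemma G_transverse x q (r : R) : e (x - xi) + e q <= r -> r < rho ->
  dotv q l = 0 -> `|dotv (G (x + q) - G x) l| <= C * r * e q.
Proof.
move=> xr rr ql; have := G_diff l xr rr.
by rewrite Jsym lJ dotv0l subr0 norm_l mulr1.
Qed.

Lemma G_lipschitz x v w (r : R) : e (x - xi) + e v <= r -> r < rho -> 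
  `|dotv (G (x + v) - G x) w| <= (C + C * rho) * (e v * e w).
Proof.
move=> xr rr; have := G_diff w xr rr; have := Jop v w.
set A := dotv _ _; set B := dotv _ _; set E := e v * e w.
have E0 : 0 <= E by rewrite mulr_ge0 ?euclid_norm_ge0.
have h1 : C * r * E <= C * rho * E by rewrite ler_wpM2r// ler_wpM2l ?ltW.
move=> h2 h3; have -> : B = A + (B - A) by ring.
apply: (le_trans (ler_normD _ _)); lra.
Qed.

(* The trace of the orbit [v] leaving [xi], as a graph [c] over the kernel
   coordinate [p], prolonged by the kernel line for [p <= 0]. *)
Record slow_curve (v : R -> 'rV[R]_n) (r0 K p1 : R) (c c1 : R -> 'rV[R]_n) : Prop := {
  sc_p1 : 0 < p1 <= r0;
  sc_der : forall p, p < p1 -> is_derive p 1 c (c1 p);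
  sc_norm : forall p, p < p1 -> e (c1 p) <= K;
  sc_proj : forall p, p < p1 -> dotv (c p - xi) l = p;
  sc_tan : forall p, p < p1 -> e (c p - (xi + p *: l)) <= K * p ^+ 2;
  sc_neg : forall p, p <= 0 -> c p = xi + p *: l /\ c1 p = l;
  sc_inv : forall p, 0 < p < p1 -> G (c p) = dotv (G (c p)) l *: c1 p;
  sc_range : forall p, 0 < p < p1 -> exists s, c p = v s
}.

(** * The orbit leaving the fold point *)

Section Orbit.
Variables (v : R -> 'rV[R]_n) (y : 'rV[R]_n).
Hypothesis v_der : forall s : R, is_derive s 1 v (- G (v s)).
Hypothesis v_minus : v s @[s --> -oo] --> xi.
Hypothesis v_plus : v s @[s --> +oo] --> y.
Hypothesis y_xi : y <> xi.

Let P s := dotv (v s - xi) l.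
Let Q s := v s - xi - P s *: l.
Let K := 4 * C / lam.
Variable r0 : R.
Hypotheses (r00 : 0 < r0) (r0rho : 2 * r0 < rho) (r0K : 2 * r0 * K <= 1)
  (r0C : 32 * r0 * C <= lam) (r0cc : 4 * C * r0 * K <= cc).

Lemma v_decomp s : v s = xi + P s *: l + Q s.
Proof. by rewrite /Q [v s - xi - _]addrC addrA addrK addrC subrK. Qed.

Lemma orbit_P_der (s : R) : is_derive s 1 P (- dotv (G (v s)) l).
Proof.
rewrite -dotvNl; apply: is_derive_dotvl.
by rewrite -[- G _]subr0; apply: is_deriveB.
Qed.

Lemma orbit_Q_der (s : R) : is_derive s 1 Q (- G (v s) + dotv (G (v s)) l *: l).
Proof.
have := orbit_P_der s => DP.
apply: is_derive_rV => i.
have -> : (fun s => Q s ord0 i) = (fun s => v s ord0 i) - cst (xi ord0 i) - l ord0 i \*: P.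
  by apply/funext => u; rewrite /Q !mxE; congr (_ - _); rewrite /= mulrC.
have := is_derive_coord ord0 i (v_der s) => Dv.
apply: is_derive_eq.
by rewrite !mxE subr0 /GRing.scale /=; ring.
Qed.

Lemma orbit_QQ_der (s : R) :
  is_derive s 1 (fun s => dotv (Q s) (Q s)) (- 2 * dotv (G (v s)) (Q s)).
Proof.
have D := orbit_Q_der s.
apply: is_derive_eq; first exact: is_derive_dotv.
have := proj_orthogonal (v s - xi) ll; rewrite -/(P s) -/(Q s).
move: (Q s) (G (v s)) => q g ql.
by rewrite (dotvC q) !(dotvDl, dotvNl, dotvZl) (dotvC l) ql; ring.
Qed.

Lemma PQ_small s : e (v s - xi) < r0 -> [/\ `|P s| < r0, e (Q s) < r0 &
  e (P s *: l) + e (Q s) <= 2 * r0].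
Proof.
move=> vs; have [h1 h2] := proj_norm_le (v s - xi) ll.
have h3 := le_lt_trans h1 vs; have h4 := le_lt_trans h2 vs.
split => //; rewrite euclid_normZ norm_l mulr1.
move: h3 h4; rewrite -/(P s) -/(Q s); set a := `|_|; set b := e _; lra.
Qed.

Lemma orbit_near_xi : exists s1 : R, forall s, s <= s1 -> e (v s - xi) < r0.
Proof.
have /cvg_euclidP/(_ _ r00) [M [Mr hM]] := v_minus.
by exists (M - 1) => s sM; apply: hM; lra.
Qed.

Lemma K_gt0 : 0 < K. Proof. by rewrite /K divr_gt0// mulr_gt0. Qed.

Lemma dist_axis s : e (xi + P s *: l - xi) = e (P s *: l).
Proof. by rewrite [xi + _]addrC addrK. Qed.

(* [|Q|^2 - K^2 P^4] cannot increase where it is positive, and vanishes at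
   [-oo]. *)
Lemma orbit_tangent s1 : (forall s, s <= s1 -> e (v s - xi) < r0) ->
  forall s, s <= s1 -> e (Q s) <= K * P s ^+ 2.
Proof.
move=> vs1 s ss1.
have K0 := K_gt0.
have KP0 u : 0 <= K * P u ^+ 2 by rewrite mulr_ge0 ?sqr_ge0 ?ltW.
pose g u := dotv (Q u) (Q u) - K ^+ 2 * P u ^+ 4.
have gE u : g u = e (Q u) ^+ 2 - (K * P u ^+ 2) ^+ 2.
  by rewrite /g euclid_norm_sqr; ring.
suff gs : g s <= 0.
  rewrite -(@ler_sqr R) ?nnegrE ?euclid_norm_ge0//.
  by rewrite -subr_le0 -gE.
rewrite leNgt; apply/negP => gs.
have gd (u : R) : is_derive u 1 g (- 2 * dotv (G (v u)) (Q u)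
     - 4 * K ^+ 2 * (P u ^+ 3 * - dotv (G (v u)) l)).
  have D1 := orbit_QQ_der u; have D2 := orbit_P_der u.
  have -> : g = (fun u => dotv (Q u) (Q u)) - K ^+ 2 \*: (P ^+ 4) by [].
  apply: is_derive_eq; congr (_ - _).
  by rewrite /GRing.scale /=; ring.
have gle u : u <= s -> 0 < g u -> - 2 * dotv (G (v u)) (Q u)
     - 4 * K ^+ 2 * (P u ^+ 3 * - dotv (G (v u)) l) <= 0.
  move=> us gu; have [p1 q1 pq] := PQ_small (vs1 u (le_trans us ss1)).
  have Ql : dotv (Q u) l = 0 by exact: proj_orthogonal.
  have prho : `|P u| < rho by move: p1 r0rho r00; set a := `|_|; lra.
  apply: (@cone_algebra _ C lam K r0 (e (Q u))) => //.
  - by rewrite /K mulrC divfK// gt_eqF.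
  - exact: euclid_norm_ge0.
  - by move: gu; rewrite gE subr_gt0 ltr_sqr ?nnegrE ?euclid_norm_ge0// => /ltW.
  - exact: ltW.
  - have := @G_coercive (xi + P u *: l) (Q u) (2 * r0).
    rewrite dist_axis -v_decomp euclid_norm_sqr => /(_ pq r0rho _ Ql).
    have Cr : C * (2 * r0) <= lam / 2 by move: r0C lam0; nra.
    move=> /(_ Cr); rewrite dotvBl.
    have := G_axis (Q u) prho; rewrite ler_norml => /andP[+ _].
    set a := dotv _ _; set b := dotv _ _; set d := dotv _ _; set z := C * _ * _.
    by lra.
  - rewrite normrN; have := @G_transverse (xi + P u *: l) (Q u) (2 * r0).
    rewrite dist_axis -v_decomp => /(_ pq r0rho Ql) h.
    have h' := G_axis l prho; rewrite norm_l mulr1 in h'.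
    have -> : dotv (G (v u)) l = dotv (G (xi + P u *: l)) l
        + dotv (G (v u) - G (xi + P u *: l)) l by rewrite dotvBl addrC subrK.
    by rewrite (le_trans (ler_normD _ _))// lerD.
have gs2 : 0 < g s / 2 by rewrite divr_gt0.
(* [g] tends to [0] at [-oo] but need not be nonpositive at any finite time, so the barrier is run
   at the level [g s / 2], below which a finite starting time exists. *)
have lim0 : exists2 u : R, u <= s & g u <= g s / 2.
  pose d := Num.min 1 (g s / 2); have d0 : 0 < d by rewrite lt_min ltr01.
  have /cvg_euclidP/(_ _ d0) [M [Mr hM]] := v_minus.
  pose u := Num.min (M - 1) s; have uM : u < M.
    by rewrite /u; apply: (@le_lt_trans _ _ (M - 1)); rewrite ?ge_min ?lexx// ltrBlDl ltrDr.
  exists u; first by rewrite ge_min lexx orbT.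
  have [_ h2] := proj_norm_le (v u - xi) ll.
  have := le_lt_trans h2 (hM u uM); rewrite -/(P u) -/(Q u) lt_min => /andP[q1 q2].
  have q0 := euclid_norm_ge0 (Q u).
  rewrite gE; apply: (@le_trans _ _ (e (Q u) ^+ 2)); first by rewrite gerBl sqr_ge0.
  apply: le_trans (ltW q2); by rewrite expr2 ler_piMl// ltW.
have [u us gu] := lim0.
suff : g s - g s / 2 <= 0 by move: gs; lra.
apply: (@barrier1 _ (fun t => g t - g s / 2) u s us).
- apply: derivable_within_continuous => t _.
  by have D := gd t; apply: ex_derive.
- by rewrite subr_le0.
- move=> t /andP[ut ts] gt; exists (- 2 * dotv (G (v t)) (Q t)
     - 4 * K ^+ 2 * (P t ^+ 3 * - dotv (G (v t)) l)); last first.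
    by apply: gle; [exact: ltW|move: gt gs2; lra].
  by rewrite -[X in is_derive _ _ _ X]subr0; apply: is_deriveB.
Qed.

(** By tangency the transverse part is [O(P^2)], so its coupling into the kernel direction takes at
    most half of the cubic drift. The right-hand side is the derivative of [P]. *)
Lemma orbit_P_growth s1 : (forall s, s <= s1 -> e (v s - xi) < r0) ->
  forall s, s <= s1 -> cc / 2 * P s ^+ 2 <= - dotv (G (v s)) l.
Proof.
move=> vs1 s ss1; have [p1 q1 pq] := PQ_small (vs1 s ss1).
have Ql : dotv (Q s) l = 0 by exact: proj_orthogonal.
have prho : `|P s| < rho by move: p1 r0rho r00; set a := `|_|; lra.
have := @G_transverse (xi + P s *: l) (Q s) (2 * r0).
rewrite dist_axis -v_decomp dotvBl => /(_ pq r0rho Ql); rewrite ler_norml => /andP[_].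
have := Ftay prho; have := orbit_tangent vs1 ss1.
have p2 := sqr_ge0 (P s).
set a := dotv _ _; set b := dotv _ _ => h1 h2 h3.
have h4 : C * (2 * r0) * e (Q s) <= C * (2 * r0) * (K * P s ^+ 2).
  by rewrite ler_wpM2l// mulr_ge0 ?mulr_ge0 ?(ltW C0) ?(ltW r00).
have h5 : 4 * C * r0 * K * P s ^+ 2 <= cc * P s ^+ 2 by rewrite ler_wpM2r.
have : C * (2 * r0) * (K * P s ^+ 2) = 2^-1 * (4 * C * r0 * K * P s ^+ 2) by field.
lra.
Qed.

(** Gronwall's inequality for the squared distance to [xi], with zero initial value and zero offset;
    the range [rho / 2] keeps the Lipschitz bound on [G] available. *)
Lemma orbit_uniq s : v s = xi -> forall t, s <= t -> v t = xi.
Proof.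
move=> vs t st.
pose yy u := dotv (v (s + u) - xi) (v (s + u) - xi).
have D (u : R) : is_derive u 1 yy (- 2 * dotv (G (v (s + u))) (v (s + u) - xi)).
  have Dsh : is_derive u 1 (fun u => s + u) (1 : R).
    have -> : (fun u => s + u) = cst s + (id : R -> R) by [].
    by apply: is_derive_eq; rewrite add0r.
  have D1 := is_derive_comp_rV (v_der (s + u)) Dsh; rewrite scale1r in D1.
  have D2 : is_derive u 1 (fun u => v (s + u) - xi) (- G (v (s + u))).
    by rewrite -[- G _]subr0; apply: is_deriveB.
  apply: is_derive_eq; first exact: is_derive_dotv.
  by rewrite (dotvC _ (- _)) dotvNl; ring.
have L0 : 0 <= C + C * rho by rewrite addr_ge0 ?mulr_ge0 ?ltW.
have rho2 : 0 < (rho / 2) ^+ 2 by rewrite exprn_gt0// divr_gt0.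
have y0 : yy 0 = 0 by rewrite /yy addr0 vs subrr dotv0l.
have ts0 : 0 <= t - s by rewrite subr_ge0.
have : yy (t - s) <= 0.
  have := @gronwall _ yy (t - s) (2 * (C + C * rho)) 0 ((rho / 2) ^+ 2) ts0.
  rewrite y0 addr0 mul0r addr0 => H.
  suff : yy (t - s) + 0 <= 0 * expR (2 * (C + C * rho) * (t - s)).
    by rewrite mul0r addr0.
  apply: H => //; [|exact: mulr_ge0|exact: ltW| |by rewrite ts0 lexx].
    by apply: derivable_within_continuous => u _; have := D u => ?; apply: ex_derive.
  move=> u _ yu; exists (- 2 * dotv (G (v (s + u))) (v (s + u) - xi)) => //.
  rewrite addr0 /yy -euclid_norm_sqr.
  have eu : e (v (s + u) - xi) < rho / 2.
    by rewrite euclid_norm_lt// divr_ge0// ltW.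
  have := @G_lipschitz xi (v (s + u) - xi) (v (s + u) - xi) (rho / 2).
  rewrite subrr euclid_norm0 add0r => /(_ (ltW eu) _).
  rewrite ltr_pdivrMr// mulr_natr mulr2n ltrDl => /(_ rho0).
  rewrite [xi + _]addrC subrK Fxi subr0 -expr2 ler_norml => /andP[+ _].
  set A := dotv _ _; set B := _ * _ ^+ 2 => h.
  have -> : 2 * (C + C * rho) * e (v (s + u) - xi) ^+ 2 = 2 * B by rewrite /B; ring.
  lra.
rewrite /yy addrCA subrr addr0 => h.
apply/eqP; rewrite -subr_eq0 -dotv_eq0 eq_le h; exact: dotvv_ge0.
Qed.

(** [P] is nondecreasing and tends to [0] at [-oo], hence is nonnegative. If it vanished, so would
    the transverse part by tangency, and the orbit would rest at [xi], against its limit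
    [y <> xi]. *)
Lemma orbit_P_pos s1 : (forall s, s <= s1 -> e (v s - xi) < r0) ->
  forall s, s <= s1 -> 0 < P s.
Proof.
move=> vs1 s ss1.
have Pge : 0 <= P s.
  rewrite leNgt; apply/negP => Ps.
  have Ps' : 0 < - P s by rewrite oppr_gt0.
  have /cvg_euclidP/(_ _ Ps') [M [Mr hM]] := v_minus.
  pose u := Num.min (M - 1) s; have uM : u < M.
    by rewrite /u; apply: (@le_lt_trans _ _ (M - 1)); rewrite ?ge_min ?lexx// ltrBlDl ltrDr.
  have us : u <= s by rewrite ge_min lexx orbT.
  have [h1 _] := proj_norm_le (v u - xi) ll.
  have := le_lt_trans h1 (hM u uM); rewrite -/(P u) ltr_norml => /andP[h2 _].
  have : - P s <= - P u; last by lra.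
  apply: (@nincr_of_derive _ (fun t => - P t)) => //.
    apply: derivable_within_continuous => t _.
    by have D := orbit_P_der t; apply: derivableN; apply: ex_derive.
  move=> t /andP[ut ts]; exists (- - dotv (G (v t)) l).
    by have D := orbit_P_der t; apply: is_deriveN.
  rewrite oppr_le0 (le_trans _ (orbit_P_growth vs1 (le_trans (ltW ts) ss1)))//.
  by rewrite mulr_ge0 ?sqr_ge0// divr_ge0// ltW.
rewrite lt_def Pge andbT; apply/eqP => P0.
have vsxi : v s = xi.
  apply/eqP; rewrite -subr_eq0 -dotv_eq0 eq_le dotvv_ge0 andbT.
  have := orbit_tangent vs1 ss1; rewrite P0 expr0n mulr0 /Q P0 scale0r subr0.
  by rewrite euclid_norm_le// expr0n.
have d0 : 0 < e (y - xi).
  rewrite lt_def euclid_norm_ge0 andbT; apply/eqP => /euclid_norm_eq0/eqP.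
  by rewrite subr_eq0 => /eqP.
have /cvg_euclidP/(_ _ d0) [M [Mr hM]] := v_plus.
pose t := Num.max (M + 1) s.
have tM : M < t by rewrite /t lt_max ltrDl ltr01.
have := hM t tM; rewrite (orbit_uniq vsxi) ?le_max ?lexx ?orbT//.
by rewrite euclid_distC ltxx.
Qed.

(** The speed has the same order [P^2] as the lower bound on the derivative of [P]. Their quotient,
    the slope of the orbit as a graph over [P], thus stays bounded down to the fold point. *)
Lemma orbit_speed s1 : (forall s, s <= s1 -> e (v s - xi) < r0) ->
  forall s, s <= s1 -> e (G (v s)) <= (C + (C + C * rho) * K) * P s ^+ 2.
Proof.
move=> vs1 s ss1; have [p1 q1 pq] := PQ_small (vs1 s ss1).
have prho : `|P s| < rho by move: p1 r0rho r00; set a := `|_|; lra.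
have [->|g0] := eqVneq (e (G (v s))) 0.
  have K0 := K_gt0; rewrite mulr_ge0 ?sqr_ge0// addr_ge0 ?(ltW C0)//.
  by rewrite mulr_ge0 ?(ltW K0)// addr_ge0 ?mulr_ge0// ltW.
have {}g0 : 0 < e (G (v s)) by rewrite lt_def g0 euclid_norm_ge0.
rewrite -(ler_pM2r g0) -expr2 euclid_norm_sqr.
have := @G_lipschitz (xi + P s *: l) (Q s) (G (v s)) (2 * r0).
rewrite dist_axis -v_decomp dotvBl => /(_ pq r0rho); rewrite ler_norml => /andP[_].
have := G_axis (G (v s)) prho; rewrite ler_norml => /andP[_].
have := orbit_tangent vs1 ss1.
set q := e (Q s); set g := e _; set A := dotv _ _; set B := dotv _ _ => h1 h2 h3.
have h4 : (C + C * rho) * (q * g) <= (C + C * rho) * (K * P s ^+ 2 * g).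
  by rewrite ler_wpM2l ?ler_wpM2r// ?(ltW g0)// addr_ge0 ?mulr_ge0// ltW.
have -> : (C + (C + C * rho) * K) * P s ^+ 2 * g
   = C * P s ^+ 2 * g + (C + C * rho) * (K * P s ^+ 2 * g) by ring.
lra.
Qed.

(** [P] is strictly increasing near [-oo], so the orbit can be reparametrised by it. In the
    constant, [1] is the slope of the kernel line, [K] the tangency constant and the quotient the
    slope bound from [orbit_speed] and [orbit_P_growth]. *)
Lemma slow_curve_exists : exists p1 c c1,
  slow_curve v r0 (1 + K + (C + (C + C * rho) * K) / (cc / 2)) p1 c c1.
Proof.
have [s1 vs1] := orbit_near_xi; have K0 := K_gt0.
set K2 := 1 + K + _.
have KK : 0 < (C + (C + C * rho) * K) / (cc / 2).
  by rewrite divr_gt0 ?divr_gt0// addr_gt0// mulr_gt0// addr_gt0// mulr_gt0.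
have Ppos s := @orbit_P_pos s1 vs1 s.
have Pgr s : s <= s1 -> 0 < - dotv (G (v s)) l.
  move=> ss1; apply: lt_le_trans (orbit_P_growth vs1 ss1).
  by rewrite mulr_gt0 ?divr_gt0// exprn_gt0// Ppos.
have Pcont a b : {within `[a, b], continuous P}.
  apply: derivable_within_continuous => t _.
  by have D := orbit_P_der t; apply: ex_derive.
have Pincr s t : s < t -> t <= s1 -> P s < P t.
  move=> st ts1; have [|c hc] := @MVT _ P (fun u => - dotv (G (v u)) l) s t st _ (Pcont s t).
    by move=> u _; exact: orbit_P_der.
  rewrite -subr_gt0 => ->; rewrite mulr_gt0 ?subr_gt0//; apply: Pgr.
  by move: hc; rewrite in_itv => /andP[_ /ltW/le_trans]; apply.
have Pinj s t : s <= s1 -> t <= s1 -> P s = P t -> s = t.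
  move=> ss1 ts1 PE; have [st|ts|//] := ltgtP s t.
    by have := Pincr _ _ st ts1; rewrite PE ltxx.
  by have := Pincr _ _ ts ss1; rewrite PE ltxx.
(* The inverse of [P] on [(-oo, s1]]: [xget] picks the preimage of [p], unique by [Pinj]; [s1] is
   the default outside the range. *)
pose sg p := xget s1 [set s | s <= s1 /\ P s = p].
have sgP p : 0 < p < P s1 -> sg p < s1 /\ P (sg p) = p.
  move=> /andP[p0 pp1].
  have /cvg_euclidP/(_ _ p0) [M [Mr hM]] := v_minus.
  pose u := Num.min (M - 1) s1; have uM : u < M.
    by rewrite /u; apply: (@le_lt_trans _ _ (M - 1)); rewrite ?ge_min ?lexx// ltrBlDl ltrDr.
  have us : u <= s1 by rewrite ge_min lexx orbT.
  have [h1 _] := proj_norm_le (v u - xi) ll.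
  have := le_lt_trans h1 (hM u uM); rewrite -/(P u) ltr_norml => /andP[_ h2].
  have [|s su Ps] := @IVT _ P u s1 p us (Pcont u s1).
    by rewrite ge_min le_max (ltW h2) (ltW pp1) orbT.
  have ss1 : s <= s1 by move: su; rewrite in_itv => /andP[].
  have [h3 h4] := @xgetPex _ s1 [set s | s <= s1 /\ P s = p] (ex_intro _ s (conj ss1 Ps)).
  split => //; rewrite lt_neqAle h3 andbT; apply/eqP => E.
  by move: pp1; rewrite -h4 -/(sg p) E ltxx.
have sgK s : s < s1 -> sg (P s) = s.
  move=> ss1; have [|h1 h2] := sgP (P s); first by rewrite Ppos ?ltW// Pincr.
  by apply: Pinj => //; exact: ltW.
have sgD (p : R) : 0 < p < P s1 -> is_derive p 1 sg (- dotv (G (v (sg p))) l)^-1.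
  move=> pp; have [h1 h2] := sgP p pp; rewrite -{1}h2.
  apply: (@is_derive_inverse _ P).
  - by near=> s; apply: sgK; near: s; exact: lt_nbhsl.
  - near=> s; have D := orbit_P_der s.
    by apply: differentiable_continuous; apply/derivable1_diffP; apply: ex_derive.
  - exact: orbit_P_der.
  - by rewrite gt_eqF// Pgr// ltW.
pose c p := if p <= 0 then xi + p *: l else v (sg p).
pose c1 p := if p <= 0 then l else (- dotv (G (v (sg p))) l)^-1 *: - G (v (sg p)).
have p1P : 0 < P s1 by exact: Ppos.
have ctan p : p < P s1 -> e (c p - (xi + p *: l)) <= K * p ^+ 2.
  move=> pp1; rewrite /c; case: ifPn => [_|]; rewrite -?ltNge.
    by rewrite subrr euclid_norm0 mulr_ge0 ?sqr_ge0// ltW.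
  move=> p0; have [|h1 h2] := sgP p; first by rewrite p0.
  have -> : v (sg p) - (xi + p *: l) = Q (sg p) by rewrite /Q h2 opprD addrA.
  by rewrite -{2}h2; apply: (orbit_tangent vs1); exact: ltW.
exists (P s1), c, c1; split.
- by rewrite p1P /=; have [/ltW h _ _] := PQ_small (vs1 s1 (lexx _));
    apply: le_trans h; rewrite ger0_norm// ltW.
- move=> p pp1; rewrite /c1; have [p0|p0|->] := ltgtP p 0.
  + have Dl : is_derive p 1 (fun p => xi + p *: l) l.
      apply: is_derive_rV => i.
      have -> : (fun p => (xi + p *: l) ord0 i) = cst (xi ord0 i) + (l ord0 i \*: (id : R -> R)).
        by apply/funext => u; rewrite !mxE mulrC.
      by apply: is_derive_eq; rewrite add0r /GRing.scale /= mulr1.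
    apply: near_eq_is_derive Dl; near=> u; rewrite /c ifT//.
    by apply: ltW; near: u; exact: lt_nbhsl.
  + have [|h1 h2] := sgP p; first by rewrite p0.
    have Ds : is_derive p 1 sg (- dotv (G (v (sg p))) l)^-1 by apply: sgD; rewrite p0.
    have := is_derive_comp_rV (v_der (sg p)) Ds; apply: near_eq_is_derive.
    near=> u; rewrite /c ifF//; apply/negbTE; rewrite -ltNge.
    by near: u; exact: lt_nbhsr.
  (* At the junction the derivative comes from tangency alone: the difference quotient is within
     [K * |h|] of [l] on either side. *)
  + have H : h^-1 *: ((c \o shift 0) (h *: (1 : R)) - c 0) @[h --> 0^'] --> l.
      apply/cvg_euclidP => eps eps0.
      have K1 : 0 < eps / (K + 1) by rewrite divr_gt0// addr_gt0.
      near=> h; have h0 : h != 0 by near: h; exact: nbhs_dnbhs_neq.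
      rewrite /= [h *: 1]mulr1 addr0 {2}/c lexx scale0r addr0.
      have -> : h^-1 *: (c h - xi) - l = h^-1 *: (c h - (xi + h *: l)).
        by rewrite opprD addrA [RHS]scalerBr scalerA mulVf// scale1r.
      rewrite euclid_normZ normfV ltr_pdivrMl ?normr_gt0//.
      have hK : `|h| < eps / (K + 1) by near: h; apply: dnbhs0_lt.
      have hp1 : h < P s1.
        by apply: le_lt_trans (ler_norm h) _; near: h; apply: dnbhs0_lt.
      apply: (le_lt_trans (ctan h hp1)).
      rewrite -real_normK ?num_real// expr2 mulrCA ltr_pM2l ?normr_gt0//.
      apply: (@lt_trans _ _ ((K + 1) * `|h|)).
        by rewrite ltr_pM2r ?normr_gt0// ltrDl.
      by rewrite mulrC -ltr_pdivlMr// addr_gt0.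
    by rewrite ?lexx; apply: DeriveDef; [apply/cvg_ex; exists l|exact: cvg_lim H].
- move=> p pp1; rewrite /c1; case: ifPn => [_|]; rewrite -?ltNge.
    by rewrite norm_l /K2 -addrA lerDl addr_ge0// ltW.
  move=> p0; have [|h1 h2] := sgP p; first by rewrite p0.
  have g0 := Pgr _ (ltW h1).
  rewrite euclid_normZ euclid_normN ger0_norm ?invr_ge0 ?(ltW g0)//.
  rewrite mulrC ler_pdivrMr//.
  apply: (le_trans (orbit_speed vs1 (ltW h1))).
  apply: (@le_trans _ _ ((C + (C + C * rho) * K) / (cc / 2) * (cc / 2 * P (sg p) ^+ 2))).
    by rewrite mulrA divfK// gt_eqF// divr_gt0.
  apply: ler_pM; [exact: ltW| |by rewrite /K2 lerDr addr_ge0// ltW|].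
    by rewrite mulr_ge0 ?sqr_ge0// divr_ge0// ltW.
  exact: (orbit_P_growth vs1 (ltW h1)).
- move=> p pp1; rewrite /c; case: ifPn => [_|]; rewrite -?ltNge.
    by rewrite [xi + _]addrC addrK dotvZl ll mulr1.
  by move=> p0; have [|h1 h2] := sgP p; first by rewrite p0.
- move=> p pp1; apply: (le_trans (ctan p pp1)); rewrite ler_wpM2r ?sqr_ge0//.
  by rewrite /K2 addrAC lerDr addr_ge0// ltW.
- by move=> p p0; rewrite /c /c1 p0.
- move=> p /andP[p0 pp1]; rewrite /c /c1 leNgt p0 /=.
  have [|h1 h2] := sgP p; first by rewrite p0.
  have g0 := Pgr _ (ltW h1).
  rewrite scalerA scalerN -scaleNr -mulrN -invrN opprK mulfV ?scale1r//.
  by rewrite -oppr_eq0 gt_eqF.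
- by move=> p /andP[p0 pp1]; exists (sg p); rewrite /c leNgt p0.
Unshelve. all: by end_near. Qed.

End Orbit.
Hypothesis Ftime : forall t x, `|t - tau| < rho -> e (x - xi) < rho ->
  forall w, `|dotv (F t x - G x) w| <= C * `|t - tau| * e w.
Hypothesis Fsign : forall t x, tau <= t -> t - tau < rho -> e (x - xi) < rho ->
  dotv (F t x - G x) l <= - beta * (t - tau).

(** * Trapping near the slow curve and exit *)

Section Passage.
Variables (v : R -> 'rV[R]_n) (r0 K p1 : R) (c c1 : R -> 'rV[R]_n).
Hypothesis sc : slow_curve v r0 K p1 c c1.
Hypotheses (r00 : 0 < r0) (K0 : 0 < K) (Kr0 : K * r0 <= 1) (r0rho : 3 * r0 < rho)
  (r0C : C * (3 * r0) <= lam / 2) (r0CK : C * (3 * r0) * K <= lam / 4)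
  (r0cc : 8 * C * K * r0 <= cc).

Lemma curve_dist p : - r0 < p < p1 -> e (c p - xi) <= 2 * r0.
Proof.
move=> /andP[p0 pp1]; have /andP[_ p1r0] := sc_p1 sc.
have pr : `|p| <= r0 by rewrite ler_norml; lra.
have -> : c p - xi = (c p - (xi + p *: l)) + p *: l by rewrite opprD addrA subrK.
rewrite (le_trans (euclid_normD _ _))// euclid_normZ norm_l mulr1.
have := sc_tan sc pp1; rewrite -[p ^+ 2]real_normK ?num_real//.
move: pr; set a := `|p| => ar h; have a0 : 0 <= a by exact: normr_ge0.
have : K * a ^+ 2 <= r0.
  have -> : K * a ^+ 2 = (K * a) * a by ring.
  apply: (@le_trans _ _ (1 * a)); last by rewrite mul1r.
  by rewrite ler_wpM2r// (le_trans _ Kr0)// ler_wpM2l// ltW.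
lra.
Qed.

Let pr x := dotv (x - xi) l.
Let dev x := x - c (pr x).

(** The curve is parametrised by its own kernel coordinate, so the deviation has no component along
    [l] and meets only the directions in which [J xi] is coercive. *)
Lemma dev_orth x : pr x < p1 -> dotv (dev x) l = 0.
Proof.
move=> h; have := sc_proj sc h; rewrite /dev => E.
by rewrite -[x in x - _](subrK xi) -addrA dotvDl -/(pr x) -opprB dotvNl E subrr.
Qed.

Lemma dev_radius x : - r0 < pr x < p1 -> e (dev x) <= r0 ->
  e (c (pr x) - xi) + e (dev x) <= 3 * r0 /\ e (x - xi) < rho.
Proof.
move=> /curve_dist h1 h2; have h3 : e (c (pr x) - xi) + e (dev x) <= 3 * r0.
  by move: h1 h2; set a := e _; set b := e _; lra.
split => //; apply: le_lt_trans r0rho; apply: le_trans h3.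
have -> : x - xi = (c (pr x) - xi) + dev x by rewrite /dev [RHS]addrC addrA subrK.
exact: euclid_normD.
Qed.

(** The left-hand side is [eps] times the product of the deviation with its time derivative. The
    part coming from the curve itself vanishes for [p > 0] by invariance; for [p <= 0] the slope is
    [l], orthogonal to the deviation, and the residual of the kernel line is at most
    [4 * C * r ^+ 2]. *)
Lemma fold_dev t x h r : `|t - tau| <= h -> h < rho -> 2 * r <= r0 ->
  - (2 * r) < pr x < p1 -> e (dev x) <= r0 ->
  - dotv (F t x) (dev x) + dotv (F t x) l * dotv (c1 (pr x)) (dev x) <=
  - (lam / 4) * e (dev x) ^+ 2 + (4 * C * r ^+ 2 + C * (1 + K) * h) * e (dev x).
Proof.
move=> th hr rr0 /andP[px1 px2] dx; have R0 := r00; have R1 := r0rho.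
have px : - r0 < pr x < p1 by rewrite px2 andbT; lra.
have [rad xr] := dev_radius px dx.
have dl := dev_orth px2.
have xE : x = c (pr x) + dev x by rewrite /dev addrC subrK.
have trho := le_lt_trans th hr.
have C0' := ltW C0; have d0 := euclid_norm_ge0 (dev x).
have h0 : 0 <= h by apply: le_trans th.
have := @G_coercive _ _ (3 * r0) rad r0rho r0C dl; rewrite -xE => hB.
have := @G_transverse _ _ (3 * r0) rad r0rho dl; rewrite -xE => hB'.
have hA := Ftime trho xr (dev x); have hA' := Ftime trho xr l.
rewrite norm_l mulr1 in hA'.
have hA2 : C * `|t - tau| * e (dev x) <= C * h * e (dev x).
  by rewrite ler_wpM2r// ler_wpM2l.
have hA2' : C * `|t - tau| <= C * h by rewrite ler_wpM2l.
have hN : `|dotv (c1 (pr x)) (dev x)| <= K * e (dev x).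
  by rewrite (le_trans (ler_dotv _ _))// ler_wpM2r// (sc_norm sc).
have hE : - dotv (G (c (pr x))) (dev x) + dotv (G (c (pr x))) l * dotv (c1 (pr x)) (dev x)
    <= 4 * C * r ^+ 2 * e (dev x).
  have [p0|p0] := leP (pr x) 0.
    have [cE ->] := sc_neg sc p0; rewrite cE (dotvC l) dl mulr0 addr0.
    have pr2 : `|pr x| < rho by rewrite ler0_norm//; lra.
    have := G_axis (dev x) pr2; rewrite ler_norml => /andP[+ _].
    have : C * pr x ^+ 2 * e (dev x) <= 4 * C * r ^+ 2 * e (dev x).
      rewrite ler_wpM2r//.
      have -> : 4 * C * r ^+ 2 = C * (2 * r) ^+ 2 by ring.
      by rewrite ler_wpM2l// -sqrrN ler_sqr ?nnegrE; lra.
    by rewrite lerNl => ? /le_trans; apply.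
  rewrite {1}(sc_inv sc); last by rewrite p0.
  rewrite dotvZl addNr; apply: mulr_ge0 => //.
  by apply: mulr_ge0 (sqr_ge0 _); apply: mulr_ge0.
have := @deviation_algebra _ C lam K r0 h r (e (dev x)) (dotv (F t x - G x) (dev x))
  (dotv (F t x - G x) l) (dotv (G x - G (c (pr x))) (dev x))
  (dotv (G x - G (c (pr x))) l) (dotv (c1 (pr x)) (dev x)) _
  C0' h0 d0 (ltW K0) (ltW r00) (le_trans hA hA2) (le_trans hA' hA2') _ hB' hN hE r0CK.
rewrite euclid_norm_sqr => /(_ hB); apply: le_trans.
rewrite !dotvBl le_eqVlt; apply/orP; left; apply/eqP; ring.
Qed.

(** In the strip just below [p = - r] the cubic drift is at least [cc * r ^+ 2]; half of it pays for
    the coupling to the deviation and half for the time perturbation, of unknown sign here. The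
    strip and the bound [2 * eta] are the margins of the barrier argument. *)
Lemma fold_p_low t x h r eta : `|t - tau| <= h -> h < rho -> 2 * r <= r0 ->
  - (2 * r) < pr x <= - r -> 0 <= r -> e (dev x) <= 2 * eta -> 0 <= eta -> eta <= r ->
  16 * C * eta <= cc * r -> C * h <= cc / 2 * r ^+ 2 ->
  dotv (F t x) l <= 0.
Proof.
move=> th hr rr0 /andP[px1 px2] rge0 dx eta0 etar Ce Ch; have R0 := r00; have R1 := r0rho.
have p0 : pr x <= 0 by lra.
have /andP[p10 p1r0] := sc_p1 sc.
have pp1 : pr x < p1 by lra.
have dl := dev_orth pp1.
have px : - r0 < pr x < p1 by rewrite pp1 andbT; lra.
have dr0 : e (dev x) <= r0 by apply: (le_trans dx); lra.
have [_ xr] := dev_radius px dr0.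
have [cE _] := sc_neg sc p0.
have xE : x = xi + pr x *: l + dev x by rewrite /dev cE addrC subrK.
have axis : e (xi + pr x *: l - xi) = - pr x.
  by rewrite [xi + _]addrC addrK euclid_normZ norm_l mulr1 ler0_norm.
have rad : e (xi + pr x *: l - xi) + e (dev x) <= 4 * r by rewrite axis; lra.
have r4 : 4 * r < rho by lra.
have := G_transverse rad r4 dl; rewrite -xE ler_norml => /andP[_ h1].
have trho := le_lt_trans th hr.
have := Ftime trho xr l; rewrite norm_l mulr1 ler_norml => /andP[_ h2].
have pr2 : `|pr x| < rho by rewrite ler0_norm//; lra.
have h3 := Ftay pr2.
have h4 : cc * r ^+ 2 <= cc * pr x ^+ 2.
  by rewrite ler_wpM2l ?(ltW cc0)// -[pr x ^+ 2]sqrrN ler_sqr ?nnegrE//; lra.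
have h5 : C * (4 * r) * e (dev x) <= C * (4 * r) * (2 * eta).
  by rewrite ler_wpM2l// !mulr_ge0// ltW.
have h6 : 16 * C * eta * r <= cc * r * r by rewrite ler_wpM2r.
have h7 : C * `|t - tau| <= C * h by rewrite ler_wpM2l// ltW.
move: h1 h2; rewrite !dotvBl; move: (dotv (F t x) l) (dotv (G x) l) => a b h1 h2.
move: (dotv _ l) h3 h1 => g h3 h1.
have h8 : C * (4 * r) * (2 * eta) <= cc / 2 * r ^+ 2.
  have -> : C * (4 * r) * (2 * eta) = 2^-1 * (16 * C * eta * r) by field.
  have -> : cc / 2 * r ^+ 2 = 2^-1 * (cc * r * r) by field.
  by rewrite ler_wpM2l.
lra.
Qed.

Lemma fold_p_up t x h eta : tau + h / 2 <= t <= tau + h -> 0 < h -> h < rho ->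
  - r0 < pr x < p1 -> e (dev x) <= eta -> 0 <= eta -> eta <= r0 ->
  (C ^+ 2 / cc + 2 * C) * eta ^+ 2 <= beta * h / 4 ->
  dotv (F t x) l <= - (beta * h / 4).
Proof.
move=> /andP[t1 t2] h0 hr px dx eta0 etar Ce; have R0 := r00; have R1 := r0rho.
have dr0 : e (dev x) <= r0 by exact: le_trans etar.
have [_ xr] := dev_radius px dr0.
have /andP[p10 p1r0] := sc_p1 sc; case/andP: (px) => px1 px2.
pose q := x - xi - pr x *: l.
have ql : dotv q l = 0 by exact: proj_orthogonal.
have xE : x = xi + pr x *: l + q by rewrite /q [x - xi - _]addrC addrA addrK addrC subrK.
have qE : q = dev x + (c (pr x) - (xi + pr x *: l)) by rewrite /dev addrA subrK /q opprD addrA.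
have pr1 : `|pr x| <= r0 by rewrite ler_norml; lra.
have qle : e q <= eta + K * `|pr x| ^+ 2.
  rewrite qE (le_trans (euclid_normD _ _))// lerD// real_normK ?num_real//.
  exact: (sc_tan sc).
have Kp : K * `|pr x| ^+ 2 <= r0.
  have -> : K * `|pr x| ^+ 2 = (K * `|pr x|) * `|pr x| by ring.
  apply: (@le_trans _ _ (1 * r0)); last by rewrite mul1r.
  by rewrite ler_pM ?mulr_ge0 ?(ltW K0)// (le_trans _ Kr0)// ler_wpM2l// ltW.
have axis : e (xi + pr x *: l - xi) = `|pr x|.
  by rewrite [xi + _]addrC addrK euclid_normZ norm_l mulr1.
have rad : `|pr x| + e q < rho.
  apply: le_lt_trans r0rho; move: pr1 qle Kp etar.
  by set a := `|_|; set b := e _; set d := K * _; lra.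
have := fun h => @G_transverse (xi + pr x *: l) q (`|pr x| + e q) h rad ql.
rewrite axis -xE => /(_ (lexx _)); rewrite ler_norml => /andP[_ h1].
have h2 := @Fsign t x; have {}h2 : dotv (F t x - G x) l <= - beta * (t - tau).
  by apply: h2 => //; lra.
have r0r : r0 < rho by lra.
have h3 := Ftay (le_lt_trans pr1 r0r).
have := exit_algebra C0 cc0 (ltW K0) (normr_ge0 (pr x)) pr1 (euclid_norm_ge0 q) eta0 qle Kr0 r0cc.
rewrite real_normK ?num_real// => h4.
have h5 : beta * (h / 2) <= beta * (t - tau) by rewrite ler_wpM2l ?(ltW beta0)//; lra.
move: h1 h2; rewrite !dotvBl; move: (dotv (F t x) l) (dotv (G x) l) => a b h1 h2.
move: (dotv _ l) h3 h1 => g h3 h1.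
lra.
Qed.

Lemma pr_continuous x : {for x, continuous pr}.
Proof.
apply: (@dotv_continuous _ _ (fun y => y - xi) (fun=> l)) => i; last exact: cst_continuous.
rewrite (_ : (fun y => (y - xi) ord0 i) = fun y => y ord0 i - xi ord0 i).
  by apply: (@cvgB _ _ _ (nbhs x)); [exact: coord_continuous|exact: cvg_cst].
by apply/funext => y; rewrite !mxE.
Qed.

Lemma dev_continuous x : pr x < p1 -> {for x, continuous (fun y => dotv (dev y) (dev y))}.
Proof.
move=> xp; suff H i : {for x, continuous (fun y => dev y ord0 i)}.
  exact: dotv_continuous.
rewrite (_ : (fun y => dev y ord0 i) = fun y => y ord0 i - c (pr y) ord0 i).
  apply: (@cvgB _ _ _ (nbhs x)); first exact: coord_continuous.
  apply: (@continuous_comp _ _ _ pr (fun p => c p ord0 i)); first exact: pr_continuous.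
  apply: differentiable_continuous; apply/derivable1_diffP.
  by have D := is_derive_coord ord0 i (sc_der sc xp); apply: ex_derive.
by apply/funext => y; rewrite !mxE.
Qed.

Lemma within_comp (A : set R) (u : R -> 'rV[R]_n) (g : 'rV[R]_n -> R) :
  {within A, continuous u} -> (forall t, A t -> {for u t, continuous g}) ->
  {within A, continuous (g \o u)}.
Proof.
move=> /subspace_continuousP cu cg; apply/subspace_continuousP => t At.
exact: (cvg_comp _ _ (cu t At) (cg t At)).
Qed.

Lemma pr_derive u (t : R) u' : is_derive t 1 u u' -> is_derive t 1 (pr \o u) (dotv u' l).
Proof.
move=> du; apply: is_derive_dotvl.
by rewrite -[u']subr0; apply: is_deriveB.
Qed.

Lemma dev_derive u (t : R) u' : pr (u t) < p1 -> is_derive t 1 u u' ->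
  is_derive t 1 (dev \o u) (u' - dotv u' l *: c1 (pr (u t))).
Proof.
move=> up du; have D := is_derive_comp_rV (sc_der sc up) (pr_derive du).
by have := is_deriveB du D.
Qed.

(* While [|t - tau| <= h] the region [- r <= p, |dev| <= eta] cannot be left
   except through [p = delta]; if that did not happen, the drift of [p] during
   [tau + h / 2, tau + h] would be too large. *)
Lemma fold_window r eta h delta : 0 < r -> 2 * r <= r0 -> 0 < eta -> eta <= r ->
  2 * eta <= r0 -> 0 < h -> h < rho -> 16 * C * eta <= cc * r -> C * h <= cc / 2 * r ^+ 2 ->
  (C ^+ 2 / cc + 2 * C) * eta ^+ 2 <= beta * h / 4 ->
  4 * C * r ^+ 2 + C * (1 + K) * h <= lam / 4 * eta -> 0 < delta < p1 ->
  forall eps a u, 0 < eps -> eps * (8 * (delta + r)) < beta * h ^+ 2 ->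
    tau - h <= a <= tau -> solves F eps u a (tau + h) ->
    - r <= pr (u a) < delta -> e (dev (u a)) <= eta ->
  exists2 te, a <= te <= tau + h & pr (u te) = delta /\
    forall t, a <= t <= te -> - r <= pr (u t) <= delta /\ e (dev (u t)) <= eta.
Proof.
move=> r_gt0 rr0 eta0 etar etar0 h0 hrho hCe hCh hup hdev /andP[delta0 deltap1].
move=> eps a u eps0 epsh /andP[a1 a2] [cu du] /andP[ua1 ua2] ua3.
have tle t : a <= t <= tau + h -> `|t - tau| <= h.
  by move=> /andP[t1 t2]; rewrite ler_norml; apply/andP; split; lra.
(* The end [b] is left free: it will be the first time at which [p = delta], or the end of the
   window when there is no such time. *)
have inv b : a <= b <= tau + h -> (forall t, a <= t < b -> pr (u t) < delta) ->
    pr (u b) <= delta -> forall t, a <= t <= b -> - r <= pr (u t) /\ e (dev (u t)) <= eta.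
  move=> /andP[ab bh] ult ub.
  have ule t : a <= t <= b -> pr (u t) < p1.
    move=> /andP[at_ tb]; apply: le_lt_trans deltap1; have [tb'|bt|->//] := ltgtP t b.
      by apply/ltW/ult; rewrite at_.
    by move: bt; rewrite ltNge tb.
  pose g (i : bool) t := if i then dotv (dev (u t)) (dev (u t)) - eta ^+ 2 else - r - pr (u t).
  have cub : {within `[a, b], continuous u}.
    apply: continuous_subspaceW cu => t /=; rewrite !in_itv /= => /andP[-> tb].
    exact: le_trans bh.
  (* Margins under which the deviation is below [2 * eta] and [p] above [- (2 * r)], the ranges of
     [fold_dev] and [fold_p_low]. *)
  have rb : 0 < Num.min (3 * eta ^+ 2) r by rewrite lt_min r_gt0 mulr_gt0// exprn_gt0.
  have H := @barrier _ bool g a b (Num.min (3 * eta ^+ 2) r) rb ab.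
  have Hg : forall t, a <= t <= b -> forall i, g i t <= 0.
    apply: H => [[]|[]|t tab gs].
    - apply/subspace_continuousP => t tab; rewrite /g.
      apply: cvgB; last exact: cvg_cst.
      have cdev s : s \in `[a, b] -> {for u s, continuous (fun x => dotv (dev x) (dev x))}.
        by rewrite in_itv => /ule; exact: dev_continuous.
      by have /subspace_continuousP/(_ t tab) := within_comp cub cdev.
    - apply/subspace_continuousP => t tab; rewrite /g.
      apply: cvgB; first exact: cvg_cst.
      have := @within_comp _ u pr cub (fun s _ => @pr_continuous (u s)).
      by move=> /subspace_continuousP/(_ t tab).
    - by rewrite /g subr_le0 -euclid_norm_le// ltW.
    - by rewrite /g /=; move: ua1; lra.
    have /andP[at_ tb] := tab.
    have tab' : a <= t <= b by rewrite !ltW.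
    have pd : pr (u t) < delta by apply: ult; rewrite (ltW at_).
    have pp := ule t tab'.
    have th : `|t - tau| <= h by apply: tle; rewrite (ltW at_) (le_trans (ltW tb)).
    have [|u' Du Eu] := du t; first by rewrite at_ (lt_le_trans tb).
    have dlt : e (dev (u t)) < 2 * eta.
      rewrite euclid_norm_lt; last by rewrite mulr_ge0// ltW.
      have := gs true; rewrite /g lt_min => /andP[+ _].
      have -> : (2 * eta) ^+ 2 = 4 * eta ^+ 2 by ring.
      lra.
    have plt : - (2 * r) < pr (u t).
      by have := gs false; rewrite /g lt_min => /andP[_]; lra.
    have eu w : eps * dotv u' w = - dotv (F t (u t)) w by rewrite -dotvZl Eu dotvNl.
    case=> /=.
      move=> gpos; have D := dev_derive pp Du.
      exists (2 * dotv (u' - dotv u' l *: c1 (pr (u t))) (dev (u t))).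
        have -> : g true = (fun s => dotv (dev (u s)) (dev (u s))) - cst (eta ^+ 2) by [].
        have D2 := is_derive_dotv D D.
        apply: is_derive_eq; rewrite subr0 (dotvC (dev _)) /=; ring.
      rewrite -(pmulr_rle0 _ eps0) mulrCA pmulr_rle0// dotvBl dotvZl mulrBr mulrA !eu mulNr opprK.
      have d1 : eta < e (dev (u t)).
        rewrite ltNge euclid_norm_le ?(ltW eta0)// -ltNge.
        by move: gpos; rewrite subr_gt0.
      have := @fold_dev t (u t) h r th hrho rr0; rewrite plt pp => /(_ isT).
      move=> /(_ (le_trans (ltW dlt) etar0)).
      set X := - dotv _ _ + _ => hX.
      apply: (le_trans hX); set d := e _ in d1 *.
      have d0 : 0 <= d by rewrite ltW// (lt_trans eta0).
      apply: (@le_trans _ _ (- (lam / 4) * d ^+ 2 + (lam / 4 * eta) * d)).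
        by rewrite lerD2l ler_wpM2r.
      have -> : - (lam / 4) * d ^+ 2 + (lam / 4 * eta) * d = - (lam / 4 * (d * (d - eta))) by ring.
      by rewrite oppr_le0 mulr_ge0 ?divr_ge0 ?(ltW lam0)// mulr_ge0// subr_ge0 ltW.
    move=> gpos; exists (- dotv u' l).
      have -> : g false = cst (- r) - (pr \o u) by [].
      have D := pr_derive Du.
      by apply: is_derive_eq; rewrite sub0r.
    rewrite -(pmulr_rle0 _ eps0) mulrN eu opprK.
    apply: (@fold_p_low t (u t) h r eta) => //.
    - by rewrite plt /=; move: gpos; lra.
    - exact: ltW.
    - exact: ltW.
    - exact: ltW.
  move=> t tab; split; first by have := Hg t tab false; rewrite /g; lra.
  by rewrite euclid_norm_le ?(ltW eta0)// -subr_le0; have := Hg t tab true.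
have ah : a <= tau + h by lra.
have cpr : {within `[a, tau + h], continuous (pr \o u)}.
  exact: (@within_comp _ u pr cu (fun s _ => @pr_continuous (u s))).
have [hit|nohit] := pselect (exists2 t, a <= t <= tau + h & delta <= pr (u t)).
  have [te teab [te1 te2]] := first_hit cpr ua2 hit.
  exists te => //; split => // t /andP[t1 t2].
  have [||h1 h2] := inv te teab te2 _ t; [by rewrite -te1 /=|by rewrite t1|].
  split => //; rewrite h1 /=; move: t2; rewrite le_eqVlt => /predU1P[->|t2].
    by rewrite -te1.
  by apply/ltW/te2; rewrite t1.
exfalso.
have all t : a <= t <= tau + h -> pr (u t) < delta.
  by move=> tab; rewrite ltNge; apply/negP => hd; apply: nohit; exists t.
have inv' t : a <= t <= tau + h -> - r <= pr (u t) /\ e (dev (u t)) <= eta.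
  apply: inv; first by rewrite ah lexx.
    by move=> s /andP[s1 s2]; apply: all; rewrite s1 ltW.
  by apply/ltW/all; rewrite ah lexx.
have hh : tau + h / 2 < tau + h by lra.
(* A mean value of [p] over the second half of the window: [eps] times the gain is at least
   [beta * h ^+ 2 / 8], while [p] has only the room [delta + r]. This gives the smallness condition
   on [eps]. *)
have [||x [d [xI dd E]]] := @MVT_exists _ (pr \o u) (tau + h / 2) (tau + h) hh.
- apply: continuous_subspaceW cpr => t /=; rewrite !in_itv /= => /andP[t1 ->].
  by rewrite andbT; lra.
- move=> x xI; have [|u' Du Eu] := du x; first by move: xI => /andP[? ?]; apply/andP; split; lra.
  by exists (dotv u' l); exact: pr_derive.
have xab : a < x < tau + h by move: xI => /andP[? ?]; apply/andP; split; lra.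
have [u' Du Eu] := du x xab.
have xab' : a <= x <= tau + h by move: xab => /andP[? ?]; rewrite !ltW.
have dE : d = dotv u' l.
  by have D := pr_derive Du; have [_ <-] := dd; have [_ <-] := D.
have [i1 i2] := inv' x xab'.
have eu : eps * d = - dotv (F x (u x)) l by rewrite dE -dotvZl Eu dotvNl.
have := @fold_p_up x (u x) h eta.
have -> : tau + h / 2 <= x <= tau + h by move: xI => /andP[? ?]; rewrite !ltW.
have -> : - r0 < pr (u x) < p1.
  by rewrite (lt_trans (all x xab')) ?andbT//; lra.
have etar0' : eta <= r0.
  by rewrite (le_trans etar)// (le_trans _ rr0)// ler_peMl ?ler1n// ltW.
move=> /(_ isT h0 hrho isT i2 (ltW eta0) etar0' hup) hF.
have l1 : pr (u (tau + h)) < delta by apply: all; rewrite ah lexx.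
have [l2 _] : - r <= pr (u (tau + h / 2)) /\ e (dev (u (tau + h / 2))) <= eta.
  by apply: inv'; apply/andP; split; lra.
have l3 : eps * d * (h / 2) < eps * (delta + r).
  rewrite -mulrA ltr_pM2l//; have -> : d * (h / 2) = pr (u (tau + h)) - pr (u (tau + h / 2)).
    by rewrite -[RHS]E; congr (_ * _); field.
  lra.
have l4 : beta * h / 4 * (h / 2) <= eps * d * (h / 2).
  by rewrite ler_wpM2r ?divr_ge0// ?(ltW h0)//; lra.
have l5 : beta * h / 4 * (h / 2) = 8^-1 * (beta * h ^+ 2) by field.
lra.
Qed.

Lemma dev_near_fold x zeta : e (x - xi) <= zeta -> zeta <= 1 -> zeta < p1 ->
  `|pr x| <= zeta /\ e (dev x) <= zeta * (2 + K).
Proof.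
move=> xz z1 zp1; have [h1 _] := proj_norm_le (x - xi) ll.
have pz : `|pr x| <= zeta by exact: le_trans xz.
have pp1 : pr x < p1 by apply: le_lt_trans zp1; exact: le_trans (ler_norm _) pz.
split => //.
have -> : dev x = (x - xi) - (c (pr x) - (xi + pr x *: l)) - pr x *: l.
  by rewrite /dev; move: (c _) (pr x *: l) => a b; apply/rowP => i; rewrite !mxE; ring.
have z0 : 0 <= zeta by exact: le_trans (euclid_norm_ge0 _) xz.
have h2 : K * pr x ^+ 2 <= K * zeta.
  rewrite ler_wpM2l ?(ltW K0)// -real_normK ?num_real//.
  by rewrite expr2 -[leRHS]mulr1 ler_pM// (le_trans pz).
have h3 := sc_tan sc pp1.
rewrite (le_trans (euclid_normD _ _))// euclid_normN euclid_normZ norm_l mulr1.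
have h4 := euclid_normD (x - xi) (- (c (pr x) - (xi + pr x *: l))).
rewrite euclid_normN in h4.
have -> : zeta * (2 + K) = zeta + K * zeta + zeta by ring.
rewrite lerD// (le_trans h4)// lerD//; exact: le_trans h2.
Qed.

(** All smallness is put on [r]. The exit level [p1 / 2] does not depend on [eta0], so only the
    accuracy at the exit, not the exit point, changes with the tolerance. *)
Lemma fold_passage_curve eta0 : 0 < eta0 ->
  exists zeta h eps0 : R, [/\ 0 < zeta, 0 < h <= eta0, 0 < eps0 &
  forall eps a u, 0 < eps < eps0 -> tau - h <= a <= tau ->
    solves F eps u a (tau + h) -> e (u a - xi) <= zeta ->
    exists2 te, a <= te <= tau + h & e (u te - c (p1 / 2)) <= eta0 /\
      forall t, a <= t <= te -> e (u t - xi) <= eta0 \/ exists s, e (u t - v s) <= eta0].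
Proof.
move=> eta00; have R0 := r00; have CC := C0; have /andP[p10 p1r0] := sc_p1 sc.
(* [k] and [K3] turn two conditions of [fold_window] into equalities: [C * h = cc / 2 * r ^+ 2] for
   the lower side, and [4 * C * r ^+ 2 + C * (1 + K) * h = lam / 4 * eta] for the deviation. The
   remaining conditions compare different powers of [r]. *)
pose k := cc / (2 * C); have k0 : 0 < k by positivity.
pose K3 := 4 / lam * (4 * C + C * (1 + K) * k).
have K30 : 0 < K3.
  have K1 : 0 < 1 + K by rewrite addr_gt0.
  by positivity.
pose M := C ^+ 2 / cc + 2 * C.
have M0 : 0 < M by rewrite /M; positivity.
near (0 : R)^'+ => r.
have r_gt0 : 0 < r by [].
have r1 : r <= 1 by near: r; exact: nbhs_right_le.
have rr0 : r <= r0 / 2 by near: r; apply: nbhs_right_le; rewrite divr_gt0.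
have rK3 : r <= K3^-1 by near: r; apply: nbhs_right_le; rewrite invr_gt0.
have rrho : r < rho / k by near: r; apply: nbhs_right_lt; rewrite divr_gt0.
have rcc : r <= cc / (16 * C * K3).
  by near: r; apply: nbhs_right_le; positivity.
have rM : r <= beta * k / (4 * M * K3 ^+ 2).
  by near: r; apply: nbhs_right_le; positivity.
have reta : r <= eta0 / 2 by near: r; apply: nbhs_right_le; rewrite divr_gt0.
have etle : r <= eta0 by apply: (le_trans reta); exact: ltW (half_lt eta00).
have rk : r <= eta0 / k by near: r; apply: nbhs_right_le; rewrite divr_gt0.
pose eta := K3 * r ^+ 2; pose h := k * r ^+ 2; pose delta := p1 / 2.
have r2 : 0 < r ^+ 2 by rewrite exprn_gt0.
have eta_gt0 : 0 < eta by rewrite mulr_gt0.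
have h_gt0 : 0 < h by rewrite mulr_gt0.
have delta0 : 0 < delta by rewrite divr_gt0.
have deltap1 : delta < p1 by exact: half_lt.
have etar : eta <= r.
  rewrite /eta expr2 mulrA ger_pMl// mulrC -ler_pdivlMr// mul1r.
  exact: rK3.
have hkr : h <= k * r by rewrite ler_wpM2l ?(ltW k0)// expr2 ger_pMl.
have hrho : h < rho by apply: (le_lt_trans hkr); rewrite mulrC -ltr_pdivlMr.
have heta : h <= eta0 by apply: (le_trans hkr); rewrite mulrC -ler_pdivlMr.
have c16 : 16 * C * eta <= cc * r.
  have -> : 16 * C * eta = (r * (16 * C * K3)) * r by rewrite /eta; ring.
  by rewrite ler_pM2r// -ler_pdivlMr; [|positivity].
have Ch : C * h <= cc / 2 * r ^+ 2.
  by rewrite /h /k le_eqVlt; apply/orP; left; apply/eqP; field; rewrite gt_eqF.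
have Mh : M * eta ^+ 2 <= beta * h / 4.
  have -> : M * eta ^+ 2 = (r * (4 * M * K3 ^+ 2)) * r * (r ^+ 2 / 4) by rewrite /eta; field.
  have -> : beta * h / 4 = beta * k * (r ^+ 2 / 4) by rewrite /h; ring.
  rewrite ler_wpM2r ?divr_ge0 ?(ltW r2)//.
  apply: (@le_trans _ _ (r * (4 * M * K3 ^+ 2))).
    by rewrite ger_pMr//; positivity.
  by rewrite -ler_pdivlMr//; positivity.
have dd : 4 * C * r ^+ 2 + C * (1 + K) * h <= lam / 4 * eta.
  by rewrite /h /eta /K3 le_eqVlt; apply/orP; left; apply/eqP; field; rewrite gt_eqF.
have etar0 : 2 * eta <= r0 by rewrite mulrC -ler_pdivlMr// (le_trans etar).
have r2r0 : 2 * r <= r0 by rewrite mulrC -ler_pdivlMr.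
have K2 : 0 < 2 + K by rewrite addr_gt0.
(* The entry conditions: [r] and [delta / 2] place [p] between [- r] and [delta], and the last term
   keeps the deviation below [eta] through [dev_near_fold]. *)
pose zeta := Num.min 1 (Num.min r (Num.min (delta / 2) (eta / (2 + K)))).
have z0 : 0 < zeta by rewrite !lt_min ltr01 r_gt0 !divr_gt0.
have z1 : zeta <= 1 by rewrite /zeta ge_min lexx.
have zr : zeta <= r by rewrite /zeta !ge_min lexx orbT.
have zd : zeta <= delta / 2 by rewrite /zeta !ge_min lexx !orbT.
have ze : zeta <= eta / (2 + K) by rewrite /zeta !ge_min lexx !orbT.
exists zeta, h, (beta * h ^+ 2 / (8 * (delta + r))); split => //.
- by rewrite h_gt0.
- by positivity.
move=> eps a u /andP[eps_gt0 epse] atau su ua.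
have zdelta : zeta < delta by apply: (le_lt_trans zd); exact: half_lt.
have [|p_le d_le] := dev_near_fold ua z1; first exact: lt_trans deltap1.
have [||||te teI [te1 te2]] := @fold_window r eta h delta r_gt0 r2r0 eta_gt0 etar etar0
   h_gt0 hrho c16 Ch Mh dd _ eps a u eps_gt0 _ atau su.
- by rewrite delta0.
- by rewrite -ltr_pdivlMr//; positivity.
- move: p_le; rewrite ler_norml => /andP[q1 q2].
  by rewrite (le_trans _ q1) ?lerN2// (le_lt_trans q2).
- by apply: (le_trans d_le); rewrite -ler_pdivlMr.
exists te => //; split.
  have te_in : a <= te <= te by case/andP: teI => -> _; rewrite lexx.
  have [_] := te2 te te_in.
  by rewrite /dev te1 => /le_trans; apply; exact: le_trans etar etle.
move=> t tI; have [/andP[t1 t2] t3] := te2 t tI.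
(* For [p <= 0] the curve is the kernel line within [r] of [xi]; for [p > 0] it is the trace of the
   orbit. *)
have [p0|p0] := leP (pr (u t)) 0.
  left; have [cE _] := sc_neg sc p0.
  have -> : u t - xi = dev (u t) + pr (u t) *: l.
    by rewrite /dev cE; move: (pr _ *: l) => b; apply/rowP => i; rewrite !mxE; ring.
  rewrite (le_trans (euclid_normD _ _))// euclid_normZ norm_l mulr1 ler0_norm//.
  rewrite [leRHS]splitr lerD//; first exact: le_trans t3 (le_trans etar reta).
  by rewrite lerNl (le_trans _ t1)// lerN2.
right; have [|s sE] := @sc_range _ _ _ _ _ _ sc (pr (u t)).
  by rewrite p0 (le_lt_trans t2).
by exists s; rewrite -sE; apply: (le_trans t3); exact: le_trans etar etle.
Unshelve. all: by end_near. Qed.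

End Passage.

(** The radius [r0] and with it the curve depend on the fold and the orbit alone, so [s0] can be
    chosen ahead of [eta0]. The convergence of profiles relies on this order of quantifiers. *)
Theorem fold_passage (v : R -> 'rV[R]_n) (y : 'rV[R]_n) :
  (forall s : R, is_derive s 1 v (- G (v s))) ->
  v s @[s --> -oo] --> xi -> v s @[s --> +oo] --> y -> y <> xi ->
  exists s0 : R, forall eta0 : R, 0 < eta0 ->
  exists zeta h eps0 : R, [/\ 0 < zeta, 0 < h <= eta0, 0 < eps0 &
  forall eps a u, 0 < eps < eps0 -> tau - h <= a <= tau ->
    solves F eps u a (tau + h) -> e (u a - xi) <= zeta ->
    exists2 te, a <= te <= tau + h & e (u te - v s0) <= eta0 /\
      forall t, a <= t <= te -> e (u t - xi) <= eta0 \/ exists s, e (u t - v s) <= eta0].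
Proof.
move=> v_der v_m v_p yxi.
pose K := 4 * C / lam; have K0 : 0 < K by positivity.
pose K2 := 1 + K + (C + (C + C * rho) * K) / (cc / 2).
have K20 : 0 < K2.
  by rewrite /K2; positivity.
near (0 : R)^'+ => r0.
have r00 : 0 < r0 by [].
have h1 : r0 < rho / 3 by near: r0; apply: nbhs_right_lt; rewrite divr_gt0.
have h2 : r0 <= (2 * K)^-1 by near: r0; apply: nbhs_right_le; positivity.
have h3 : r0 <= lam / (32 * C) by near: r0; apply: nbhs_right_le; positivity.
have h4 : r0 <= cc / (4 * C * K) by near: r0; apply: nbhs_right_le; positivity.
have h5 : r0 <= K2^-1 by near: r0; apply: nbhs_right_le; rewrite invr_gt0.
have h6 : r0 <= lam / (12 * C * K2) by near: r0; apply: nbhs_right_le; positivity.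
have h7 : r0 <= cc / (8 * C * K2) by near: r0; apply: nbhs_right_le; positivity.
have r3 : 3 * r0 < rho by rewrite mulrC -ltr_pdivlMr.
have g1 : 2 * r0 < rho by apply: lt_trans r3; rewrite ltr_pM2r// ltr_nat.
have g2 : 2 * r0 * K <= 1.
  by rewrite mulrAC [_ * r0]mulrC -ler_pdivlMr; [rewrite div1r|positivity].
have g3 : 32 * r0 * C <= lam.
  by rewrite mulrAC [_ * r0]mulrC -ler_pdivlMr; [|positivity].
have g4 : 4 * C * r0 * K <= cc.
  by rewrite mulrAC [_ * r0]mulrC -ler_pdivlMr; [|positivity].
have [p1 [c [c1 sc]]] := @slow_curve_exists v y v_der v_m v_p yxi r0 r00 g1 g2 g3 g4.
have g5 : K2 * r0 <= 1 by rewrite mulrC -ler_pdivlMr// mul1r.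
have g6 : C * (3 * r0) <= lam / 2.
  rewrite ler_pdivlMr//; have -> : C * (3 * r0) * 2 = 6 * r0 * C by ring.
  by apply: le_trans g3; rewrite !ler_pM2r// ler_nat.
have g7 : C * (3 * r0) * K2 <= lam / 4.
  have : r0 * (12 * C * K2) <= lam by rewrite -ler_pdivlMr; [|positivity].
  have -> : r0 * (12 * C * K2) = 4 * (C * (3 * r0) * K2) by ring.
  by rewrite mulrC -ler_pdivlMr.
have g8 : 8 * C * K2 * r0 <= cc by rewrite mulrC -ler_pdivlMr; [|positivity].
have /andP[p10 _] := sc_p1 sc.
have [|s0 s0E] := @sc_range _ _ _ _ _ _ sc (p1 / 2).
  by rewrite divr_gt0//=; exact: half_lt.
exists s0 => eta0 eta00; rewrite -s0E.
exact: (@fold_passage_curve v r0 K2 p1 c c1 sc r00 K20 g5 r3 g6 g7 g8).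
Unshelve. all: by end_near. Qed.

End Fold.

(** * Following branches and orbits *)

Section Tubes.
Context {R : realType} {n : nat}.
Implicit Types (F : R -> 'rV[R]_n -> 'rV[R]_n) (u w v : R -> 'rV[R]_n).
Local Notation e := euclid_norm.

Lemma within_norm_sqr (A : set R) u w : {within A, continuous u} ->
  {within A, continuous w} ->
  {within A, continuous (fun t => dotv (u t - w t) (u t - w t))}.
Proof.
move=> /subspace_continuousP cu /subspace_continuousP cw.
apply/subspace_continuousP => t At.
apply: (@cvg_sum_real _ _ _ _ _ (fun i x => (u x - w x) ord0 i * (u x - w x) ord0 i)) => i.
have H : (u x - w x) ord0 i @[x --> within A (nbhs t)] --> (u t - w t) ord0 i.
  have cuw : u x - w x @[x --> within A (nbhs t)] --> u t - w t.
    by apply: cvgB; [exact: cu|exact: cw].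
  apply/cvgrPdist_lt => eps eps0; move/cvg_euclidP/(_ _ eps0): cuw.
  apply: filterS => x; apply: le_lt_trans; rewrite distrC.
  have -> : (u x - w x) ord0 i - (u t - w t) ord0 i = (u x - w x - (u t - w t)) ord0 i.
    by rewrite !mxE.
  exact: coord_le_euclid.
exact: cvgM.
Qed.

(** The comparison curve [w] need not be a solution: its residual is at most [m * eta], and strong
    monotonicity outweighs it as soon as the distance reaches [eta]. The margin [3 * eta ^+ 2] on
    squares means a distance below [2 * eta], hence within the range [rho] of monotonicity. *)
Lemma contraction_tube F (eps : R) u w (a b m rho eta : R) :
  0 < eps -> 0 < m -> 0 < eta -> 2 * eta <= rho -> a <= b ->
  solves F eps u a b -> {within `[a, b], continuous w} ->
  (forall t : R, a < t < b ->
    exists2 w', is_derive t 1 w w' & e (eps *: w' + F t (w t)) <= m * eta) ->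
  (forall t x, a < t < b -> e (x - w t) < rho ->
    m * e (x - w t) ^+ 2 <= dotv (F t x - F t (w t)) (x - w t)) ->
  e (u a - w a) <= eta -> forall t, a <= t <= b -> e (u t - w t) <= eta.
Proof.
move=> eps0 m0 eta0 er ab [cu du] cw dw mono ua t tab.
pose g (_ : 'I_1) t := dotv (u t - w t) (u t - w t) - eta ^+ 2.
have e3 : 0 < 3 * eta ^+ 2 by rewrite mulr_gt0// exprn_gt0.
suff : g ord0 t <= 0 by rewrite /g subr_le0 -euclid_norm_le// ltW.
move: t tab; have cg i : {within `[a, b], continuous (g i)}.
  have /subspace_continuousP cuw := within_norm_sqr cu cw.
  apply/subspace_continuousP => t tab; rewrite /g.
  by apply: cvgB; [exact: cuw|exact: cvg_cst].
move=> t tab; apply: (barrier e3 ab cg) => // [i|s sab gs i gi].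
  by rewrite /g subr_le0 -euclid_norm_le// ltW.
have [u' Du Eu] := du s sab; have [w' Dw Ew] := dw s sab.
have D := is_deriveB Du Dw.
exists (2 * dotv (u' - w') (u s - w s)).
  have -> : g i = (fun s => dotv (u s - w s) (u s - w s)) - cst (eta ^+ 2) by [].
  have D2 := is_derive_dotv D D.
  apply: is_derive_eq; rewrite subr0 (dotvC (u s - w s)) /=; ring.
set z := u s - w s.
have z2 : e z < 2 * eta.
  rewrite euclid_norm_lt; last by rewrite mulr_ge0// ltW.
  have := gs ord0; rewrite /g -/z.
  have -> : (2 * eta) ^+ 2 = 4 * eta ^+ 2 by ring.
  by clear; lra.
have z1 : eta <= e z.
  rewrite leNgt; apply/negP; rewrite euclid_norm_lt ?(ltW eta0)//.
  by move: gi; rewrite /g subr_gt0 -/z => h1 h2; have := lt_trans h1 h2; rewrite ltxx.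
have M := mono s (u s) sab (lt_le_trans z2 er); rewrite -/z in M.
rewrite -(pmulr_rle0 _ eps0) mulrCA pmulr_rle0// -dotvZl scalerBr Eu.
have -> : - F s (u s) - eps *: w' = - (F s (u s) - F s (w s)) - (eps *: w' + F s (w s)).
  by apply/rowP => j; rewrite !mxE; ring.
rewrite dotvBl dotvNl.
have : `|dotv (eps *: w' + F s (w s)) z| <= m * eta * e z.
  by rewrite (le_trans (ler_dotv _ _))// ler_wpM2r ?euclid_norm_ge0.
rewrite ler_norml => /andP[h _].
have h2 : m * eta * e z <= m * e z ^+ 2.
  by rewrite -mulrA ler_wpM2l ?(ltW m0)// expr2 ler_wpM2r ?euclid_norm_ge0.
move: h h2 M; clear; move: (dotv _ z) (dotv _ z) => x y; lra.
Qed.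

(* Gronwall, run forwards ([sg = 1]) or backwards ([sg = -1]) in time. *)
Lemma follow_orbit_half F tau v (s0 S L rho mu eps sg t0 eta : R) u :
  (forall s : R, is_derive s 1 v (- F tau (v s))) ->
  0 <= S -> 0 <= L -> 0 <= mu -> 0 < eps -> `|sg| = 1 -> 0 <= eta -> eta < rho ->
  (forall s x, 0 < s < S -> e (x - v (s0 + sg * s)) < rho ->
    `|dotv (F (t0 + eps * (sg * s)) x - F (t0 + eps * (sg * s)) (v (s0 + sg * s)))
        (x - v (s0 + sg * s))| <= L * e (x - v (s0 + sg * s)) ^+ 2) ->
  (forall s, 0 < s < S ->
    e (F (t0 + eps * (sg * s)) (v (s0 + sg * s)) - F tau (v (s0 + sg * s))) <= mu) ->
  (forall s : R, 0 <= s <= S -> {for s, continuous (fun s => u (t0 + eps * (sg * s)))}) ->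
  (forall s : R, 0 < s < S -> exists2 u', is_derive (t0 + eps * (sg * s)) 1 u u' &
     eps *: u' = - F (t0 + eps * (sg * s)) (u (t0 + eps * (sg * s)))) ->
  (e (u t0 - v s0) ^+ 2 + mu ^+ 2) * expR ((2 * L + 1) * S) <= eta ^+ 2 ->
  forall s, 0 <= s <= S -> e (u (t0 + eps * (sg * s)) - v (s0 + sg * s)) <= eta.
Proof.
move=> dv S0 L0 mu0 eps0 sg1 eta0 er HL Hmu cu du h0 s sS.
have K0 : 0 <= 2 * L + 1 by rewrite addr_ge0// mulr_ge0.
have r2 : eta ^+ 2 < rho ^+ 2 by rewrite ltr_sqr ?nnegrE// (le_trans eta0)// ltW.
pose U s := u (t0 + eps * (sg * s)); pose V s := v (s0 + sg * s).
have dV (r : R) : is_derive r 1 V (sg *: - F tau (V r)).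
  have Ds : is_derive r 1 (fun r => s0 + sg * r) sg.
    have -> : (fun r => s0 + sg * r) = cst s0 + (sg \*: (id : R -> R)) by [].
    by apply: is_derive_eq; rewrite add0r /GRing.scale /= mulr1.
  exact: (@is_derive_comp_rV _ _ v (fun r => s0 + sg * r) r _ _ (dv _) Ds).
pose y r := dotv (U r - V r) (U r - V r).
have y0 : y 0 = e (u t0 - v s0) ^+ 2.
  by rewrite /y /U /V !mulr0 !addr0 euclid_norm_sqr.
suff : y s + mu ^+ 2 <= (y 0 + mu ^+ 2) * expR ((2 * L + 1) * s).
  move=> h; rewrite euclid_norm_le// -/(U s) -/(V s).
  have : y s <= y s + mu ^+ 2 by rewrite lerDl sqr_ge0.
  move=> /le_trans; apply; apply: (le_trans h); rewrite y0; apply: le_trans h0.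
  rewrite ler_wpM2l ?addr_ge0 ?sqr_ge0// ler_expR ler_wpM2l//.
  by case/andP: sS.
apply: (@gronwall _ y S _ _ (rho ^+ 2)) => //.
- have -> : y = (fun r => dotv (U r - V r) (U r - V r)) by [].
  apply: within_norm_sqr.
    by apply: continuous_in_subspaceT => r; rewrite inE /= in_itv => /cu.
  apply: continuous_subspaceT => r; apply: differentiable_continuous.
  by apply/derivable1_diffP; have D := dV r; apply: ex_derive.
- by rewrite y0 (le_lt_trans h0)// ltr_wpDr ?sqr_ge0.
- exact: sqr_ge0.
- exact: sqr_ge0.
move=> r rS yr; have [u' Du Eu] := du r rS.
have dU : is_derive r 1 U ((eps * sg) *: u').
  have Ds : is_derive r 1 (fun r => t0 + eps * (sg * r)) (eps * sg).
    have -> : (fun r => t0 + eps * (sg * r)) = cst t0 + ((eps * sg) \*: (id : R -> R)).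
      by apply/funext => x; rewrite /= mulrA.
    by apply: is_derive_eq; rewrite add0r /GRing.scale /= mulr1.
  exact: (@is_derive_comp_rV _ _ u (fun r => t0 + eps * (sg * r)) r _ _ Du Ds).
have D := is_deriveB dU (dV r).
exists (2 * dotv ((eps * sg) *: u' - sg *: - F tau (V r)) (U r - V r)).
  have D2 := is_derive_dotv D D.
  apply: is_derive_eq; rewrite (dotvC (U r - V r)) /=; ring.
have zr : e (U r - V r) < rho.
  by rewrite euclid_norm_lt// (le_trans eta0)// ltW.
have h1 := HL r (U r) rS zr; have h2 := Hmu r rS.
rewrite -/(V r) in h1 h2; set z := U r - V r in h1 zr *.
rewrite [eps * sg]mulrC -scalerA Eu -/(U r) -scalerBr dotvZl.
move: h1 h2; set A := F _ (U r); set B := F _ (V r); set E := F tau _ => h1 h2.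
have -> : - A - - E = - (A - B) - (B - E) by apply/rowP => j; rewrite !mxE; ring.
have h3 : `|dotv (B - E) z| <= mu * e z.
  by rewrite (le_trans (ler_dotv _ _))// ler_wpM2r ?euclid_norm_ge0.
have h4 : `|sg * dotv (- (A - B) - (B - E)) z| <= L * e z ^+ 2 + mu * e z.
  rewrite normrM sg1 mul1r dotvBl dotvNl -opprD normrN.
  by rewrite (le_trans (ler_normD _ _))// lerD.
have h5 := le_trans (ler_norm _) h4.
(* This absorbs the term linear in the distance: twice [mu * e z] is at most [e z ^+ 2 + mu ^+ 2],
   whence the rate [2 * L + 1] and the offset [mu ^+ 2]. *)
have h6 := sqr_ge0 (e z - mu).
have h7 : 0 <= L * mu ^+ 2 by rewrite mulr_ge0 ?sqr_ge0.
rewrite /y -/z -euclid_norm_sqr.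
move: h5 h6 h7; clear; move: (sg * _) (e z) => x d; lra.
Qed.

End Tubes.

(** * Compactness in time *)

Section Uniform.
Context {R : realType}.

(** The parameter [m] is read in two ways later: as a constant that is at once a radius and a rate,
    and as [eps] itself. *)
Lemma compact_uniform (K : set R) (P : R -> R -> Prop) : compact K ->
  (forall s, K s -> exists2 d : R, 0 < d &
     forall m s', 0 < m < d -> K s' -> `|s' - s| < d -> P m s') ->
  exists2 d : R, 0 < d & forall m s, 0 < m < d -> K s -> P m s.
Proof.
move=> cK h.
have /compact_near_coveringP/near_covering_withinP cov := cK.
have [] := cov R (0^'+)%classic (fun m s => 0 < m -> P m s) _ _ .
  move=> s /= sK; have [d d0 hd] := h s sK.
  near=> s' m => /= s'K m0.
  have md : m < d by near: m; exact: nbhs_right_lt.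
  have sd : `|s' - s| < d by near: s'; apply/nbhs_realP; exists d.
  by apply: hd => //; rewrite m0.
move=> d /= d0 hd; exists d => // m s /andP[m0 md] sK.
by apply: (hd m) => //=; rewrite /ball_ /= sub0r normrN gtr0_norm.
Unshelve. all: by end_near. Qed.

Lemma segment_uniform (a b : R) (P : R -> R -> Prop) :
  (forall s, a <= s <= b -> exists2 d : R, 0 < d &
     forall m s', 0 < m < d -> a <= s' <= b -> `|s' - s| < d -> P m s') ->
  exists2 d : R, 0 < d & forall m s, 0 < m < d -> a <= s <= b -> P m s.
Proof.
move=> h; have inK (s : R) : `[a, b]%classic s <-> a <= s <= b by rewrite /= in_itv.
have [s /inK/h[d d0 hd]|d d0 hd] := compact_uniform (P := P) (@segment_compact R a b).
  by exists d => // m s' md /inK; exact: hd.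
by exists d => // m s md /inK; exact: hd.
Qed.

End Uniform.

Lemma form_perturb (R : realType) n (A B : 'M[R]_n) (w : 'rV[R]_n) (m : R) :
  m * dotv w w <= dotv (w *m B) w ->
  `|dotv (w *m (A - B)) w| <= m / 2 * (euclid_norm w * euclid_norm w) ->
  m / 2 * euclid_norm w ^+ 2 <= dotv (w *m A) w.
Proof.
rewrite mulmxBr dotvBl -expr2 -euclid_norm_sqr ler_norml => h1 /andP[h2 _].
lra.
Qed.

Lemma form_perturb_norm (R : realType) n (A B : 'M[R]_n) (w : 'rV[R]_n) :
  `|dotv (w *m (A - B)) w| <= 1 * (euclid_norm w * euclid_norm w) ->
  `|dotv (w *m A) w| <= (1 + n%:R ^+ 2 * `|B|) * euclid_norm w ^+ 2.
Proof.
move=> h1; have -> : dotv (w *m A) w = dotv (w *m (A - B)) w + dotv (w *m B) w.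
  by rewrite mulmxBr dotvBl subrK.
rewrite (le_trans (ler_normD _ _))// mulrDl expr2 lerD//.
apply: dotv_mulmx_bound => i j; rewrite [leRHS]/Num.Def.normr/= mx_normrE.
exact: (le_bigmax _ (fun k : 'I_n * 'I_n => `|B k.1 k.2|) (i, j)).
Qed.

Section Flow.
Context {R : realType} {n : nat}.
Variables (T : R) (f : R -> 'rV[R]_n -> R).
Hypothesis Cf : class_C T 3 f.
Local Notation F := (fun t x => grad (f t) x).
Local Notation e := euclid_norm.

(** A single [m] measures the neighbourhood and the strength of monotonicity, and the statement
    weakens as [m] shrinks; this suits [segment_uniform]. *)
Lemma monotone_near t0 y : 0 <= t0 <= T -> posdef (hess (f t0) y) ->
  exists2 m : R, 0 < m & forall t c x, 0 <= t <= T -> `|t - t0| < m ->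
    e (c - y) < m -> e (x - c) < m ->
    m * e (x - c) ^+ 2 <= dotv (F t x - F t c) (x - c).
Proof.
move=> t0T /coercive_posdef[m0 m00 hm].
have m2 : 0 < m0 / 2 by rewrite divr_gt0.
have [d d0 hd] := hess_continuous y Cf t0T m2.
exists (Num.min (m0 / 2) (d / 2)); first by rewrite lt_min m2 divr_gt0.
move=> t c x tT; rewrite !lt_min => /andP[_ t1] /andP[_ c1] /andP[_ x1].
have [th /andP[th0 th1]] := grad_MVT c (x - c) (x - c) Cf tT.
rewrite [c + (x - c)]addrC subrK => ->.
set z := c + _; set w := x - c.
have zy : e (z - y) < d.
  rewrite /z addrAC (le_lt_trans (euclid_normD _ _))//.
  rewrite euclid_normZ ger0_norm//.
  have : th * e w <= e w by rewrite ler_piMl// euclid_norm_ge0.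
  by move: c1 x1; rewrite -/w; clear; set a := e (c - y); set b := e w; set d' := th * b; lra.
have td : `|t - t0| < d by apply: (lt_trans t1); rewrite ltr_pdivrMr// ltr_pMr// ltr1n.
apply: (@le_trans _ _ (m0 / 2 * e w ^+ 2)).
  by rewrite ler_wpM2r ?sqr_ge0// ge_min lexx.
exact: (form_perturb (hm w) (hd t z tT td zy w w)).
Qed.

(** The comparison curve is the constant [y], whose residual is small by continuity of the gradient
    and free of [eps]. Being independent of any branch, the estimate works right after a jump and
    also at the final time. *)
Lemma landing t0 y (eta : R) : 0 <= t0 <= T -> grad (f t0) y = 0 ->
  posdef (hess (f t0) y) -> 0 < eta ->
  exists h zeta : R, [/\ 0 < h, 0 < zeta & forall eps u a b, 0 < eps -> a <= b ->
    0 <= a -> b <= T -> t0 - h <= a -> b <= t0 + h -> solves F eps u a b ->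
    e (u a - y) <= zeta -> forall t, a <= t <= b -> e (u t - y) <= eta].
Proof.
move=> t0T g0 Hp eta0; have [m m0 mono] := monotone_near t0T Hp.
pose zeta := Num.min eta (m / 2).
have z0 : 0 < zeta by rewrite lt_min eta0 divr_gt0.
have zm : 2 * zeta <= m by rewrite mulrC -ler_pdivlMr// ge_min lexx orbT.
have mz : 0 < m * zeta by rewrite mulr_gt0.
have [d d0 hd] := grad_continuous y Cf t0T mz.
pose h := Num.min d m / 2; have h0 : 0 < h by rewrite divr_gt0// lt_min d0.
have hdm : h < Num.min d m by rewrite half_lt// lt_min d0.
exists h, zeta; split => // eps u a b eps0 ab a0 bT ah bh su ua t tab.
have near0 s : a < s < b -> 0 <= s <= T /\ `|s - t0| < Num.min d m.
  move=> /andP[as_ sb]; split; first by apply/andP; split; lra.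
  by apply: le_lt_trans hdm; rewrite ler_norml; apply/andP; split; lra.
apply: (@le_trans _ _ zeta); last by rewrite ge_min lexx.
apply: (@contraction_tube _ _ F eps u (fun=> y) a b m m zeta eps0 m0 z0 zm ab su) => //.
- by apply: continuous_subspaceT => s; exact: cst_continuous.
- move=> s /near0[sT]; rewrite lt_min => /andP[sd _].
  exists 0; first exact: is_derive_cst.
  rewrite scaler0 add0r; apply: ltW.
  by have := hd s y sT sd; rewrite subrr euclid_norm0 g0 subr0; apply.
- move=> s x /near0[sT]; rewrite lt_min => /andP[_ sm] xy.
  by apply: mono => //; rewrite subrr euclid_norm0.
Qed.

(** The branch itself is the comparison curve. Positive definiteness may be lost at [t2], so the
    monotonicity constant is made uniform on the compact interval [[a, b]] only. *)
Lemma track (t1 t2 a b eta : R) (g : R -> 'rV[R]_n) :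
  class_C_curve 2 `[t1, t2[ g -> 0 <= t1 -> t2 <= T ->
  (forall t, t \in `[t1, t2[ -> grad (f t) (g t) = 0 /\ posdef (hess (f t) (g t))) ->
  t1 <= a -> a <= b -> b < t2 -> 0 < eta ->
  exists zeta eps0 : R, [/\ 0 < zeta, 0 < eps0 & forall eps u a1, 0 < eps < eps0 ->
    a <= a1 <= b -> solves F eps u a1 b -> e (u a1 - g a1) <= zeta ->
    forall t, a1 <= t <= b -> e (u t - g t) <= eta].
Proof.
move=> [cg [dg [cdg _]]] t10 t2T crit ta ab bt eta0.
have sub t : a <= t <= b -> t1 <= t < t2.
  by move=> /andP[? ?]; apply/andP; split; lra.
have sub' t : t \in `[a, b] -> t \in `[t1, t2[.
  by rewrite !in_itv; exact: sub.
have tT t : a <= t <= b -> 0 <= t <= T.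
  by move=> /andP[? ?]; apply/andP; split; lra.
have cgab : {within `[a, b], continuous g} by apply: continuous_subspaceW cg => t; exact: sub'.
have [|d d0 mono] := @segment_uniform R a b (fun m t => forall x, e (x - g t) < m ->
    m * e (x - g t) ^+ 2 <= dotv (F t x - F t (g t)) (x - g t)) _.
  move=> t tab; have [] := crit t; first by rewrite in_itv; exact: sub.
  move=> _ /(monotone_near (tT t tab))[m m0 hm].
  have [d d0 hd] := (within_continuous_rVP _ _).1 cgab t tab m m0.
  exists (Num.min m d) => [|m' s]; first by rewrite lt_min m0.
  rewrite !lt_min => /and3P[m'0 m'm _] sab /andP[sm sd] x xs.
  apply: (@le_trans _ _ (m * e (x - g s) ^+ 2)); first by rewrite ler_wpM2r ?sqr_ge0// ltW.
  by apply: hm => //; [exact: tT|exact: hd|exact: lt_trans m'm].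
pose m := d / 2; have m0 : 0 < m by rewrite divr_gt0.
have md : 0 < m < d by rewrite m0 half_lt.
have [B hB] : exists B, forall t, a <= t <= b -> e (derive_in `[t1, t2[ g t) <= B.
  have cd : {within `[a, b], continuous (derive_in `[t1, t2[ g)}.
    by apply: continuous_subspaceW cdg => t; exact: sub'.
  have c0 : {within `[a, b], continuous (fun=> 0 : 'rV[R]_n)}.
    by apply: continuous_subspaceT => s; exact: cst_continuous.
  have [c cab hc] := EVT_max ab (within_norm_sqr cd c0).
  exists (e (derive_in `[t1, t2[ g c)) => t tab.
  rewrite euclid_norm_le ?euclid_norm_ge0// euclid_norm_sqr.
  by have := hc t; rewrite in_itv /= => /(_ tab); rewrite !subr0.
have B0 : 0 <= B by apply: le_trans (hB a _); [exact: euclid_norm_ge0|rewrite lexx ab].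
pose zeta := Num.min eta (m / 2).
have z0 : 0 < zeta by rewrite lt_min eta0 divr_gt0.
have zm : 2 * zeta <= m by rewrite mulrC -ler_pdivlMr// ge_min lexx orbT.
(* The gradient vanishes on the branch, so the residual is [eps] times its derivative, bounded by
   [B]; this threshold keeps it below [m * zeta]. *)
exists zeta, (m * zeta / (B + 1)); split => //.
  by rewrite divr_gt0 ?mulr_gt0// ltr_wpDl.
move=> eps u a1 /andP[eps_gt0 epse] /andP[aa1 a1b] su ua t ta1b.
have in_ab s : a1 < s < b -> a <= s <= b.
  by move=> /andP[? ?]; apply/andP; split; lra.
apply: (@le_trans _ _ zeta); last by rewrite ge_min lexx.
apply: (@contraction_tube _ _ F eps u g a1 b m m zeta eps_gt0 m0 z0 zm a1b su) => //.
- apply: continuous_subspaceW cgab => s /=; rewrite !in_itv /= => /andP[a1s ->].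
  by rewrite (le_trans aa1).
- move=> s sab; have s12 := sub s (in_ab s sab).
  exists (derive_in `[t1, t2[ g s).
    apply: is_derive_within_interior; last by apply: dg; rewrite /= in_itv.
    have /andP[a1s sb] := sab.
    near=> r; rewrite /= in_itv /=; apply/andP; split.
      apply: ltW; near: r; apply: lt_nbhsr; lra.
    by near: r; apply: lt_nbhsl; lra.
  have [|-> _] := crit s; first by rewrite in_itv.
  rewrite addr0 euclid_normZ gtr0_norm//.
  apply: (@le_trans _ _ (eps * (B + 1))).
    by rewrite ler_wpM2l ?(ltW eps_gt0)// (le_trans (hB _ (in_ab s sab)))// lerDl.
  by rewrite -ler_pdivlMr ?ltr_wpDl// ltW.
- by move=> s x sab xs; apply: (mono m s md (in_ab s sab)).
Unshelve. all: by end_near. Qed.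

Lemma follow_orbit tau v (s0 S eta : R) : 0 < tau < T -> gradient_flow f tau v ->
  0 <= S -> 0 < eta ->
  exists mu eps0 : R, [/\ 0 < mu, 0 < eps0 & forall eps u t0, 0 < eps < eps0 ->
    `|t0 - tau| < mu -> e (u t0 - v s0) <= mu ->
    (forall t : R, 0 < t < T -> exists2 u', is_derive t 1 u u' & eps *: u' = - F t (u t)) ->
    forall s, `|s| <= S -> 0 < t0 + eps * s < T /\
      e (u (t0 + eps * s) - v (s0 + s)) <= eta].
Proof.
move=> /andP[tau0 tauT] flow S0 eta0.
have tauT' : 0 <= tau <= T by rewrite !ltW.
have cv (s : R) : {for s, continuous v}.
  apply: differentiable_continuous; apply/derivable1_diffP.
  by have D := flow s; apply: ex_derive.
pose m1 := Num.min tau (T - tau).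
have m10 : 0 < m1 by rewrite lt_min tau0 subr_gt0.
have inT t : `|t - tau| < m1 -> 0 < t < T.
  rewrite ltr_norml !lt_min => /andP[]; rewrite ltrNl lt_min => /andP[? ?] /andP[? ?].
  by apply/andP; split; lra.
have inT' t : `|t - tau| < m1 -> 0 <= t <= T by move=> /inT/andP[? ?]; rewrite !ltW.
clearbody m1.
have vnear s (r : R) : 0 < r -> exists2 d : R, 0 < d & forall s', `|s' - s| < d -> e (v s' - v s) < r.
  by move=> r0; have /cvg_euclidP/(_ _ r0)/nbhs_realP := cv s.
(* The inverse of the radius [m] doubles as Lipschitz constant, so shrinking [m] weakens both
   requirements. *)
have [|d d0 lip] := @segment_uniform R (s0 - S) (s0 + S) (fun m s => forall t x,
    `|t - tau| < m -> e (x - v s) < m ->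
    `|dotv (F t x - F t (v s)) (x - v s)| <= m^-1 * e (x - v s) ^+ 2) _.
  move=> s _; have [d d0 hd] := hess_continuous (v s) Cf tauT' (@ltr01 R).
  pose A := hess (f tau) (v s).
  pose Cop := n%:R ^+ 2 * `|A|.
  have Cop0 : 0 <= Cop by rewrite mulr_ge0 ?sqr_ge0.
  have d20' : 0 < d / 2 by rewrite divr_gt0.
  have [d2 d20 hd2] := vnear s (d / 2) d20'.
  have r1 : 0 < (1 + Cop)^-1 by rewrite invr_gt0 ltr_wpDr.
  exists (Num.min (Num.min m1 d2) (Num.min (d / 2) (1 + Cop)^-1)) => [|m s'].
    by rewrite !lt_min m10 d20 r1 divr_gt0.
  rewrite !lt_min => /andP[m0 /andP[/andP[mm1 _] /andP[md mC]]] _.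
  move=> /andP[/andP[_ sd2] _] t x tm xm.
  have tT := inT' t (lt_trans tm mm1).
  have [th /andP[th0 th1]] := grad_MVT (v s') (x - v s') (x - v s') Cf tT.
  rewrite [v s' + (x - v s')]addrC subrK => ->.
  set w := x - v s' in xm *; set z := v s' + _.
  have zy : e (z - v s) < d.
    rewrite /z addrAC (le_lt_trans (euclid_normD _ _))//.
    rewrite euclid_normZ ger0_norm//.
    have : th * e w <= e w by rewrite ler_piMl// euclid_norm_ge0.
    have := hd2 s' sd2; have := lt_trans xm md.
    by clear; set a := e (v s' - v s); set b := e w; set d' := th * b; lra.
  have td : `|t - tau| < d.
    by apply: (lt_trans tm); apply: (lt_trans md); exact: half_lt.
  apply: (le_trans (form_perturb_norm (hd t z tT td zy w w))).
  rewrite ler_wpM2r ?sqr_ge0// -/A -/Cop.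
  by rewrite -[leLHS]invrK lef_pV2 ?posrE// ltW.
pose rho := Num.min (d / 2) (m1 / 2).
have rho0 : 0 < rho by rewrite lt_min !divr_gt0.
have rhod : 0 < rho < d by rewrite rho0 gt_min half_lt.
have rhom : rho < m1 by rewrite gt_min (half_lt m10) orbT.
have {}lip := fun s => lip rho s rhod.
pose L := rho^-1; have L0 : 0 <= L by rewrite invr_ge0 ltW.
pose E := expR ((2 * L + 1) * S); have E0 : 0 < E by exact: expR_gt0.
pose eta' := Num.min eta (rho / 2).
have eta'0 : 0 < eta' by rewrite lt_min eta0 divr_gt0.
have eta'r : eta' < rho by rewrite gt_min (half_lt rho0) orbT.
(* [mu] bounds both the initial error and the error of the field, so twice [mu ^+ 2] times the
   Gronwall factor [E] must not exceed [eta' ^+ 2]; [mu <= 1] gives [mu ^+ 2 <= mu]. *)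
pose mu := Num.min 1 (eta' ^+ 2 / (2 * E)).
have mu0 : 0 < mu by rewrite lt_min ltr01 divr_gt0 ?exprn_gt0// mulr_gt0.
have muE : (mu ^+ 2 + mu ^+ 2) * E <= eta' ^+ 2.
  have m1' : mu ^+ 2 <= mu by rewrite expr2 ger_pMl// ge_min lexx.
  have : mu <= eta' ^+ 2 / (2 * E) by rewrite ge_min lexx orbT.
  rewrite ler_pdivlMr ?mulr_gt0// => h.
  have : mu ^+ 2 * (2 * E) <= mu * (2 * E) by rewrite ler_wpM2r// mulr_ge0// ltW.
  have -> : mu ^+ 2 * (2 * E) = (mu ^+ 2 + mu ^+ 2) * E by ring.
  by move=> /le_trans; apply.
have [|d' d'0 time] := @segment_uniform R (s0 - S) (s0 + S) (fun m s => forall t,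
    `|t - tau| < m -> e (F t (v s) - F tau (v s)) <= mu) _.
  move=> s _; have mu2 : 0 < mu / 2 by rewrite divr_gt0.
  have [r r0 hr] := grad_continuous (v s) Cf tauT' mu2.
  have [d2 d20 hd2] := vnear s r r0.
  exists (Num.min d2 (Num.min r m1)) => [|m s']; first by rewrite !lt_min d20 r0.
  rewrite !lt_min => /and4P[m0 md2 mr mm1] _ /and3P[sd2 _ _] t tm.
  have h1 := hr t (v s') (inT' t (lt_trans tm mm1)) (lt_trans tm mr) (hd2 s' sd2).
  have tt : `|tau - tau| < r by rewrite subrr normr0.
  have h2 := hr tau (v s') tauT' tt (hd2 s' sd2).
  rewrite euclid_distC in h2.
  rewrite (le_trans (euclid_normB_le _ _ (F tau (v s))))//.
  move: h1 h2; clear; set a := e (F t (v s') - F tau (v s)).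
  by set b := e (F tau (v s) - F tau (v s')); lra.
pose r := Num.min rho (d' / 2).
have r0 : 0 < r by rewrite lt_min rho0 divr_gt0.
have rd' : 0 < d' / 2 < d' by rewrite divr_gt0//= half_lt.
exists (Num.min mu (r / 2)), (r / 2 / (S + 1)); split.
- by rewrite lt_min mu0 divr_gt0.
- by rewrite !divr_gt0// ltr_wpDl.
move=> eps u t0 /andP[eps0 epse]; rewrite lt_min => /andP[_ t0r].
rewrite le_min => /andP[ut0 _] du.
have epsS : eps * S < r / 2.
  apply: (@le_lt_trans _ _ (eps * (S + 1))).
    by rewrite ler_wpM2l ?(ltW eps0)// lerDl.
  by rewrite -ltr_pdivlMr// ltr_wpDl.
have close s : `|s| <= S -> `|t0 + eps * s - tau| < r.
  move=> sS; rewrite addrAC (le_lt_trans (ler_normD _ _))//.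
  have : `|eps * s| <= eps * S by rewrite normrM gtr0_norm// ler_wpM2l// ltW.
  by move: t0r epsS; clear; set a := `|t0 - tau|; set b := `|eps * s|; set E := eps * S; lra.
have rrho : r <= rho by rewrite ge_min lexx.
have rd : r <= d' / 2 by rewrite ge_min lexx orbT.
have half sg : `|sg| = 1 -> forall s, 0 <= s <= S ->
    e (u (t0 + eps * (sg * s)) - v (s0 + sg * s)) <= eta'.
  move=> sg1.
  have sgS s : 0 <= s <= S -> `|sg * s| <= S.
    by move=> /andP[h1 h2]; rewrite normrM sg1 mul1r ger0_norm.
  have in_S s : 0 < s < S -> `|sg * s| <= S.
    by move=> /andP[h1 h2]; apply: sgS; rewrite !ltW.
  have s0S s : 0 < s < S -> s0 - S <= s0 + sg * s <= s0 + S.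
    by move=> /in_S; rewrite ler_norml !lerD2l.
  apply: (@follow_orbit_half _ _ F tau v s0 S L rho mu eps sg t0 eta') => //.
  - exact: ltW.
  - exact: ltW.
  - move=> s x sS xv; apply: lip => //; first exact: s0S.
    by apply: lt_le_trans rrho; apply: close; exact: in_S.
  - move=> s sS; apply: (time (d' / 2)) => //; first exact: s0S.
    by apply: lt_le_trans rd; apply: close; exact: in_S.
  - move=> s /sgS/close h; have [|u' Du _] := du (t0 + eps * (sg * s)).
      by apply: inT; apply: (lt_trans h); exact: le_lt_trans rhom.
    apply: (@continuous_comp _ _ _ (fun s => t0 + eps * (sg * s)) u).
      apply: (@continuousD _ _ _ (cst t0)); first exact: cst_continuous.
      by apply: continuousM; [exact: cst_continuous|exact: mulrl_continuous].
    by apply: differentiable_continuous; apply/derivable1_diffP; apply: ex_derive.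
  - move=> s /in_S/close h; apply: du; apply: inT.
    by apply: (lt_trans h); exact: le_lt_trans rhom.
  - apply: le_trans muE; rewrite ler_wpM2r ?(ltW E0)// lerD2r.
    by rewrite ler_sqr ?nnegrE ?euclid_norm_ge0// ltW.
move=> s sS; split.
  by apply: inT; apply: (lt_trans (close s sS)); exact: le_lt_trans rhom.
apply: (@le_trans _ _ eta'); last by rewrite ge_min lexx.
have [s_ge0|s_lt0] := leP 0 s.
  have := half 1 (normr1 _) s; rewrite !mul1r; apply.
  by rewrite s_ge0; move: sS; rewrite ger0_norm.
have := half (-1) (normrN1 _) (- s); rewrite !mulrNN !mul1r; apply.
by rewrite oppr_ge0 (ltW s_lt0); move: sS; rewrite ltr0_norm.
Qed.

End Flow.

(** * Folds of the potential *)

Section FoldJump.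
Context {R : realType} {n : nat}.
Variables (T : R) (f : R -> 'rV[R]_n -> R).
Local Notation F := (fun t x => grad (f t) x).
Local Notation e := euclid_norm.

Lemma third_form_scale (g : 'rV[R]_n -> R) x l (k : R) :
  third_form g x (k *: l) = k ^+ 3 * third_form g x l.
Proof.
rewrite /third_form mulr_sumr; apply: eq_bigr => i _.
rewrite mulr_sumr; apply: eq_bigr => j _; rewrite mulr_sumr; apply: eq_bigr => m _.
rewrite !mxE; ring.
Qed.

(** The mixed form has degree one and the third form degree three in [l], so both change sign with
    it. Having equal signs, they can be made negative together, which orients [l] so that the cubic
    drift and, after [tau], the time perturbation both increase [p]. *)
Lemma fold_direction_normalize tau xi (l0 : 'rV[R]_n) :
  fold_direction T f tau xi l0 ->
  Num.sg (mixed_form T f tau xi l0) = Num.sg (third_form (f tau) xi l0) ->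
  exists l, [/\ dotv l l = 1, (kermx (hess (f tau) xi) :=: l)%MS,
    mixed_form T f tau xi l < 0 & third_form (f tau) xi l < 0].
Proof.
move=> [l00 kerl mix third] sgE.
have e0 : 0 < e l0.
  by rewrite lt_def euclid_norm_ge0 andbT; apply: contra_neq l00 => /euclid_norm_eq0.
set A := third_form _ _ _ in third sgE *; set B := mixed_form _ _ _ _ _ in mix sgE *.
pose k := - (Num.sg A / e l0).
have sg0 : Num.sg A != 0 by rewrite sgr_eq0.
have k0 : k != 0 by rewrite oppr_eq0 mulf_neq0// invr_neq0// gt_eqF.
have sg2 : Num.sg A ^+ 2 = 1 by rewrite sqr_sg third.
exists (k *: l0); split.
- rewrite dotvZl dotvZr -euclid_norm_sqr mulrA -expr2 /k sqrrN exprMn sg2 mul1r.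
  by rewrite exprVn mulVf// expf_neq0// gt_eqF.
- by apply: (eqmx_trans kerl); apply: eqmx_sym; apply: eqmx_scale.
- rewrite /mixed_form dotvZr -[dotv _ _]/B /k mulNr oppr_lt0 mulrAC -sgE -normrEsg.
  by rewrite divr_gt0// normr_gt0.
- rewrite third_form_scale -[third_form _ _ _]/A /k.
  have -> : (- (Num.sg A / e l0)) ^+ 3 * A = - ((Num.sg A ^+ 2 * (Num.sg A * A)) / e l0 ^+ 3).
    by field; rewrite gt_eqF.
  by rewrite sg2 mul1r -normrEsg oppr_lt0 divr_gt0 ?exprn_gt0// normr_gt0.
Qed.

Lemma fold_jump tau xi (l0 : 'rV[R]_n) v y : class_C T 3 f -> 0 < tau < T ->
  grad (f tau) xi = 0 -> possemidef (hess (f tau) xi) ->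
  fold_direction T f tau xi l0 ->
  Num.sg (mixed_form T f tau xi l0) = Num.sg (third_form (f tau) xi l0) ->
  gradient_flow f tau v -> v s @[s --> -oo] --> xi -> v s @[s --> +oo] --> y -> y <> xi ->
  exists s0 : R, forall eta0 : R, 0 < eta0 ->
  exists zeta h eps0 : R, [/\ 0 < zeta, 0 < h <= eta0, 0 < eps0 &
  forall eps a u, 0 < eps < eps0 -> tau - h <= a <= tau ->
    solves F eps u a (tau + h) -> e (u a - xi) <= zeta ->
    exists2 te, a <= te <= tau + h & e (u te - v s0) <= eta0 /\
      forall t, a <= t <= te -> e (u t - xi) <= eta0 \/ exists s, e (u t - v s) <= eta0].
Proof.
move=> Cf tauT g0 Hp fd sgE flow vm vp yxi.
have tauT' : 0 <= tau <= T by case/andP: tauT => ? ?; rewrite !ltW.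
have [l [ll kerl mix third]] := fold_direction_normalize fd sgE.
have Hs i j : hess (f tau) xi i j = hess (f tau) xi j i by exact: hess_sym Cf tauT'.
have l0' : l != 0 by rewrite -dotv_eq0 ll oner_eq0.
have [lJ [lam lam0 coer]] := coercive_fold Hs Hp l0' kerl.
have [C1 C10 [d1 d10 lip]] := hess_lipschitz xi Cf tauT'.
have lJl : dotv (l *m hess (f tau) xi) l = 0 by rewrite lJ dotv0l.
have [d2 d20 tay] := fold_taylor Cf tauT' g0 lJl third.
(* Half of the mixed form is kept as drift; the other half pays for the error of [grad_time],
   applied with tolerance [beta]. *)
pose beta := - mixed_form T f tau xi l / 2.
have beta0 : 0 < beta by rewrite divr_gt0// oppr_gt0.
have [d3 d30 time] := grad_time xi Cf tauT beta0.
pose rho := Num.min d1 (Num.min d2 d3).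
have rho0 : 0 < rho by rewrite !lt_min d10 d20.
have [r1 [r2 r3]] : rho <= d1 /\ rho <= d2 /\ rho <= d3.
  by rewrite /rho !ge_min !lexx !orbT.
pose N := e (grad (dtime T f tau) xi).
pose Cop := n%:R ^+ 2 * `|hess (f tau) xi|.
(* Dominates the Lipschitz constant of the Hessian, its size at [xi] and the rate of change of the
   gradient in time. *)
pose C := C1 + Cop + (N + beta).
have Cop0 : 0 <= Cop by rewrite mulr_ge0 ?sqr_ge0.
have N0 : 0 <= N by exact: euclid_norm_ge0.
have C0 : 0 < C by rewrite /C; lra.
have C1C : C1 <= C by rewrite /C; lra.
have CopC : Cop <= C by rewrite /C; lra.
have NC : N + beta <= C by rewrite /C; lra.
have cc0 : 0 < - third_form (f tau) xi l / 4 by rewrite divr_gt0// oppr_gt0.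
apply: (@fold_passage R n F (fun x => hess (f tau) x) tau xi l rho C lam
  (- third_form (f tau) xi l / 4) beta _ _ _ _ _ _ _ _ _ _ _ _ _ _ _ _ v y) => //.
- move=> x z; exact: dotv_mulmx_sym.
- by move=> x w z; exact: grad_MVT Cf tauT'.
- move=> x xr u w; have xd1 := lt_le_trans xr r1.
  have xid : e (xi - xi) < d1 by rewrite subrr euclid_norm0.
  apply: (le_trans (lip x xi xd1 xid u w)).
  by rewrite !ler_wpM2r ?mulr_ge0 ?euclid_norm_ge0.
- move=> u w; apply: (@le_trans _ _ (Cop * (e u * e w))); last first.
    by rewrite ler_wpM2r// mulr_ge0 ?euclid_norm_ge0.
  apply: dotv_mulmx_bound => i j; rewrite [leRHS]/Num.Def.normr/= mx_normrE.
  exact: (le_bigmax _ (fun k : 'I_n * 'I_n => `|hess (f tau) xi k.1 k.2|) (i, j)).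
- move=> p pr; apply: (le_trans (tay p (lt_le_trans pr r2))).
  have -> : - (- third_form (f tau) xi l / 4) = third_form (f tau) xi l / 4.
    by rewrite mulNr opprK.
  exact: lexx.
- move=> t x tr xr w; have := time t x (lt_le_trans tr r3) (lt_le_trans xr r3) w.
  move=> h; rewrite -[dotv _ w](subrK ((t - tau) * dotv (grad (dtime T f tau) xi) w)).
  rewrite (le_trans (ler_normD _ _))//.
  apply: (@le_trans _ _ ((N + beta) * `|t - tau| * e w)); last first.
    by rewrite !ler_wpM2r ?euclid_norm_ge0.
  have h2 : `|(t - tau) * dotv (grad (dtime T f tau) xi) w| <= N * `|t - tau| * e w.
    by rewrite normrM mulrAC mulrC ler_wpM2r// ler_dotv.
  by apply: (le_trans (lerD h h2)); rewrite -!mulrDl [beta + N]addrC.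
- move=> t x tt tr xr; have tE : `|t - tau| = t - tau by rewrite ger0_norm ?subr_ge0.
  have tr' : `|t - tau| < rho by rewrite tE.
  have := time t x (lt_le_trans tr' r3) (lt_le_trans xr r3) l.
  have -> : e l = 1 by rewrite /euclid_norm ll sqrtr1.
  rewrite mulr1 -/(mixed_form T f tau xi l) tE ler_norml => /andP[_].
  have -> : mixed_form T f tau xi l = - (2 * beta) by rewrite /beta; field.
  by rewrite lerBlDr => /le_trans; apply; rewrite le_eqVlt; apply/orP; left; apply/eqP; ring.
Qed.

End FoldJump.

(** * Convergence to the limit evolution *)

Section Convergence.
Context {R : realType}.

Lemma near_at0P (P : R -> Prop) : (\forall eps \near 0^'+, P eps) <->
  exists2 eps0 : R, 0 < eps0 & forall eps, 0 < eps < eps0 -> P eps.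
Proof.
split=> [[d /= d0 hd]|[eps0 e0 h]].
  exists d => // eps /andP[e0 ed]; apply: hd => //.
  by rewrite /ball_ /= sub0r normrN gtr0_norm.
near=> eps; apply: h; apply/andP; split; first by [].
by near: eps; exact: nbhs_right_lt.
Unshelve. all: by end_near. Qed.

Lemma uniform_cvgI (V : normedModType R) (K : set R) (g : R -> R -> V) (u : R -> V) :
  (forall eta : R, 0 < eta -> \forall eps \near 0^'+, forall t, K t -> `|g eps t - u t| < eta) ->
  {uniform K, g eps @[eps --> 0^'+] --> u}.
Proof.
move=> h A /uniform_nbhs[E [+ EA]].
rewrite -entourage_ballE => -[eta /= eta0 hE].
have := h eta eta0; apply: filterS => eps hK; apply: EA => t Kt.
apply: hE => /=; rewrite -ball_normE /= distrC; exact: hK.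
Qed.

Lemma derivable_in_continuous n (A : set R) (g : R -> 'rV[R]_n) :
  (forall t, A t -> derivable_in A g t) -> {within A, continuous g}.
Proof.
move=> dg; apply/within_continuous_rVP => t At eta eta0.
have /cvg_ex[L] := dg t At.
move/cvg_euclidP/(_ _ ltr01) => -[d /= d0 hd].
have L1 : 0 < euclid_norm L + 1 by rewrite ltr_wpDl// euclid_norm_ge0.
exists (Num.min d (eta / (euclid_norm L + 1))) => [|s As].
  by rewrite lt_min d0 divr_gt0.
rewrite lt_min => /andP[sd se].
have [->|st] := eqVneq s t; first by rewrite subrr euclid_norm0.
have h0 : s - t != 0 by rewrite subr_eq0.
have := hd (s - t); rewrite /ball_ /= sub0r normrN => /(_ sd h0).
rewrite subrK => /(_ As) H.
have -> : g s - g t = (s - t) *: ((s - t)^-1 *: (g s - g t)) by rewrite scalerA mulfV// scale1r.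
rewrite euclid_normZ; set q := _^-1 *: _ in H *.
have qL : euclid_norm q <= euclid_norm L + 1.
  rewrite -[q](subrK L) addrC (le_trans (euclid_normD _ _))//.
  by rewrite addrC [leRHS]addrC lerD2r ltW.
apply: (@le_lt_trans _ _ (`|s - t| * (euclid_norm L + 1))); first by rewrite ler_wpM2l.
by rewrite -ltr_pdivlMr.
Qed.

Lemma dist_to_le n (p : R * 'rV[R]_n) (A : set (R * 'rV[R]_n)) q (eta : R) : A q ->
  `|p.1 - q.1| <= eta -> euclid_norm (p.2 - q.2) <= eta ->
  0 <= dist_to p A <= 2 * eta.
Proof.
move=> Aq h1 h2; have eta0 : 0 <= eta by exact: le_trans h1.
have ge0 x : [set euclid_dist p q | q in A] x -> 0 <= x.
  by move=> [z _ <-]; exact: sqrtr_ge0.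
apply/andP; split; first by apply: lb_le_inf => //; exists (euclid_dist p q), q.
apply: (@le_trans _ _ (euclid_dist p q)).
  by apply: ge_inf; [exists 0|exists q].
rewrite -(@ler_sqr R) ?nnegrE ?sqrtr_ge0 ?mulr_ge0//.
rewrite sqr_sqrtr ?addr_ge0 ?sqr_ge0//.
have h3 : (p.1 - q.1) ^+ 2 <= eta ^+ 2.
  by rewrite -real_normK ?num_real// ler_sqr ?nnegrE.
have h4 : euclid_norm (p.2 - q.2) ^+ 2 <= eta ^+ 2.
  by rewrite ler_sqr ?nnegrE// euclid_norm_ge0.
have := sqr_ge0 eta; have -> : (2 * eta) ^+ 2 = 4 * eta ^+ 2 by ring.
move: h3 h4; clear; set a := _ ^+ 2; set b := _ ^+ 2; set c := _ ^+ 2; lra.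
Qed.

(* Choosing, for every [eps], an almost optimal [te] makes the choice
   independent of the tolerance. *)
Lemma uniform_choice (Q : R -> R -> R -> Prop) :
  (forall eps te r r', Q eps te r -> r <= r' -> Q eps te r') ->
  (forall eta : R, 0 < eta -> \forall eps \near 0^'+, exists te, Q eps te eta) ->
  exists tf : R -> R, forall eta : R, 0 < eta -> \forall eps \near 0^'+, Q eps (tf eps) eta.
Proof.
move=> Qmono Qex.
pose A eps := [set r : R | 0 <= r /\ exists te, Q eps te r].
have lbA eps : has_lbound (A eps) by exists 0 => r [].
have [|tf tfP] := @choice _ _ (fun eps te => 0 < eps -> A eps !=set0 ->
    Q eps te (inf (A eps) + eps)).
  move=> eps; have [[r Ar]|nA] := pselect (A eps !=set0); last by exists 0 => _ /nA.
  have [e0|e0] := leP eps 0; first by exists 0.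
  have [|r' [_ [te Qte]] r'lt] := @inf_adherent _ (A eps) eps e0.
    by split; [exists r|].
  by exists te => _ _; apply: Qmono Qte (ltW r'lt).
exists tf => eta eta0; have eta2 : 0 < eta / 2 by rewrite divr_gt0.
near=> eps; have eps0 : 0 < eps by [].
have Ae : A eps (eta / 2).
  by split; [exact: ltW|near: eps; exact: Qex].
have epse : eps <= eta / 2 by near: eps; exact: nbhs_right_le.
apply: (Qmono _ _ _ _ (tfP eps eps0 _)); first by exists (eta / 2).
have := ge_inf (lbA eps) Ae; lra.
Unshelve. all: by end_near. Qed.

End Convergence.

Lemma window_arith (R : realFieldType) (tau a te h h2 d eta es hL mu : R) :
  tau - h < a -> a <= te -> te <= tau + h -> h <= d -> d <= h2 / 2 -> d <= mu / 2 ->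
  0 < h2 -> 0 < mu -> h2 <= eta -> h2 <= hL -> 0 <= es -> es <= h2 / 2 ->
  [/\ `|te - tau| < mu, `|te - tau| <= eta, te + es <= tau + h2 & tau - hL <= te + es].
Proof.
move=> *; split; [rewrite ltr_norml| rewrite ler_norml|lra|lra];
  by apply/andP; split; lra.
Qed.

(** * Induction over the stages *)

Section Main.
Context {R : realType} {n : nat}.
Variables (T : R) (f : R -> 'rV[R]_n -> R).
Local Notation F := (fun t x => grad (f t) x).
Local Notation e := euclid_norm.
Hypotheses (T_gt0 : 0 < T) (Cf : class_C T 3 f).
Hypothesis A2T : ~ (fst @` degenerate T f) T.
Variables (y0 : 'rV[R]_n) (k : nat) (t_ : nat -> R).
Variables (u_ v_ : nat -> R -> 'rV[R]_n) (x_ : nat -> 'rV[R]_n) (u : R -> 'rV[R]_n).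
Hypothesis lim : limit_evolution T f y0 k t_ u_ v_ x_ u.
Variables (yeps : R -> 'rV[R]_n) (ueps : R -> R -> 'rV[R]_n).
Hypothesis ueps_sol : forall eps : R, 0 < eps ->
    perturbed_solution T f eps (yeps eps) (ueps eps).
Hypothesis yeps_cvg : yeps eps @[eps --> 0^'+] --> y0.

Lemma k_gt0 : (0 < k)%N.
Proof.
rewrite lt0n; apply/eqP => k0; have := le_tk lim; rewrite k0 (le_t0 lim) => T0.
by move: T_gt0; rewrite -T0 ltxx.
Qed.

Lemma t_le i j : (i <= j <= k)%N -> t_ i <= t_ j.
Proof.
case/andP => ij jk; elim: j ij jk => [|j IH] ij jk.
  by move: ij; rewrite leqn0 => /eqP ->.
move: ij; rewrite leq_eqVlt => /predU1P[->//|ij].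
by rewrite (le_trans (IH ij (ltnW jk)))// ltW// (le_t_incr lim).
Qed.

Lemma t_in i : (i <= k)%N -> 0 <= t_ i <= T.
Proof.
by move=> ik; rewrite -{1}(le_t0 lim) -(le_tk lim) !t_le//= ?leq0n ?ik ?leqnn.
Qed.

Lemma t_in_oo i : (0 < i < k)%N -> 0 < t_ i < T.
Proof.
move=> /andP[i0 ik]; apply/andP; split.
  case: i i0 ik => // i _ ik; apply: le_lt_trans (le_t_incr lim (ltnW ik)).
  by have /andP[] := t_in (ltnW (ltnW ik)).
by apply: (lt_le_trans (le_t_incr lim ik)); have /andP[] := t_in ik.
Qed.

Lemma stage_exists t : 0 <= t < T ->
  exists2 i, (0 < i <= k)%N & t_ i.-1 <= t < t_ i.
Proof.
move=> /andP[t0 tT]; have ex : exists i, t < t_ i by exists k; rewrite (le_tk lim).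
have ik : (ex_minn ex <= k)%N by case: ex_minnP => i _; apply; rewrite (le_tk lim).
exists (ex_minn ex); case: ex_minnP ik => i ti imin ik.
  rewrite ik andbT lt0n; apply: contraTneq ti => ->.
  by rewrite (le_t0 lim) -leNgt.
rewrite ti andbT; have i0 : (0 < i)%N.
  by rewrite lt0n; apply: contraTneq ti => ->; rewrite (le_t0 lim) -leNgt.
by rewrite leNgt; apply/negP => /imin; rewrite leqNgt prednK// leqnn.
Qed.

Lemma ueps_derive eps (t : R) : 0 < eps -> 0 < t < T ->
  exists2 u', is_derive t 1 (ueps eps) u' & eps *: u' = - F t (ueps eps t).
Proof.
move=> eps0 /andP[t0 tT]; have [_ /(_ t)] := ueps_sol eps0.
rewrite in_itv /= !ltW// => /(_ isT)[D E].
exists (derive_in `[0, T] (ueps eps) t); last exact: E.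
apply: is_derive_within_interior D; near=> s; rewrite /= in_itv /=; apply/andP; split.
  by apply: ltW; near: s; exact: lt_nbhsr.
by apply: ltW; near: s; exact: lt_nbhsl.
Unshelve. all: by end_near. Qed.

Lemma ueps_solves eps a b : 0 < eps -> 0 <= a -> b <= T -> solves F eps (ueps eps) a b.
Proof.
move=> eps0 a0 bT; split.
  have cT : {within `[0, T], continuous (ueps eps)}.
    by apply: derivable_in_continuous => t tT; have [_ /(_ t tT)[]] := ueps_sol eps0.
  apply: continuous_subspaceW cT => t /=; rewrite !in_itv /= => /andP[at_ tb].
  by rewrite (le_trans a0)// (le_trans tb).
move=> t /andP[at_ tb]; apply: ueps_derive => //.
by rewrite (le_lt_trans a0)// (lt_le_trans tb).
Qed.

(* The time [a] may not depend on [eps], but may depend on [eta]: after a jump,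
   [ueps] gets close to the new branch only at times tending to [t_ i.-1]. *)
Definition starts i a0 := forall eta : R, 0 < eta ->
  exists2 a, t_ i.-1 <= a <= a0 & \forall eps \near 0^'+, e (ueps eps a - u_ i a) <= eta.

(** The radius [zeta] that [track] asks for is known once [eta] is, and [starts] then supplies a
    time [a <= a0] at which it is met. Tracking covers [[a, b]], hence [[a0, b]]. *)
Lemma stage_track i a0 b (eta : R) : (0 < i <= k)%N -> a0 <= b -> b < t_ i ->
  starts i a0 -> 0 < eta ->
  \forall eps \near 0^'+, forall t, a0 <= t <= b -> e (ueps eps t - u_ i t) <= eta.
Proof.
move=> ik ab bt st eta0; have /andP[i0 ik'] := ik.
have /andP[tp0 _] : 0 <= t_ i.-1 <= T by apply: t_in; rewrite (leq_trans (leq_pred i)).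
have /andP[_ tiT] := t_in ik'.
have [a' /andP[ta' a'a0] _] := st 1 ltr01.
have tb : t_ i.-1 <= b by rewrite (le_trans ta')// (le_trans a'a0).
have [zeta [eps0 [z0 e0 tr]]] := @track _ _ T f Cf (t_ i.-1) (t_ i) (t_ i.-1) b eta (u_ i)
  (le_u_C2 lim ik) tp0 tiT (le_crit lim ik) (lexx _) tb bt eta0.
have [a /andP[ta aa0] near_a] := st zeta z0.
near=> eps => t /andP[at_ tb']; apply: (tr eps (ueps eps) a).
- by apply/andP; split => //; near: eps; exact: nbhs_right_lt.
- by rewrite ta (le_trans aa0).
- by apply: ueps_solves => //; [exact: le_trans ta|exact: ltW (lt_le_trans bt tiT)].
- by near: eps.
- by rewrite (le_trans aa0).
Unshelve. all: by end_near. Qed.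

Lemma starts_first : starts 1 0.
Proof.
move=> eta eta0; exists 0; first by rewrite (le_t0 lim) lexx.
near=> eps; have eps0 : 0 < eps by [].
have [-> _] := ueps_sol eps0; rewrite (le_init lim); apply: ltW; near: eps.
by have /cvg_euclidP := yeps_cvg; apply.
Unshelve. all: by end_near. Qed.

Lemma left_limit i (eta d : R) : (0 < i <= k)%N -> 0 < eta -> 0 < d ->
  exists2 a, t_ i.-1 < a < t_ i & t_ i - d < a /\ e (u_ i a - x_ i) <= eta.
Proof.
move=> ik eta0 d0; have /cvg_euclidP/(_ _ eta0) H := le_x_lim lim ik.
have ti : t_ i.-1 < t_ i by case/andP: ik => i0 ik; have := @le_t_incr _ _ _ _ _ _ _ _ _ _ _ lim i.-1; rewrite prednK//; apply.
have : \forall a \near (t_ i)^'-, [/\ t_ i.-1 < a < t_ i, t_ i - d < a & e (u_ i a - x_ i) <= eta].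
  near=> a; split.
  - by apply/andP; split; [near: a; exact: nbhs_left_gt|].
  - by near: a; apply: nbhs_left_gt; rewrite ltrBlDr ltrDl.
  - by apply: ltW; near: a.
move=> /filter_ex[a [h1 h2 h3]]; by exists a.
Unshelve. all: by end_near. Qed.

Section Jump.
Variable i : nat.
Hypothesis ik : (0 < i < k)%N.
Hypothesis st : forall a0, t_ i.-1 < a0 -> starts i a0.
Let tau := t_ i.
Let xi := x_ i.
Let v := v_ i.
Let y := u_ i.+1 (t_ i).

Let ik1 : (0 < i <= k)%N. Proof. by case/andP: ik => -> /ltnW. Qed.
Let ik2 : (0 < i.+1 <= k)%N. Proof. by case/andP: ik. Qed.

Definition close_jump (eta eps t : R) :=
  [\/ exists s, e (ueps eps t - v s) <= eta, e (ueps eps t - xi) <= eta |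
      e (ueps eps t - y) <= eta].

Lemma tau_lt : t_ i < t_ i.+1.
Proof. by apply: (le_t_incr lim); case/andP: ik. Qed.

Lemma y_crit : grad (f tau) y = 0 /\ posdef (hess (f tau) y).
Proof. by apply: (le_crit lim ik2); rewrite in_itv /= lexx tau_lt. Qed.

(** The Hessian is singular at [xi] and nonsingular at [y]. *)
Lemma y_neq_xi : y <> xi.
Proof.
have [[_ _ /= det0] _ _] := le_x_fold lim ik; have [_ yp] := y_crit => E.
have : \det (hess (f tau) y) != 0.
  apply/det0P => -[z z0 zH]; have := yp z z0.
  by rewrite zH dotv0l ltxx.
by rewrite E det0 eqxx.
Qed.

(** The tolerances are chosen against the direction of time: the basin of [y], the length of orbit
    leading into it, the accuracy at the exit from the fold, and last the entry time [a] on the old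
    branch. The times [a] and [b] do not depend on [eps], and [s0] does not depend on [eta]. *)
Lemma jump_core : exists s0 : R, forall eta : R, 0 < eta ->
  exists a b, [/\ tau - eta <= a < tau, tau < b <= tau + eta &
    \forall eps \near 0^'+,
      [/\ exists2 te, `|te - tau| <= eta & e (ueps eps te - v s0) <= eta,
          forall t, a <= t <= b -> close_jump eta eps t
        & e (ueps eps b - y) <= eta]].
Proof.
have [[_ /= xcrit _] xsemi [l [fd sgE]]] := le_x_fold lim ik.
have [flow vm vp] := le_v_flow lim ik.
have tauT := t_in_oo ik; have /andP[tau0 tau1] := tauT.
have tauT' : 0 <= tau <= T by rewrite !ltW.
have [s0 jump] := @fold_jump _ _ T f tau xi l v y Cf tauT xcrit xsemi fd sgE flow vm vp y_neq_xi.
exists s0 => eta eta0; have [yc yp] := y_crit.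
have [hL [zL [hL0 zL0 land]]] := landing Cf tauT' yc yp eta0.
have zL2 : 0 < zL / 2 by rewrite divr_gt0.
(* The orbit uses half of the landing radius at fast time [s2]; the other half is left for the error
   in following it. *)
have [s2 s02 vs2] : exists2 s2 : R, s0 <= s2 & e (v s2 - y) <= zL / 2.
  have /cvg_euclidP/(_ _ zL2) [M [Mr hM]] := vp.
  exists (Num.max s0 (M + 1)); first by rewrite le_max lexx.
  by apply/ltW/hM; rewrite lt_max ltrDl ltr01 orbT.
pose S := s2 - s0; have S0 : 0 <= S by rewrite subr_ge0.
pose eta1 := Num.min eta (zL / 2).
have eta10 : 0 < eta1 by rewrite lt_min eta0.
have [mu [eps1 [mu0 eps10 follow]]] := follow_orbit Cf s0 tauT flow S0 eta10.
pose h2 := Num.min (Num.min hL eta) (T - tau).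
have h20 : 0 < h2 by rewrite !lt_min hL0 eta0 subr_gt0.
have [h2L h2eta h2T] : [/\ h2 <= hL, h2 <= eta & h2 <= T - tau].
  by rewrite /h2 !ge_min !lexx !orbT.
clearbody h2.
(* [mu / 2] makes the exit a valid start for [follow_orbit]; [h2 / 2] leaves half of the landing
   window for the following phase, which takes the slow time [eps * S]. *)
pose eta2 := Num.min (mu / 2) (h2 / 2).
have eta20 : 0 < eta2 by rewrite lt_min !divr_gt0.
have [e2mu e2h] : eta2 <= mu / 2 /\ eta2 <= h2 / 2 by rewrite /eta2 !ge_min !lexx orbT.
clearbody eta2.
have muhalf := half_lt mu0; have h2half := half_lt h20.
have e2eta : eta2 <= eta by rewrite (le_trans e2h)// (le_trans (ltW h2half)).
have [zeta [h [eps2 [z0 /andP[h0 he2] eps20 pass]]]] := jump eta2 eta20.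
have zeta2 : 0 < zeta / 2 by rewrite divr_gt0.
have [a /andP[pa atau] [ah ua]] := left_limit ik1 zeta2 h0.
exists a, (tau + h2).
split.
- by rewrite atau andbT (le_trans _ (ltW ah))// lerD2l lerN2 (le_trans he2).
- by rewrite ltrDl h20 lerD2l.
have near_a : \forall eps \near 0^'+, forall t, a <= t <= a -> e (ueps eps t - u_ i t) <= zeta / 2.
  by apply: (stage_track ik1) => //; exact: st.
near=> eps; have eps0 : 0 < eps by [].
have epsS : eps * S <= h2 / 2.
  apply: (@le_trans _ _ (eps * (S + 1))); first by rewrite ler_wpM2l ?lerDl// ltW.
  rewrite -ler_pdivlMr ?ltr_wpDl//; near: eps; apply: nbhs_right_le.
  by rewrite !divr_gt0// ltr_wpDl.
have a_ge0 : 0 <= a.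
  have ip : (i.-1 <= k)%N by case/andP: ik => _ /ltnW; apply: leq_trans (leq_pred i).
  by have /andP[q _] := t_in ip; exact: le_trans q (ltW pa).
have uax : e (ueps eps a - xi) <= zeta.
  rewrite (le_trans (euclid_normB_le _ _ (u_ i a)))//.
  have near_aa : forall t, a <= t <= a -> e (ueps eps t - u_ i t) <= zeta / 2 by near: eps.
  have := near_aa a; rewrite lexx => /(_ isT) h1.
  by rewrite [zeta]splitr lerD.
have [|||te /andP[ate teh] [ute close1]] := pass eps a (ueps eps) _ _ _ uax.
- by apply/andP; split => //; near: eps; exact: nbhs_right_lt.
- by rewrite -/tau in ah; rewrite (ltW ah) ltW.
- apply: ueps_solves => //; rewrite -lerBrDl (le_trans _ h2T)// (le_trans he2)//.
  by rewrite (le_trans e2h)// ltW.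
rewrite -/tau in ah; have epsS0 : 0 <= eps * S by rewrite mulr_ge0// ltW.
have [te_tau te_eta teb teL] :=
  window_arith ah ate teh he2 e2h e2mu h20 mu0 h2eta h2L epsS0 epsS.
have ute' : e (ueps eps te - v s0) <= mu.
  by apply: (le_trans ute); apply: (le_trans e2mu); exact: ltW.
have foll := follow eps (ueps eps) te _ te_tau ute' (fun t => ueps_derive eps0).
have {}foll : forall s, `|s| <= S -> 0 < te + eps * s < T /\
      e (ueps eps (te + eps * s) - v (s0 + s)) <= eta1.
  by apply: foll; apply/andP; split => //; near: eps; exact: nbhs_right_lt.
have land_y : forall t, te + eps * S <= t <= tau + h2 -> e (ueps eps t - y) <= eta.
  apply: (land eps (ueps eps) (te + eps * S) (tau + h2) eps0 teb).
  - by rewrite addr_ge0// (le_trans a_ge0).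
  - by rewrite addrC -lerBrDr.
  - exact: teL.
  - by rewrite lerD2l.
  - apply: ueps_solves => //; first by rewrite addr_ge0// (le_trans a_ge0).
    by rewrite addrC -lerBrDr.
  have [|_] := foll S; first by rewrite ger0_norm.
  have s0S : s0 + S = s2 by rewrite addrC subrK.
  rewrite s0S => h1.
  rewrite (le_trans (euclid_normB_le _ _ (v s2)))// [zL]splitr lerD//.
  by rewrite (le_trans h1)// ge_min lexx orbT.
split.
- by exists te => //; exact: le_trans e2eta.
- move=> t /andP[at_ tb].
  have [tte|tet] := leP t te.
    have tI : a <= t <= te by rewrite at_.
    have [h1|[s h1]] := close1 t tI.
      by apply: Or32; exact: le_trans e2eta.
    by apply: Or31; exists s; exact: le_trans e2eta.
  have [tS|St] := leP t (te + eps * S); last first.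
    by apply: Or33; apply: land_y; rewrite (ltW St).
  (* The fast time elapsed since the exit, counted from [s0]. *)
  apply: Or31; exists (s0 + (t - te) / eps).
  have [|_] := foll ((t - te) / eps).
    rewrite ger0_norm; last by rewrite divr_ge0 ?subr_ge0// ltW.
    by rewrite ler_pdivrMr// lerBlDl mulrC.
  rewrite mulrCA mulfV ?gt_eqF// mulr1 [te + _]addrC subrK => /le_trans; apply.
  by rewrite ge_min lexx.
- by apply: land_y; rewrite lexx andbT.
Unshelve. all: by end_near. Qed.

(** At the end [b] of the jump window the solution is near [y], and so is the new branch by its
    right continuity at [t_ i]. Shrinking the tolerance brings [b] as close to [t_ i] as desired. *)
Lemma starts_next a0 : t_ i < a0 -> starts i.+1 a0.
Proof.
move=> ta0 eta eta0; have [s0 core] := jump_core.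
have cu : {within `[t_ i, t_ i.+1[, continuous (u_ i.+1)} by case: (le_u_C2 lim ik2).
have eta2 : 0 < eta / 2 by rewrite divr_gt0.
have [|d d0 hd] := (within_continuous_rVP _ _).1 cu (t_ i) _ _ eta2.
  by rewrite /= in_itv /= lexx tau_lt.
have tt := tau_lt.
pose r := Num.min (Num.min (eta / 2) (a0 - t_ i)) (Num.min (d / 2) ((t_ i.+1 - t_ i) / 2)).
have r0 : 0 < r by rewrite !lt_min eta2 subr_gt0 ta0 !divr_gt0// subr_gt0.
have [r1 r2 r3 r4] : [/\ r <= eta / 2, r <= a0 - t_ i, r <= d / 2 & r <= (t_ i.+1 - t_ i) / 2].
  by rewrite /r !ge_min !lexx !orbT.
clearbody r.
have [a [b [_ /andP[b1 b2] near_b]]] := core r r0.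
exists b; first by rewrite /= (ltW b1) /=; rewrite /tau in b2; lra.
near=> eps; have [_ _ hb] : [/\ exists2 te, `|te - tau| <= r & e (ueps eps te - v s0) <= r,
          forall t, a <= t <= b -> close_jump r eps t
        & e (ueps eps b - y) <= r] by near: eps.
rewrite (le_trans (euclid_normB_le _ _ y))// [eta]splitr lerD//; first exact: le_trans r1.
rewrite euclid_distC; apply/ltW/hd.
  by rewrite /= in_itv /= (ltW b1) /=; rewrite /tau in b2; lra.
by rewrite /tau in b1 b2; rewrite gtr0_norm ?subr_gt0//; lra.
Unshelve. all: by end_near. Qed.

Lemma close_graph eta eps t : `|t - tau| <= eta -> close_jump eta eps t ->
  0 <= dist_to (t, ueps eps t) (limit_graph T k t_ u_ v_ x_ u) <= 2 * eta.
Proof.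
move=> tt cj.
have inG z : (range v `|` [set xi; y]) z -> limit_graph T k t_ u_ v_ x_ u (tau, z).
  by move=> zG; right; exists i => //; split.
case: cj => [[s h]|h|h].
- by apply: (@dist_to_le _ _ _ _ (tau, v s)) => //; apply: inG; left; exists s.
- by apply: (@dist_to_le _ _ _ _ (tau, xi)) => //; apply: inG; right; left.
- by apply: (@dist_to_le _ _ _ _ (tau, y)) => //; apply: inG; right; right.
Qed.

End Jump.

Lemma starts_all i : (0 < i <= k)%N -> forall a0, t_ i.-1 < a0 -> starts i a0.
Proof.
elim: i => // i IH /andP[_ ik] a0 ta0.
have [i0|i0] := posnP i.
  rewrite i0 /= in ta0 *; move=> eta eta0; have [a /andP[a1 a2] h] := starts_first eta0.
  by exists a => //; rewrite a1 /= (le_trans a2)// -(le_t0 lim) ltW.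
apply: starts_next => //; first by rewrite i0.
by apply: IH; rewrite i0 ltnW.
Qed.

Lemma regular_time t : 0 <= t < T -> (forall i, (0 < i <= k)%N -> t <> t_ i) ->
  exists2 d : R, 0 < d & forall eta : R, 0 < eta -> \forall eps \near 0^'+,
    forall s, 0 <= s <= T -> `|s - t| < d -> e (ueps eps s - u s) <= eta.
Proof.
move=> tT treg; have [i ik /andP[ti1 ti2]] := stage_exists tT.
have /andP[i0 ik'] := ik.
suff [a0 [d [d0 da st]]] : exists a0 d, [/\ 0 < d,
    forall s, 0 <= s <= T -> `|s - t| < d -> t_ i.-1 <= a0 <= s /\ s <= (t + t_ i) / 2 & starts i a0].
  exists d => // eta eta0.
  have := stage_track (b := (t + t_ i) / 2) ik _ _ st eta0.
  have ab : a0 <= (t + t_ i) / 2.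
    have tT' : 0 <= t <= T by case/andP: tT => -> /ltW.
    have td : `|t - t| < d by rewrite subrr normr0.
    by have [/andP[_ h1] h2] := da t tT' td; exact: le_trans h2.
  have bt : (t + t_ i) / 2 < t_ i by lra.
  move=> /(_ ab bt); apply: filterS => eps H s sT sd.
  have [/andP[h1 h2] h3] := da s sT sd.
  rewrite (le_u_pieces lim ik); first by apply: H; rewrite h2.
  by rewrite in_itv /= (le_trans h1 h2) (le_lt_trans h3).
(* On the first stage tracking begins at time [0], so that [t = 0] is included; on later stages it
   begins strictly between [t_ i.-1] and [t]. *)
have [i1|i1] := eqVneq i 1%N.
  exists 0, ((t_ i - t) / 2); split.
  - by rewrite divr_gt0// subr_gt0.
  - move=> s /andP[s0 _]; rewrite ltr_norml s0 i1 /= (le_t0 lim) lexx => /andP[h1 h2].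
    by split => //; lra.
  - by rewrite i1; exact: starts_first.
have ti : t_ i.-1 < t.
  rewrite lt_neqAle ti1 andbT; apply/eqP => E; apply: (treg i.-1) => //.
  rewrite (leq_trans (leq_pred i))// andbT -ltnS prednK//.
  by rewrite ltn_neqAle eq_sym i1.
exists ((t_ i.-1 + t) / 2), (Num.min ((t_ i - t) / 2) ((t - t_ i.-1) / 2)); split.
- by rewrite lt_min !divr_gt0 ?subr_gt0.
- move=> s _; rewrite lt_min !ltr_norml => /andP[/andP[h1 h2] /andP[h3 h4]].
  by split; [apply/andP; split; lra|lra].
- by apply: (starts_all ik); lra.
Qed.

(** Passing to the limit along the last branch makes [x_ k] a critical point with semidefinite
    Hessian at time [T]. No degenerate point lives at [T], so the Hessian is definite and [landing]
    applies, although the branch is controlled only before [T]. *)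
Lemma final_time (eta : R) : 0 < eta ->
  exists2 d : R, 0 < d & \forall eps \near 0^'+,
    forall s, 0 <= s <= T -> T - d <= s -> e (ueps eps s - x_ k) <= eta.
Proof.
move=> eta0.
have kk : (0 < k <= k)%N by rewrite k_gt0 leqnn.
have TT : 0 <= T <= T by rewrite lexx ltW.
have tk : t_ k = T := le_tk lim.
have tk1 : t_ k.-1 < T.
  by rewrite -tk; have := @le_t_incr _ _ _ _ _ _ _ _ _ _ _ lim k.-1; rewrite prednK ?k_gt0//; apply.
have /andP[tk0 _] : 0 <= t_ k.-1 <= T by apply: t_in; exact: leq_pred.
have in_k a : t_ k.-1 < a < t_ k -> (a \in `[t_ k.-1, t_ k[) /\ 0 <= a <= T.
  move=> /andP[a1 a2]; rewrite in_itv /= (ltW a1) a2 (le_trans tk0 (ltW a1)).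
  by rewrite -tk ltW.
have grad0 : grad (f T) (x_ k) = 0.
  apply: euclid_norm_eq0; apply/eqP; rewrite eq_le euclid_norm_ge0 andbT.
  apply/ler_addgt0Pl => r r0; rewrite addr0.
  have [d d0 hd] := grad_continuous (x_ k) Cf TT r0.
  have d2 : 0 < d / 2 by rewrite divr_gt0.
  have [a a1 [a2 a3]] := left_limit kk d2 d0.
  have [a4 a5] := in_k a a1; have [ga _] := le_crit lim kk a4.
  have ua : e (u_ k a - x_ k) < d by apply: (le_lt_trans a3); exact: half_lt.
  have ad : `|a - T| < d.
    case/andP: a1 => _ at_; rewrite tk in a2 at_.
    by rewrite ltr0_norm ?subr_lt0// opprB ltrBlDl -ltrBlDr.
  by have := hd a (u_ k a) a5 ad ua; rewrite ga sub0r euclid_normN => /ltW.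
have semi : possemidef (hess (f T) (x_ k)).
  move=> z; rewrite leNgt; apply/negP => zneg.
  have zz : 0 <= e z * e z by rewrite mulr_ge0 ?euclid_norm_ge0.
  (* An error [r] times the square of the norm of [z] cannot compensate the negative value, so the
     form would fail to be positive at nearby points of the branch. *)
  pose r := - dotv (z *m hess (f T) (x_ k)) z / (e z * e z + 1).
  have r0 : 0 < r by rewrite divr_gt0 ?oppr_gt0// ltr_wpDl.
  have [d d0 hd] := hess_continuous (x_ k) Cf TT r0.
  have d2 : 0 < d / 2 by rewrite divr_gt0.
  have [a a1 [a2 a3]] := left_limit kk d2 d0.
  have [a4 a5] := in_k a a1; have [_ pa] := le_crit lim kk a4.
  have ua : e (u_ k a - x_ k) < d by apply: (le_lt_trans a3); exact: half_lt.
  have ad : `|a - T| < d.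
    case/andP: a1 => _ at_; rewrite tk in a2 at_.
    by rewrite ltr0_norm ?subr_lt0// opprB ltrBlDl -ltrBlDr.
  have z0 : z != 0 by apply: contraTneq zneg => ->; rewrite mul0mx dotv0l ltxx.
  have := pa z z0; have := hd a (u_ k a) a5 ad ua z z.
  have : r * (e z * e z) <= - dotv (z *m hess (f T) (x_ k)) z.
    by rewrite /r mulrAC ler_pdivrMr ?ltr_wpDl// ler_pM2l ?oppr_gt0// lerDl.
  rewrite mulmxBr dotvBl ler_norml => h1 /andP[_ h2] h3.
  have := le_trans h2 h1; rewrite lerBlDr addNr => h4.
  by have := lt_le_trans h3 h4; rewrite ltxx.
have pd : posdef (hess (f T) (x_ k)).
  apply: possemidef_det_posdef => //; first by move=> i j; exact: hess_sym Cf TT.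
  by move=> det0; apply: A2T; exists (T, x_ k) => //; split => //=; rewrite in_itv.
have [h [zeta [h0 z0 land]]] := landing Cf TT grad0 pd eta0.
have z2 : 0 < zeta / 2 by rewrite divr_gt0.
have [a a1 [a2 a3]] := left_limit kk z2 h0.
have [a4 /andP[a5 a6]] := in_k a a1; case/andP: a1 => a7 a8; rewrite tk in a8 a2.
exists (T - a); first by rewrite subr_gt0.
have near_a : \forall eps \near 0^'+, forall t, a <= t <= a -> e (ueps eps t - u_ k t) <= zeta / 2.
  by apply: (stage_track kk) => //; [rewrite tk|exact: starts_all].
near=> eps => s /andP[s0 sT]; rewrite subKr => as_.
have eps0 : 0 < eps by [].
apply: (land eps (ueps eps) a T) => //.
- by rewrite ltW.
- by rewrite lerDl ltW.
- exact: ueps_solves.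
- have near_aa : forall t, a <= t <= a -> e (ueps eps t - u_ k t) <= zeta / 2 by near: eps.
  rewrite (le_trans (euclid_normB_le _ _ (u_ k a)))// [zeta]splitr lerD//.
  by apply: near_aa; rewrite lexx.
- by rewrite as_.
Unshelve. all: by end_near. Qed.

Lemma uniform_away_from_jumps (K : set R) : compact K ->
  K `<=` `[0, T] `\` [set t_ i | i in [set i | (0 < i <= k)%N]] ->
  {uniform K, ueps eps @[eps --> 0^'+] --> u}.
Proof.
move=> cK Ksub; apply: uniform_cvgI => eta eta0.
have eta2 : 0 < eta / 2 by rewrite divr_gt0.
(* The small parameter of the covering lemma is [eps] here, and [K] avoids [T] because
   [T = t_ k]. *)
have [t Kt|d d0 hd] := @compact_uniform _ K (fun eps t => e (ueps eps t - u t) <= eta / 2) cK.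
  have [tT treg] := Ksub t Kt; rewrite /= in_itv /= in tT.
  have ne i : (0 < i <= k)%N -> t <> t_ i by move=> ik E; apply: treg; exists i.
  have tT' : 0 <= t < T.
    case/andP: tT => -> tT; rewrite lt_neqAle tT andbT; apply/eqP.
    by rewrite -(le_tk lim); apply: ne; rewrite k_gt0 leqnn.
  have [d d0 /(_ _ eta2)/near_at0P[eps0 e0 hd]] := regular_time tT' ne.
  exists (Num.min d eps0) => [|eps s]; first by rewrite lt_min d0.
  rewrite !lt_min => /andP[e1 /andP[_ e2]] Ks /andP[sd _].
  apply: hd => //; first by rewrite e1.
  by have [] := Ksub s Ks; rewrite /= in_itv.
apply/near_at0P; exists d => // eps epsd t Kt.
apply: (le_lt_trans (norm_le_euclid _)); apply: (le_lt_trans (hd eps t epsd Kt)).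
exact: half_lt.
Qed.

Lemma jump_profile i : (0 < i < k)%N -> exists2 teps : R -> R,
  teps eps @[eps --> 0^'+] --> t_ i &
  forall K : set R, compact K ->
    {uniform K, (fun s => ueps eps (teps eps + eps * s)) @[eps --> 0^'+] --> v_ i}.
Proof.
move=> ik; have ik1 : (0 < i <= k)%N by case/andP: ik => -> /ltnW.
have [s0 core] := jump_core ik (starts_all ik1).
have [||tf tfP] := @uniform_choice _ (fun eps te r =>
    `|te - t_ i| <= r /\ e (ueps eps te - v_ i s0) <= r) _ _.
- by move=> eps te r r' [h1 h2] rr; split; exact: le_trans rr.
- move=> eta eta0; have [a [b [_ _ near_eta]]] := core eta eta0.
  by apply: filterS near_eta => eps [[te h1 h2] _ _]; exists te.
have epss0 (c : R) : 0 < c -> \forall eps \near 0^'+, `|eps * s0| < c.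
  move=> c0; near=> eps; rewrite normrM gtr0_norm//.
  apply: (@le_lt_trans _ _ (eps * (`|s0| + 1))); first by rewrite ler_wpM2l ?lerDl// ltW.
  rewrite -ltr_pdivlMr ?ltr_wpDl//; near: eps; apply: nbhs_right_lt.
  by rewrite divr_gt0// ltr_wpDl.
(* [tf] marks the passage near [v_ i s0]; going back by the fast time [s0] aligns the parameter with
   that of [v_ i] and costs only [O(eps)]. *)
exists (fun eps => tf eps - eps * s0).
  apply/cvgrPdist_lt => eta eta0; have eta2 : 0 < eta / 2 by rewrite divr_gt0.
  near=> eps; rewrite distrC addrAC [eta]splitr (le_lt_trans (ler_normB _ _))//.
  apply: ler_ltD; last by near: eps; exact: epss0.
  have [h1 _] : `|tf eps - t_ i| <= eta / 2 /\ e (ueps eps (tf eps) - v_ i s0) <= eta / 2.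
    by near: eps; exact: tfP.
  exact: h1.
move=> K /compact_bounded[M [Mr MK]]; apply: uniform_cvgI => eta eta0.
have eta2 : 0 < eta / 2 by rewrite divr_gt0.
have [flow _ _] := le_v_flow lim ik.
(* Bounds [s - s0] for all [s] in [K]. *)
pose S := `|M| + 1 + `|s0|; have S0 : 0 <= S by rewrite !addr_ge0.
have [mu [eps1 [mu0 eps10 follow]]] := follow_orbit Cf s0 (t_in_oo ik) flow S0 eta2.
have mu2 : 0 < mu / 2 by rewrite divr_gt0.
near=> eps => s Ks; have eps0 : 0 < eps by [].
have [h1 h2] : `|tf eps - t_ i| <= mu / 2 /\ e (ueps eps (tf eps) - v_ i s0) <= mu / 2.
  by near: eps; exact: tfP.
have mul := half_lt mu0.
have epsI : 0 < eps < eps1 by apply/andP; split => //; near: eps; exact: nbhs_right_lt.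
have foll := follow eps (ueps eps) (tf eps) epsI (le_lt_trans h1 mul)
  (le_trans h2 (ltW mul)) (fun t => ueps_derive eps0).
have sM : `|s| <= `|M| + 1 by apply: (MK (`|M| + 1)) => //; rewrite (le_lt_trans (ler_norm M))// ltrDl.
have [|_] := foll (s - s0); first by rewrite (le_trans (ler_normB _ _))// lerD2r.
rewrite [s0 + _]addrC subrK.
have -> : tf eps + eps * (s - s0) = tf eps - eps * s0 + eps * s by ring.
move=> h3; apply: (le_lt_trans (norm_le_euclid _)); apply: (le_lt_trans h3).
exact: half_lt.
Unshelve. all: by end_near. Qed.

(** Every time has a neighbourhood in which one of three estimates holds: [final_time] at [T],
    [regular_time] away from the jumps and [jump_core] at a fold. Compactness of [[0, T]] then gives
    one threshold for [eps]. *)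
Lemma graph_limit : {uniform `[0, T],
  (fun t => dist_to (t, ueps eps t) (limit_graph T k t_ u_ v_ x_ u))
    @[eps --> 0^'+] --> (fun=> 0 : R)}.
Proof.
apply: uniform_cvgI => eta eta0; pose r := eta / 4.
have r0 : 0 < r by rewrite divr_gt0.
have r2 : 2 * r < eta by rewrite /r; lra.
have inG s : 0 <= s <= T -> limit_graph T k t_ u_ v_ x_ u (s, u s).
  by move=> sT; left; exists s => //; rewrite /= in_itv.
have [t tT|d d0 hd] := @segment_uniform _ 0 T (fun eps t =>
    0 <= dist_to (t, ueps eps t) (limit_graph T k t_ u_ v_ x_ u) <= 2 * r); last first.
  apply/near_at0P; exists d => // eps epsd t; rewrite /= in_itv /= => tT.
  have /andP[h1 h2] := hd eps t epsd tT.
  by rewrite subr0 ger0_norm//; exact: le_lt_trans r2.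
have [tE|tne] := eqVneq t T.
  have [d d0 /near_at0P[eps0 e0 hd]] := final_time r0.
  exists (Num.min (Num.min d r) eps0) => [|eps s]; first by rewrite !lt_min d0 r0.
  rewrite !lt_min tE => /andP[e1 /andP[_ e2]] sT /andP[/andP[sd sr] _].
  apply: (@dist_to_le _ _ _ _ (T, u T)) => /=.
  - by apply: inG; rewrite lexx ltW.
  - exact: ltW.
  rewrite (le_u_end lim); apply: hd => //; first by rewrite e1.
  by move: sd; rewrite ltr_norml => /andP[h _]; rewrite lerBlDr -lerBlDl; move: (ltW h); rewrite lerNl opprB.
have tT' : 0 <= t < T by case/andP: tT => -> ?; rewrite lt_neqAle tne.
have [[i ik tE]|reg] := pselect (exists2 i, (0 < i <= k)%N & t = t_ i); last first.
  have ne i : (0 < i <= k)%N -> t <> t_ i by move=> ik E; apply: reg; exists i.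
  have [d d0 /(_ _ r0)/near_at0P[eps0 e0 hd]] := regular_time tT' ne.
  exists (Num.min d eps0) => [|eps s]; first by rewrite lt_min d0.
  rewrite !lt_min => /andP[e1 /andP[_ e2]] sT /andP[sd _].
  apply: (dist_to_le (inG s sT)) => /=; first by rewrite subrr normr0 ltW.
  by apply: hd => //; rewrite e1.
have ik' : (0 < i < k)%N.
  case/andP: ik => -> /=; rewrite leq_eqVlt => /predU1P[ik|//].
  by move: tne; rewrite tE ik (le_tk lim) eqxx.
have [s0 core] := jump_core ik' (starts_all ik).
have [a [b [/andP[_ at_] /andP[tb _] /near_at0P[eps0 e0 hd]]]] := core r r0.
exists (Num.min (Num.min (t_ i - a) (b - t_ i)) (Num.min r eps0)) => [|eps s].
  by rewrite !lt_min !subr_gt0 at_ tb r0.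
rewrite !lt_min tE => /andP[e1 /andP[_ /andP[_ e2]]] sT.
move=> /andP[/andP[s1 s2] /andP[sr _]].
have epsI : 0 < eps < eps0 by rewrite e1.
have [_ hc _] := hd eps epsI; apply: (close_graph ik'); first exact: ltW.
apply: hc; move: s1 s2; rewrite !ltr_norml => /andP[h1 _] /andP[_ h2].
by apply/andP; split; lra.
Qed.

End Main.

Theorem theorem3p7 (R : realType) (n : nat) (T : R) (f : R -> 'rV[R]_n -> R)
  (T_gt0 : 0 < T)
  (A1 : assumption1 T f) (A2 : assumption2 T f)
  (A3 : assumption3 T f) (A4 : assumption4 T f)
  (y0 : 'rV[R]_n)
  (y0_crit : grad (f 0) y0 = 0) (y0_posdef : posdef (hess (f 0) y0))
  (k : nat) (t_ : nat -> R) (u_ v_ : nat -> R -> 'rV[R]_n)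
  (x_ : nat -> 'rV[R]_n) (u : R -> 'rV[R]_n)
  (u_lim : limit_evolution T f y0 k t_ u_ v_ x_ u)
  (yeps : R -> 'rV[R]_n) (ueps : R -> R -> 'rV[R]_n)
  (ueps_sol : forall eps : R, 0 < eps ->
    perturbed_solution T f eps (yeps eps) (ueps eps))
  (yeps_cvg : yeps eps @[eps --> 0^'+] --> y0) :
  [/\ forall K : set R, compact K ->
        K `<=` `[0, T] `\` [set t_ i | i in [set i | (0 < i <= k)%N]] ->
        {uniform K, ueps eps @[eps --> 0^'+] --> u},
      forall i, (0 < i < k)%N ->
        exists2 teps : R -> R,
          teps eps @[eps --> 0^'+] --> t_ i &
          forall K : set R, compact K ->
            {uniform K,
              (fun s => ueps eps (teps eps + eps * s)) @[eps --> 0^'+] --> v_ i}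
    & {uniform `[0, T],
        (fun t => dist_to (t, ueps eps t) (limit_graph T k t_ u_ v_ x_ u))
          @[eps --> 0^'+] --> (fun=> 0 : R)}].
Proof.
have [Cf _] := A1; have [_ _ _ A2T] := A2; split.
- exact: (uniform_away_from_jumps T_gt0 Cf u_lim ueps_sol yeps_cvg).
- exact: (jump_profile Cf u_lim ueps_sol yeps_cvg).
- exact: (graph_limit T_gt0 Cf A2T u_lim ueps_sol yeps_cvg).
Qed.
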